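(* For any partitions $\lambda$ and $\mu$, $$(A_\lambda,A_\mu)=R^2_{A_\lambda A_{-\mu}}(z)=\langle A_\lambda,A_\mu\rangle ,$$ where $z=s-s^{-1}$, $(\cdot,\cdot)$ is the inner product on $\mathcal{C}^+$ for which the elements $Q_\lambda$ are orthonormal, and $\langle\cdot,\cdot\rangle$ is the bilinear form on $\mathcal{C}^+$ defined by $2$-graded ruling polynomials.
   Context: **Skein algebra side.** Let $R'$ be the smallest subring of the field of rational functions in $a,s$ containing $\mathbb{Z}[a^{\pm1},s^{\pm1}]$ and the inverses of $s^r-s^{-r}$ for all $r\ge1$; put $z=s-s^{-1}$. $\mathcal{C}^+$ (over $R'$) is the subalgebra of the HOMFLY-PT skein algebra of the annulus generated by the basic fronts $A_m$, $m\ge1$ (defined below); by Turaev it is the free commutative unital $R'$-algebra on $A_1,A_2,\dots$, graded with $A_m$ in degree $m$, with linear basis $A_\lambda=A_{\lambda_1}\cdots A_{\lambda_\ell}$ over all partitions $\lambda$. Let $\Lambda$ be the algebra of symmetric functions over $R'$ with Schur functions $s_\lambda$, and let $(a|b)=(a+1,1,\dots,1)$ (with $b$ ones) be the hook partition of $a+b+1$. There is a (known) isomorphism of graded algebras $\mathcal{C}^+\cong\Lambda$ under which $Q_\lambda\in\mathcal{C}^+$ denotes the element corresponding to $s_\lambda$, and which is determined by $$A_m=\sum_{a+b=m-1,\ a,b\ge0}(-1)^b s^{a-b}Q_{(a|b)}\qquad(m\ge1).$$ The form $(\cdot,\cdot):\mathcal{C}^+\times\mathcal{C}^+\to R'$ is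 the $R'$-bilinear form with $(Q_\lambda,Q_\mu)=\delta_{\lambda,\mu}$. The form $\langle\cdot,\cdot\rangle$ is the bilinear form with $\langle A_\lambda,A_\mu\rangle=R^2_{A_\lambda A_{-\mu}}(z)$. **Fronts.** $J^1(S^1)=\{(x,y,z): x\in S^1,\ y,z\in\mathbb{R}\}$ carries the contact structure $\ker(dz-y\,dx)$. A Legendrian link is a smooth oriented link tangent to it, determined by its front projection $(x,y,z)\mapsto(x,z)$ to $S^1\times\mathbb{R}$; at a crossing the strand of smaller slope is on top. Fronts are taken generic (immersed apart from semicubical cusps, only transverse double points); a front is $\sigma$-generic if in addition all crossings and cusps have distinct $x$-coordinates. The product of fronts $K\cdot L$ stacks $K$ above $L$. For $m\ge1$, $A_m$ is the one-component front with $m-1$ crossings, no cusps, oriented to the right, that is the annular closure of the $m$-braid $\sigma_1\sigma_2\cdots\sigma_{m-1}$ (composed left to right, strands numbered top to bottom; $\sigma_i$ is the crossing of strands $i,i+1$); $A_{-m}$ is $A_m$ with reversed orientation; $A_\lambda=A_{\lambda_1}\cdots A_{\lambda_\ell}$, $A_{-\mu}=A_{-\mu_1}\cdots A_{-\mu_k}$. **Normal rulings.** Let $L$ be a $\sigma$-generic front, $\pi(x,z)=x$, $\Sigma\subset S^1$ the finite set of $x$-values of crossings and cusps, $L_x=L\cap\pi^{-1}(x)$. A normal ruling is a continuous map $\rho:L\setminus\pi^{-1}(\Sigma)\to L\setminus\pi^{-1}(\Sigma)$ with $\pi\circ\rho=\pi$ such that: each $\rho_x:L_x\to L_x$ is a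 fixed-point-free involution; the two strands meeting at a cusp are paired near it, and the pairing of the other strands agrees before and after the cusp; the two strands meeting at a crossing are not paired near it; near a crossing at $x_0$ there are a neighborhood $N$ of $x_0$ and continuous sections $f_1,\dots,f_n:N\to L$ of $\pi$ covering every point of $L\cap\pi^{-1}(N)$ exactly once, except the double point, covered by two of them, with each $\rho\circ f_i$ equal to some $f_j$ over $N\setminus\Sigma$; the two sections through the double point either cross transversally or switch strands at the crossing, and in the latter case the crossing is a switch; near a switch, the two vertical intervals joining the crossing strands to their companions are disjoint or nested. It is $2$-graded if $\rho$ always pairs a right-oriented strand with a left-oriented strand. $R^2_L(z)=\sum_\rho z^{j(\rho)}$ over $2$-graded normal rulings, $j(\rho)=\#(\text{switches})-\#(\text{right cusps})$; this is a Legendrian isotopy invariant (Chekanov–Pushkar). *)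

(* Defs.v *)
From HB Require Import structures.
From mathcomp Require Import all_boot all_order all_algebra.
From mathcomp Require Import perm.
From mathcomp.classical Require Import boolp.
From mathcomp.multinomials Require Import mpoly.

Set Implicit Arguments.
Unset Strict Implicit.
Unset Printing Implicit Defensive.

Import GRing.Theory.
Local Open Scope ring_scope.


(* Q(a,s), as the fraction field of Z[a][s]. *)
Definition ratfun : fieldType := {fraction {poly {poly int}}}.
Definition a_rf : ratfun := tofrac ('X%:P).
Definition s_rf : ratfun := tofrac 'X.

Inductive Rprime_gen : ratfun -> Prop :=
| Rprime_1 : Rprime_gen 1
| Rprime_sub x y : Rprime_gen x -> Rprime_gen y -> Rprime_gen (x - y)
| Rprime_mul x y : Rprime_gen x -> Rprime_gen y -> Rprime_gen (x * y)
| Rprime_a : Rprime_gen a_rf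
| Rprime_aV : Rprime_gen a_rf^-1
| Rprime_s : Rprime_gen s_rf
| Rprime_sV : Rprime_gen s_rf^-1
| Rprime_qint r : (0 < r)%N -> Rprime_gen (s_rf ^+ r - s_rf ^- r)^-1.

Definition in_Rprime : {pred ratfun} := fun x => `[< Rprime_gen x >].

Lemma in_RprimeP x : reflect (Rprime_gen x) (x \in in_Rprime).
Proof. exact: asboolP. Qed.

Fact in_Rprime_subring : subring_closed in_Rprime.
Proof.
split; first by apply/in_RprimeP/Rprime_1.
- by move=> x y /in_RprimeP hx /in_RprimeP hy; apply/in_RprimeP/Rprime_sub.
- by move=> x y /in_RprimeP hx /in_RprimeP hy; apply/in_RprimeP/Rprime_mul.
Qed.

HB.instance Definition _ :=
  GRing.isSubringClosed.Build ratfun in_Rprime in_Rprime_subring.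

Record Rprime : predArgType :=
  MkRprime { Rprime_val :> ratfun; _ : Rprime_val \in in_Rprime }.

HB.instance Definition _ := [isSub for Rprime_val].
HB.instance Definition _ := [Choice of Rprime by <:].
HB.instance Definition _ := [SubChoice_isSubComNzRing of Rprime by <:].

Definition Rprime_unit : {pred Rprime} :=
  fun x => (val x != 0) && ((val x)^-1 \in in_Rprime).
Definition Rprime_inv (x : Rprime) : Rprime :=
  if val x == 0 then x else insubd x (val x)^-1.

Fact Rprime_mulVx : {in Rprime_unit, left_inverse 1 Rprime_inv *%R}.
Proof.
move=> x /andP[x0 xV]; apply: val_inj.
by rewrite rmorphM /= /Rprime_inv (negPf x0) val_insubd xV mulVf.
Qed.

Fact Rprime_unitPl (x y : Rprime) : y * x = 1 -> x \in Rprime_unit.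
Proof.
move=> /(congr1 val); rewrite rmorphM rmorph1 /= => yx1.
have x0 : val x != 0 by apply: contra_eq_neq yx1 => ->; rewrite mulr0 eq_sym oner_eq0.
have xV : (val x)^-1 = val y by rewrite -[LHS]mul1r -yx1 mulfK.
by rewrite unfold_in x0 /= xV; apply: valP.
Qed.

Fact Rprime_invr_out : {in [predC Rprime_unit], Rprime_inv =1 id}.
Proof.
move=> x; rewrite inE unfold_in /Rprime_inv; case: eqP => //= _ xV.
by apply: val_inj; rewrite val_insubd (negPf xV).
Qed.

HB.instance Definition _ := GRing.ComNzRing_hasMulInverse.Build Rprime
  Rprime_mulVx Rprime_unitPl Rprime_invr_out.

Fact Rprime_idomain (x y : Rprime) : x * y = 0 -> (x == 0) || (y == 0).
Proof.
move=> /(congr1 val); rewrite rmorphM rmorph0 /= => /eqP.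
by rewrite mulf_eq0.
Qed.

HB.instance Definition _ := GRing.ComUnitRing_isIntegral.Build Rprime
  Rprime_idomain.

Definition sR : Rprime := MkRprime (introT (in_RprimeP _) Rprime_s).
(* [z = s - s^-1]; both [sR] and [zR] are units of R', so that integer
   exponents have their usual meaning. *)
Definition zR : Rprime := sR - sR^-1.

Lemma sR_unit : sR \is a GRing.unit.
Proof.
have s0 : s_rf != 0 by rewrite tofrac_eq0 polyX_eq0.
by apply/andP; split; [exact: s0 | apply/in_RprimeP/Rprime_sV].
Qed.

Lemma Rprime_valV x : x \is a GRing.unit -> Rprime_val x^-1 = (Rprime_val x)^-1.
Proof.
move=> ux; have := congr1 val (mulVr ux); rewrite rmorphM rmorph1 /= => h.
have x0 : Rprime_val x != 0.
  by apply: contra_eq_neq h => /= ->; rewrite mulr0 eq_sym oner_eq0.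
by apply: (mulIf x0); rewrite h mulVf.
Qed.

Lemma zR_unit : zR \is a GRing.unit.
Proof.
have zE : Rprime_val zR = s_rf ^+ 1 - s_rf ^- 1.
  by rewrite expr1 -[s_rf^-1](Rprime_valV sR_unit).
suff z0 : Rprime_val zR != 0.
  apply/andP; split; first exact: z0.
  by apply/in_RprimeP; move: (Rprime_qint (isT : 0 < 1)%N); rewrite -zE.
have s0 : s_rf != 0 by rewrite tofrac_eq0 polyX_eq0.
rewrite zE expr1 subr_eq0; apply/eqP => h.
have : s_rf ^+ 2 == 1 by rewrite expr2 {2}h mulfV.
rewrite /s_rf -tofracXn -tofrac1 tofrac_eq => /eqP.
move/(congr1 (fun p : {poly {poly int}} => size p)).
by rewrite size_polyXn size_poly1.
Qed.


Record intpart := IntPart {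
  parts :> seq nat;
  _ : sorted geq parts && all (fun i => (0 < i)%N) parts }.

HB.instance Definition _ := [isSub for parts].
HB.instance Definition _ := [Equality of intpart by <:].

Fact hook_proof a b :
  sorted geq (a.+1 :: nseq b 1%N) && all (fun i => (0 < i)%N) (a.+1 :: nseq b 1%N).
Proof.
apply/andP; split; last by rewrite /= all_nseq orbT.
by case: b => [|b] //=; elim: b.
Qed.
Definition hook a b : intpart := IntPart (hook_proof a b).


(* Following Macdonald, a symmetric function is a sequence [f_n] of symmetric
   polynomials in x_1, ..., x_n of bounded degree, each [f_n] being obtained
   from [f_(n+1)] by setting the last variable to 0. *)
Section SymmetricFunctions.
Variable R : comNzRingType.

Definition polyfam := forall n, {mpoly R[n]}.
HB.instance Definition _ := Choice.on polyfam.

Implicit Types f g h : polyfam.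

Definition polyfam_zero : polyfam := fun n => 0.
Definition polyfam_one : polyfam := fun n => 1.
Definition polyfam_opp f : polyfam := fun n => - f n.
Definition polyfam_add f g : polyfam := fun n => f n + g n.
Definition polyfam_mul f g : polyfam := fun n => f n * g n.
Definition polyfam_scale (c : R) f : polyfam := fun n => c *: f n.

Ltac pf := repeat move=> ?; apply: functional_extensionality_dep => n;
  rewrite /polyfam_add /polyfam_opp /polyfam_mul /polyfam_scale /polyfam_one /polyfam_zero /=.

Fact polyfam_addA : associative polyfam_add. Proof. by pf; rewrite addrA. Qed.
Fact polyfam_addC : commutative polyfam_add. Proof. by pf; rewrite addrC. Qed.
Fact polyfam_add0 : left_id polyfam_zero polyfam_add.
Proof. by pf; rewrite add0r. Qed.
Fact polyfam_addN : left_inverse polyfam_zero polyfam_opp polyfam_add.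
Proof. by pf; rewrite addNr. Qed.

HB.instance Definition _ := GRing.isZmodule.Build polyfam
  polyfam_addA polyfam_addC polyfam_add0 polyfam_addN.

Fact polyfam_mulA : associative polyfam_mul. Proof. by pf; rewrite mulrA. Qed.
Fact polyfam_mulC : commutative polyfam_mul. Proof. by pf; rewrite mulrC. Qed.
Fact polyfam_mul1 : left_id polyfam_one polyfam_mul.
Proof. by pf; rewrite mul1r. Qed.
Fact polyfam_mulDl : left_distributive polyfam_mul +%R.
Proof. by pf; rewrite mulrDl. Qed.
Fact polyfam_1neq0 : polyfam_one != 0.
Proof. by apply/eqP => /(congr1 (fun f : polyfam => f 0%N)) /eqP; rewrite oner_eq0. Qed.

HB.instance Definition _ := GRing.Zmodule_isComNzRing.Build polyfam
  polyfam_mulA polyfam_mulC polyfam_mul1 polyfam_mulDl polyfam_1neq0.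

Fact polyfam_scaleA b c f :
  polyfam_scale b (polyfam_scale c f) = polyfam_scale (b * c) f.
Proof. by pf; rewrite scalerA. Qed.
Fact polyfam_scale1 : left_id 1 polyfam_scale.
Proof. by pf; rewrite scale1r. Qed.
Fact polyfam_scaleDr : right_distributive polyfam_scale +%R.
Proof. by pf; rewrite scalerDr. Qed.
Fact polyfam_scaleDl f : {morph polyfam_scale^~ f : b c / b + c}.
Proof. by pf; rewrite scalerDl. Qed.

HB.instance Definition _ := GRing.Zmodule_isLmodule.Build R polyfam
  polyfam_scaleA polyfam_scale1 polyfam_scaleDr polyfam_scaleDl.

Fact polyfam_scaleAl c f g : c *: (f * g) = (c *: f) * g.
Proof. by apply: functional_extensionality_dep => n; apply: scalerAl. Qed.

HB.instance Definition _ := GRing.Lmodule_isLalgebra.Build R polyfam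
  polyfam_scaleAl.

(* Setting the last of n+1 variables to 0. *)
Definition drop_last n (p : {mpoly R[n.+1]}) : {mpoly R[n]} :=
  p \mPo [tuple if unlift ord_max i is Some j then 'X_j else 0 | i < n.+1].

Definition is_symfun : {pred polyfam} := fun f =>
  `[< [/\ forall n, f n \is symmetric,
          forall n, drop_last (f n.+1) = f n
        & exists d, forall n, (msize (f n) <= d)%N] >].

Fact is_symfun_subalg : subalg_closed is_symfun.
Proof.
have dlD n : {morph @drop_last n : p q / p + q}.
  by move=> p q; rewrite /drop_last comp_mpolyD.
have dlZ n c p : @drop_last n (c *: p) = c *: drop_last p.
  by rewrite /drop_last comp_mpolyZ.
have dlM n : {morph @drop_last n : p q / p * q}.
  by move=> p q; rewrite /drop_last rmorphM.
split.
- apply/asboolP; split=> [n|n|]; [exact: rpred1 | exact: rmorph1 |].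
  by exists 1%N => n; rewrite msize1.
- move=> c f g /asboolP[fs fr [d fd]] /asboolP[gs gr [e ge]].
  apply/asboolP; split=> [n|n|].
  + by apply: rpredD; [apply: rpredZ; apply: fs | apply: gs].
  + by rewrite dlD dlZ fr gr.
  + exists (maxn d e) => n; apply: leq_trans (msizeD_le _ _) _.
    by rewrite geq_max !leq_max (leq_trans (msizeZ_le _ _) (fd n)) ge orbT.
- move=> f g /asboolP[fs fr [d fd]] /asboolP[gs gr [e ge]].
  apply/asboolP; split=> [n|n|].
  + by apply: rpredM; [apply: fs | apply: gs].
  + by rewrite dlM fr gr.
  + exists (d + e).+1 => n; apply: leq_trans (msizeM_le _ _) _.
    by rewrite ltnS leq_add.
Qed.

HB.instance Definition _ :=
  GRing.isSubalgClosed.Build R polyfam is_symfun is_symfun_subalg.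

Record symfun : predArgType :=
  MkSymfun { symfun_val : polyfam; _ : symfun_val \in is_symfun }.

HB.instance Definition _ := [isSub for symfun_val].
HB.instance Definition _ := [Choice of symfun by <:].
HB.instance Definition _ := [SubChoice_isSubComNzRing of symfun by <:].
HB.instance Definition _ := [SubZmodule_isSubLmodule of symfun by <:].
HB.instance Definition _ := [SubNzRing_SubLmodule_isSubLalgebra of symfun by <:].
HB.instance Definition _ := GRing.Lalgebra_isComAlgebra.Build R symfun.

Definition symfun_at (f : symfun) n : {mpoly R[n]} := symfun_val f n.
Coercion symfun_at : symfun >-> Funclass.

(* The alternant a_(la + delta)(x_1, ..., x_n), delta = (n-1, ..., 1, 0). *)
Definition alternant n (la : seq nat) : {mpoly R[n]} :=
  \det (\matrix_(i < n, j < n) ('X_i ^+ (nth 0%N la j + (n - j.+1)) : {mpoly R[n]})).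

(* f is the Schur function s_la: s_la(x_1, ..., x_n) = a_(la+delta) / a_delta
   as soon as n is at least the length of la. *)
Definition is_schur (la : intpart) (f : symfun) : Prop :=
  forall n, (size la <= n)%N -> f n * alternant n [::] = alternant n la.

End SymmetricFunctions.


(* Imported only here, since its notation for multivariate polynomials would
   override the one used above. *)
From mathcomp.multinomials Require Import monalg.

(* By Turaev's theorem C^+ is the free commutative R'-algebra on A_1, A_2, ...;
   the generator A_m is the variable of index m-1. *)
Definition Cplus : comAlgType Rprime := {malg Rprime[{cmonom nat}]}.

(* Only meaningful for m >= 1. *)
Definition skA (m : nat) : Cplus :=
  (<< ucm m.-1 >> : {malg Rprime[{cmonom nat}]}).

Definition skA_part (la : intpart) : Cplus := \prod_(m <- la) skA m.


(* A sigma-generic front is recorded, up to isotopies preserving the vertical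
   fibres, by cutting S^1 at a point of S^1 \ Sigma, and reading from left to
   right the crossings and cusps.  The strands over a point of S^1 \ Sigma are
   numbered 0, 1, ... from top to bottom, and are described by the list of
   their orientations, [true] meaning oriented to the right.
   - [Crossing i]: strands i and i+1 cross;
   - [LeftCusp i b]: two strands, oriented by b and ~~ b, are created at a left
     cusp, and become strands i and i+1 on its right;
   - [RightCusp i]: strands i and i+1 end at a right cusp. *)
Inductive front_event :=
| Crossing of nat
| LeftCusp of nat & bool
| RightCusp of nat.

Definition event_ok (o : seq bool) (e : front_event) : bool :=
  match e with
  | Crossing i => (i.+1 < size o)%N
  | LeftCusp i _ => (i <= size o)%N
  | RightCusp i => (i.+1 < size o)%N && (nth true o i != nth true o i.+1)
  end.

Definition event_step (o : seq bool) (e : front_event) : seq bool :=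
  match e with
  | Crossing i =>
      take i o ++ [:: nth true o i.+1; nth true o i] ++ drop i.+2 o
  | LeftCusp i b => take i o ++ [:: b; ~~ b] ++ drop i o
  | RightCusp i => take i o ++ drop i.+2 o
  end.

Fixpoint events_run (o : seq bool) (es : seq front_event) (o' : seq bool) :=
  if es is e :: es' then event_ok o e && events_run (event_step o e) es' o'
  else o == o'.

Record front := MkFront {
  base : seq bool;
  events : seq front_event;
  front_closed : events_run base events base }.

(* S^1 \ Sigma consists of the intervals (gaps) between consecutive events;
   gap k lies after the first k events, so that gap 0 and gap (size events)
   are the two halves of the interval containing the cutting point (for a front
   without events: both are equal to the whole S^1 cut at that point). *)
Definition gap (L : front) (k : nat) : seq bool :=
  foldl event_step (base L) (take k (events L)).

Definition shift_event (n : nat) (e : front_event) : front_event :=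
  match e with
  | Crossing i => Crossing (n + i)
  | LeftCusp i b => LeftCusp (n + i) b
  | RightCusp i => RightCusp (n + i)
  end.

Definition reverse_event (e : front_event) : front_event :=
  if e is LeftCusp i b then LeftCusp i (~~ b) else e.

Lemma events_run_cat o es1 o1 es2 o2 :
  events_run o es1 o1 -> events_run o1 es2 o2 -> events_run o (es1 ++ es2) o2.
Proof. by elim: es1 o => [o /eqP<- //|e es IH o /= /andP[-> /= /IH]]; apply. Qed.

Lemma events_run_below es o o' p :
  events_run o es o' -> events_run (o ++ p) es (o' ++ p).
Proof.
have dropl i (q : seq bool) : (i <= size q)%N -> drop i (q ++ p) = drop i q ++ p.
  rewrite drop_cat leq_eqVlt => /predU1P[->|->] //.
  by rewrite ltnn subnn drop0 drop_size.
elim: es o => [o /= /eqP-> //|e es IH o /= /andP[ok /IH]].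
have -> : event_step (o ++ p) e = event_step o e ++ p.
  case: e ok => [i|i b|i] /= ok.
  - have ok' := ltnW ok.
    by rewrite !nth_cat ok ok' takel_cat ?(ltnW ok') // dropl // -!catA.
  - by rewrite takel_cat // dropl // -!catA.
  - case/andP: ok => ok _; have ok' := ltnW ok.
    by rewrite takel_cat ?(ltnW ok') // dropl // -!catA.
move=> ->; rewrite andbT.
case: e ok => [i|i b|i] /= ok; rewrite size_cat.
- by rewrite (leq_trans ok) ?leq_addr.
- by rewrite (leq_trans ok) ?leq_addr.
- case/andP: ok => ok; rewrite !nth_cat ok (ltnW ok) => ->.
  by rewrite (leq_trans ok) ?leq_addr.
Qed.

Lemma events_run_shift es o o' p :
  events_run o es o' ->
  events_run (p ++ o) (map (shift_event (size p)) es) (p ++ o').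
Proof.
have takeD i (q : seq bool) : take (size p + i) (p ++ q) = p ++ take i q.
  by rewrite take_cat ltnNge leq_addr /= addKn.
have dropD i (q : seq bool) : drop (size p + i) (p ++ q) = drop i q.
  by rewrite drop_cat ltnNge leq_addr /= addKn.
have nthD i (q : seq bool) : nth true (p ++ q) (size p + i) = nth true q i.
  by rewrite nth_cat ltnNge leq_addr /= addKn.
elim: es o => [o /= /eqP-> //|e es IH o /= /andP[ok /IH]].
have -> : event_step (p ++ o) (shift_event (size p) e) = p ++ event_step o e.
  by case: e ok => [i|i b|i] /= _; rewrite -?addnS ?takeD ?dropD ?nthD -?catA.
move=> ->; rewrite andbT.
by case: e ok => [i|i b|i] /=; rewrite size_cat -?addnS ?nthD ?ltn_add2l ?leq_add2l.
Qed.

Lemma events_run_reverse es o o' :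
  events_run o es o' ->
  events_run (map negb o) (map reverse_event es) (map negb o').
Proof.
elim: es o => [o /= /eqP-> //|e es IH o /= /andP[ok /IH]].
have nthN i : (i < size o)%N -> nth true (map negb o) i = ~~ nth true o i.
  by move=> h; rewrite (nth_map true).
have -> : event_step (map negb o) (reverse_event e) = map negb (event_step o e).
  case: e ok => [i|i b|i] /= ok; rewrite !map_cat /= ?map_take ?map_drop //.
  by rewrite !nthN // ltnW.
move=> ->; rewrite andbT.
case: e ok => [i|i b|i] /=; rewrite size_map //.
move=> /andP[ok]; rewrite !nthN // ?(ltnW ok) // ok /=.
by case: (nth _ _ _); case: (nth _ _ _).
Qed.

Fact front_empty_closed : events_run [::] [::] [::].
Proof. by []. Qed.
Definition front_empty : front := MkFront front_empty_closed.

(* K . L stacks K above L; the representative chosen has all the events of K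
   to the left of all those of L. *)
Fact front_mul_closed (K L : front) :
  events_run (base K ++ base L)
    (events K ++ map (shift_event (size (base K))) (events L))
    (base K ++ base L).
Proof.
apply: (@events_run_cat _ _ (base K ++ base L)).
  by apply: events_run_below; apply: front_closed.
by apply: events_run_shift; apply: front_closed.
Qed.
Definition front_mul (K L : front) : front := MkFront (front_mul_closed K L).

Fact front_rev_closed (L : front) :
  events_run (map negb (base L)) (map reverse_event (events L))
    (map negb (base L)).
Proof. by apply: events_run_reverse; apply: front_closed. Qed.
Definition front_rev (L : front) : front := MkFront (front_rev_closed L).

(* The closure of the m-braid sigma_1 ... sigma_(m-1), oriented to the right. *)
Fact frontA_closed (m : nat) :
  events_run (nseq m true) (map Crossing (iota 0 m.-1)) (nseq m true).
Proof.
have step i : (i.+1 < m)%N ->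
    event_step (nseq m true) (Crossing i) = nseq m true.
  move=> h /=; rewrite !nth_nseq h (ltnW h) take_nseq ?(ltnW (ltnW h)) //.
  rewrite drop_nseq; have := cat_nseq i [:: true, true & nseq (m - i.+2) true].
  by rewrite -[in RHS](subnKC h) !addSn -!addnS nseqD.
have : all (fun i => i.+1 < m)%N (iota 0 m.-1).
  apply/allP => i; rewrite mem_iota add0n => /andP[_].
  by case: m {step} => [|m].
elim: (iota 0 m.-1) => [|i s IH]; first by rewrite /= eqxx.
case/andP => h /IH {}IH; apply/andP; split; first by rewrite /= size_nseq.
rewrite -[X in is_true X]/(events_run (event_step (nseq m true) (Crossing i))
  (map Crossing s) (nseq m true)).
by rewrite (step _ h).
Qed.
Definition frontA (m : nat) : front := MkFront (frontA_closed m).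

Definition frontA_part (la : intpart) : front :=
  foldr (fun m L => front_mul (frontA m) L) front_empty la.
Definition frontAneg_part (mu : intpart) : front :=
  foldr (fun m L => front_mul (front_rev (frontA m)) L) front_empty mu.


Section Rulings.
Variable L : front.

(* A continuous fibre-preserving self-map of L \ pi^-1(Sigma) is given by a map
   of the set of strands over each gap (with a compatibility at the cutting
   point, see [normal_ruling]). *)
Definition ruling_data :=
  {dffun forall k : 'I_(size (events L)).+1,
     {ffun 'I_(size (gap L k)) -> 'I_(size (gap L k))}}.

Variable rho : ruling_data.

(* The companion, over gap k, of strand i. *)
Definition companion (k i : nat) : nat :=
  let k' := inord k in
  if insub i is Some j then val (rho k' j) else i.

Let nstrands k := size (gap L k).

(* The position, right of a left cusp creating strands i and i+1, of strand j
   on its left; dually for a right cusp. *)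
Definition around_cusp (i j : nat) : nat := if (j < i)%N then j else j.+2.

Definition transpose (i j : nat) : nat :=
  if j == i then i.+1 else if j == i.+1 then i else j.

(* The sections f_j near a crossing at strands i, i+1: in a switch (resp. a
   transversal crossing) the section starting at strand j on the left ends at
   strand j (resp. [transpose i j]) on the right. *)
Definition switched_at (k : nat) : bool :=
  [forall j : 'I_(nstrands k), companion k.+1 j == companion k j].
Definition crossed_at (k i : nat) : bool :=
  [forall j : 'I_(nstrands k),
     companion k.+1 (transpose i j) == transpose i (companion k j)].

(* The vertical intervals joining strands i and i+1 to their companions over
   gap k are disjoint or nested. *)
Definition normal_at (k i : nat) : bool :=
  let lo j := minn j (companion k j) in
  let hi j := maxn j (companion k j) in
  [|| hi i < lo i.+1, hi i.+1 < lo i,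
      (lo i < lo i.+1) && (hi i.+1 < hi i)
    | (lo i.+1 < lo i) && (hi i < hi i.+1)]%N.

Definition crossing_cond (k i : nat) : bool :=
  [&& companion k i != i.+1, companion k.+1 i != i.+1
    & crossed_at k i
      || [&& switched_at k, normal_at k i & normal_at k.+1 i]].

Definition left_cusp_cond (k i : nat) : bool :=
  (companion k.+1 i == i.+1)
  && [forall j : 'I_(nstrands k),
        companion k.+1 (around_cusp i j) == around_cusp i (companion k j)].

Definition right_cusp_cond (k i : nat) : bool :=
  (companion k i == i.+1)
  && [forall j : 'I_(nstrands k.+1),
        companion k (around_cusp i j) == around_cusp i (companion k.+1 j)].

Definition event_at (k : nat) : front_event := nth (Crossing 0) (events L) k.

Definition event_cond (k : nat) : bool :=
  match event_at k with
  | Crossing i => crossing_cond k i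
  | LeftCusp i _ => left_cusp_cond k i
  | RightCusp i => right_cusp_cond k i
  end.

Definition normal_ruling : bool :=
  [&& [forall k : 'I_(size (events L)).+1, forall j : 'I_(size (gap L k)),
         (rho k (rho k j) == j) && (rho k j != j)],
      [forall j : 'I_(nstrands 0), companion (size (events L)) j == companion 0 j]
    & [forall k : 'I_(size (events L)), event_cond k]].

Definition two_graded : bool :=
  [forall k : 'I_(size (events L)).+1, forall j : 'I_(size (gap L k)),
     nth true (gap L k) (rho k j) != nth true (gap L k) j].

Definition is_switch (k : nat) : bool :=
  if event_at k is Crossing i then switched_at k else false.

Definition is_right_cusp (e : front_event) : bool :=
  if e is RightCusp _ then true else false.

Definition ruling_index : int :=
  #|[set k : 'I_(size (events L)) | is_switch k]|%:Z
    - (count is_right_cusp (events L))%:Z.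

End Rulings.

(* [z] is to be taken invertible, [z ^ j] having an integer exponent. *)
Definition ruling_poly2 (R : comUnitRingType) (z : R) (L : front) : R :=
  \sum_(rho : ruling_data L | normal_ruling rho && two_graded rho)
     z ^ ruling_index rho.

(* Main.v *)
(* Both sides, multiplied by z^(l(lambda) + l(mu)), are the coefficient of
   u^lambda in the product over j of Y_(mu_j)(u), where
   sum_m Y_m(u) v^m = prod_i 1 / (1 - z^2 sum_(k >= 1) k (u_i v)^k).
   Symmetric functions: the hook formula for A_m says that the generating series
   H of the one-row Q's satisfies H(s v) = H(v / s) (1 + z sum_m A_m v^m), whence
   z A_m is the m-th coefficient of prod_k (1 - x_k v / s) / (1 - s x_k v).  By the
   symmetry of the resulting Cauchy kernel, the coordinates of A_mu in the basis
   Q_nu are coefficients of Jacobi-Trudi determinants, which are also the images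
   of Q_nu under the homomorphism A_m |-> Y_m / z.
   Rulings: over a gap, a 2-graded ruling of A_lambda A_(-mu) matches the right
   oriented strands with the left oriented ones, and each crossing is either
   crossed or switched.  The sequences of choices in the upper half cut the blocks
   of lambda into intervals; the condition that the ruling closes up determines
   the lower half by reading these intervals one after the other, starting
   anywhere in an interval of length k: this gives the factors k. *)

From HB Require Import structures.
Require Import Defs.
From mathcomp Require Import all_boot all_order all_algebra.
From mathcomp Require Import perm ring zify.
From mathcomp.classical Require Import boolp.
From mathcomp.finmap Require finmap.
From mathcomp.multinomials Require Import mpoly.
From mathcomp.multinomials Require monalg.

Set Implicit Arguments.
Unset Strict Implicit.
Unset Printing Implicit Defensive.

Import GRing.Theory.
Local Open Scope ring_scope.

(** * Formal power series *)

(** The kernel comes from the equation F(s v) = F(v / s) Y(v). It determines F from Y and the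
    constant term, since s^m - s^-m is never 0 for m > 0, and for the Y of the overview its solution
    is G(v) = prod_i (1 - u_i v / s) / (1 - s u_i v). Hence A_m |-> Y_m / z sends the one-row Q's to
    the coefficients of G, and orthonormality turns pairing with A_lambda, up to a power of z, into
    taking the coefficient of u^lambda in the image. For rulings, the normality conditions make the
    count multiplicative. At the top they force the intervals cut from one block of lambda to be met
    from the last to the first; at the bottom they force the intervals filling one block of mu to
    come from blocks of lambda of nonincreasing index. Only the lengths that each block of mu takes
    from each block of lambda remain free, besides the starting letters. The weight z^2 collects one
    z for a switch on each side; z^(l(lambda) + l(mu)) pays for the last interval of each block,
    which ends without a switch. *)

Definition fps (K : Type) : Type := nat -> K.

Section FpsRing.
Variable K : comNzRingType.
Implicit Types f g h : fps K.

HB.instance Definition _ := Choice.on (fps K).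

Definition fps_zero : fps K := fun _ => 0.
Definition fps_one : fps K := fun n => (n == 0%N)%:R.
Definition fps_opp f : fps K := fun n => - f n.
Definition fps_add f g : fps K := fun n => f n + g n.
Definition fps_mul f g : fps K := fun n => \sum_(i < n.+1) f i * g (n - i)%N.

Fact fps_addA : associative fps_add.
Proof. by move=> f g h; apply/funext => n; rewrite /fps_add addrA. Qed.
Fact fps_addC : commutative fps_add.
Proof. by move=> f g; apply/funext => n; rewrite /fps_add addrC. Qed.
Fact fps_add0 : left_id fps_zero fps_add.
Proof. by move=> f; apply/funext => n; rewrite /fps_add add0r. Qed.
Fact fps_addN : left_inverse fps_zero fps_opp fps_add.
Proof. by move=> f; apply/funext => n; rewrite /fps_add addNr. Qed.

HB.instance Definition _ := GRing.isZmodule.Build (fps K)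
  fps_addA fps_addC fps_add0 fps_addN.

(** Coefficients up to order [n] can be computed in [{poly K}], from which commutativity and
    associativity are inherited. *)
Definition trunc n f : {poly K} := \poly_(i < n.+1) f i.

Lemma coef_trunc n f i : (i <= n)%N -> (trunc n f)`_i = f i.
Proof. by rewrite coef_poly ltnS => ->. Qed.

Lemma coef_trunc_mul n f g i : (i <= n)%N ->
  (trunc n f * trunc n g)`_i = fps_mul f g i.
Proof.
move=> le_in; rewrite coefM; apply: eq_bigr => j _.
by rewrite !coef_trunc ?(leq_trans _ le_in) ?leq_subr // -ltnS.
Qed.

Fact fps_mulC : commutative fps_mul.
Proof.
move=> f g; apply/funext => n.
by rewrite -!(@coef_trunc_mul n) // mulrC.
Qed.

Fact fps_mulA : associative fps_mul.
Proof.
move=> f g h; apply/funext => n.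
have E u v w : fps_mul (fps_mul u v) w n = (trunc n u * trunc n v * trunc n w)`_n.
  rewrite coefM; apply: eq_bigr => i _.
  have le_in : (i <= n)%N by rewrite -ltnS.
  by rewrite coef_trunc_mul // coef_trunc ?leq_subr.
by rewrite E fps_mulC E; congr (_ `_ n); rewrite mulrC mulrA.
Qed.

Fact fps_mul1 : left_id fps_one fps_mul.
Proof.
move=> f; apply/funext => n; rewrite /fps_mul big_ord_recl /= mul1r subn0.
by rewrite big1 ?addr0 // => i _; rewrite mul0r.
Qed.

Fact fps_mulDl : left_distributive fps_mul fps_add.
Proof.
move=> f g h; apply/funext => n; rewrite /fps_mul /fps_add -big_split /=.
by apply: eq_bigr => i _; rewrite mulrDl.
Qed.

Fact fps_1neq0 : fps_one != 0.
Proof. by apply/eqP => /(congr1 (fun f => f 0%N)) /eqP; rewrite oner_eq0. Qed.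

HB.instance Definition _ := GRing.Zmodule_isComNzRing.Build (fps K)
  fps_mulA fps_mulC fps_mul1 fps_mulDl fps_1neq0.

Lemma fpsD f g n : (f + g) n = f n + g n. Proof. by []. Qed.
Lemma fpsN f n : (- f) n = - f n. Proof. by []. Qed.
Lemma fps0 n : (0 : fps K) n = 0. Proof. by []. Qed.
Lemma fps1 n : (1 : fps K) n = (n == 0%N)%:R. Proof. by []. Qed.
Lemma fpsM f g n : (f * g) n = \sum_(i < n.+1) f i * g (n - i)%N.
Proof. by []. Qed.

Lemma fps_sum I (r : seq I) (P : pred I) (F : I -> fps K) n :
  (\sum_(i <- r | P i) F i) n = \sum_(i <- r | P i) F i n.
Proof. by apply: (big_morph (fun f : fps K => f n)). Qed.

Lemma fpsM0 f g : (f * g) 0%N = f 0%N * g 0%N.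
Proof. by rewrite fpsM big_ord_recl big_ord0 addr0. Qed.

(** With v the variable of the series, this is c v; [fps_geom c] is 1 / (1 - c v), and [fps_scale c]
    below substitutes c v for v. *)
Definition fpsX (c : K) : fps K := fun n => if n == 1%N then c else 0.
Definition fps_geom (c : K) : fps K := fun n => c ^+ n.

Lemma fpsXM c f n : (fpsX c * f) n = if n is n'.+1 then c * f n' else 0.
Proof.
case: n => [|n]; first by rewrite fpsM0 mul0r.
rewrite fpsM big_ord_recl mul0r add0r big_ord_recl /= subSS subn0.
by rewrite big1 ?addr0 // => i _; rewrite mul0r.
Qed.

Lemma fps_geomV c : (1 - fpsX c) * fps_geom c = 1.
Proof.
apply/funext => n; rewrite mulrBl mul1r fpsD fpsN fpsXM fps1 /fps_geom.
by case: n => [|n]; rewrite ?subr0 // -exprS subrr.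
Qed.

Definition fps_scale (c : K) f : fps K := fun n => c ^+ n * f n.

Fact fps_scale_additive c : zmod_morphism (fps_scale c).
Proof.
move=> f g; apply/funext => n.
by rewrite !fpsD !fpsN /fps_scale !fpsD !fpsN mulrBr.
Qed.
Fact fps_scale_multiplicative c : monoid_morphism (fps_scale c).
Proof.
split; first by apply/funext => -[|n]; rewrite /fps_scale !fps1 ?mulr1 ?mulr0.
move=> f g; apply/funext => n; rewrite /fps_scale !fpsM mulr_sumr.
apply: eq_bigr => i _; rewrite mulrACA -exprD subnKC //.
by rewrite -ltnS.
Qed.
HB.instance Definition _ c :=
  GRing.isZmodMorphism.Build (fps K) (fps K) (fps_scale c) (fps_scale_additive c).
HB.instance Definition _ c :=
  GRing.isMonoidMorphism.Build (fps K) (fps K) (fps_scale c) (fps_scale_multiplicative c).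

Lemma fps_scaleX c d : fps_scale c (fpsX d) = fpsX (c * d).
Proof.
by apply/funext => -[|[|n]]; rewrite /fps_scale /fpsX //= ?mulr0 // expr1.
Qed.
Lemma fps_scale_geom c d : fps_scale c (fps_geom d) = fps_geom (c * d).
Proof. by apply/funext => n; rewrite /fps_scale /fps_geom exprMn. Qed.

End FpsRing.

Section FpsMap.
Variables (K L : comNzRingType) (phi : {rmorphism K -> L}).
Definition fps_map (f : fps K) : fps L := fun n => phi (f n).
Lemma fps_mapM f g : fps_map (f * g) = fps_map f * fps_map g.
Proof.
apply/funext => n; rewrite /fps_map !fpsM rmorph_sum.
by apply: eq_bigr => i _; rewrite rmorphM.
Qed.
Lemma fps_map_scale c f : fps_map (fps_scale c f) = fps_scale (phi c) (fps_map f).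
Proof. by apply/funext => n; rewrite /fps_map /fps_scale rmorphM rmorphXn. Qed.
End FpsMap.

(** * Jacobi-Trudi determinants and alternants *)

Section JacobiTrudi.
Variable K : comNzRingType.

(** The Jacobi-Trudi determinant with entries g_(nu_i - i + j); the test gives 0 at negative
    indices, which truncated subtraction would turn into index 0. *)
Definition JTdet (g : nat -> K) n (nu : seq nat) : K :=
  \det (\matrix_(i < n, j < n)
    if (i <= nth 0 nu i + j)%N then g (nth 0 nu i + j - i)%N else 0).

(** The last row of the larger matrix is (0, ..., 0, 1), because [nu] has no part there. *)
Lemma JTdetS g n nu : g 0%N = 1 -> (size nu <= n)%N ->
  JTdet g n.+1 nu = JTdet g n nu.
Proof.
move=> g0 le_nu; rewrite /JTdet (expand_det_row _ ord_max) (bigD1 ord_max) //=.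
rewrite big1 ?addr0 => [|j /eqP jn].
  rewrite !mxE (nth_default _ le_nu) add0n leqnn subnn g0 mul1r.
  rewrite /cofactor addnn -signr_odd odd_double expr0 mul1r; congr (\det _).
  apply/matrixP=> i j; rewrite !mxE !lift_max //.
rewrite !mxE (nth_default _ le_nu) add0n leqNgt.
suff -> : (j < n)%N by rewrite mul0r.
have := ltn_ord j; rewrite ltnS leq_eqVlt => /orP[/eqP jn'|//].
by case: jn; apply: val_inj.
Qed.

Lemma JTdet_le g n m nu : g 0%N = 1 -> (size nu <= n)%N -> (n <= m)%N ->
  JTdet g m nu = JTdet g n nu.
Proof.
move=> g0 le_nu /subnKC <-; elim: (m - n)%N => [|k IHk]; first by rewrite addn0.
by rewrite addnS JTdetS // (leq_trans le_nu) ?leq_addr.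
Qed.

Lemma JTdet_nil g n : g 0%N = 1 -> JTdet g n [::] = 1.
Proof. by move=> g0; rewrite (@JTdet_le _ 0) // /JTdet det_mx00. Qed.

Lemma JTdet1 g n m : g 0%N = 1 -> (0 < n)%N -> JTdet g n [:: m] = g m.
Proof.
move=> g0 n0; rewrite (@JTdet_le _ 1) // /JTdet [X in \det X]mx11_scalar.
by rewrite det_scalar1 !mxE /= addn0 subn0.
Qed.

Lemma JTdet_ext g g' n nu : g =1 g' -> JTdet g n nu = JTdet g' n nu.
Proof. by move=> eg; congr (\det _); apply/matrixP=> i j; rewrite !mxE eg. Qed.

Lemma fps_prod_lin (I : Type) (x : I -> K) (r : seq I) (P : pred I) m :
  (count P r < m)%N -> (\prod_(i <- r | P i) (1 - fpsX (x i))) m = 0.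
Proof.
elim: r m => [|i r IHr] m /=; first by rewrite big_nil fps1; case: m.
rewrite big_cons; case: (P i) => /=; last exact: IHr.
case: m => // m; rewrite add1n ltnS => lt_m.
by rewrite mulrBl mul1r fpsD fpsN fpsXM !IHr ?mulr0 ?subr0 // ltnW.
Qed.

(** Since 1 / (1 - x_k v) = P_k(v) h(v), where P_k is the product of the other factors 1 - x_l v,
    the matrix of powers is the Jacobi-Trudi matrix times a matrix of coefficients of the P_k. The
    case of the empty partition identifies the determinant of the latter with the Vandermonde
    determinant. *)
Lemma JT_alternant n (x : 'I_n -> K) (nu : seq nat) :
  \det (\matrix_(i < n, j < n) x i ^+ (nth 0 nu j + (n - j.+1))%N) =
  JTdet (\prod_k fps_geom (x k)) n nu *
  \det (\matrix_(i < n, j < n) x i ^+ (n - j.+1)%N).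
Proof.
set h := \prod_k _.
pose P k := \prod_(l | l != k) (1 - fpsX (x l)) : fps K.
pose M := \matrix_(l < n, k < n) P k (n - l.+1)%N.
have h0 : h 0%N = 1.
  rewrite /h; elim/big_rec: _ => [|i f _ IH]; first by rewrite fps1.
  by rewrite fpsM0 IH mulr1.
have geomE k : fps_geom (x k) = P k * h.
  rewrite /h (bigD1 k) //= mulrCA -big_split /= big1 ?mulr1 // => i _.
  exact: fps_geomV.
have powE k a : x k ^+ a =
    \sum_(i < n) if (i <= a)%N then P k i * h (a - i)%N else 0.
  have -> : x k ^+ a = fps_geom (x k) a by [].
  (* The sum may be cut at [a] because of the test, and at [n] because P_k has degree n - 1; both
     cuts are compared with the sum of length a.+1 + n. *)
  rewrite geomE fpsM; pose F i := if (i <= a)%N then P k i * h (a - i)%N else 0.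
  have -> : \sum_(i < a.+1) P k i * h (a - i)%N = \sum_(i < a.+1) F i.
    by apply: eq_bigr => i _; rewrite /F -ltnS ltn_ord.
  have E1 : \sum_(i < a.+1 + n) F i = \sum_(i < a.+1) F i.
    rewrite big_split_ord /= [X in _ + X]big1 ?addr0 // => i _.
    by rewrite /F ifF //=; lia.
  have E2 : \sum_(i < n + a.+1) F i = \sum_(i < n) F i.
    rewrite big_split_ord /= [X in _ + X]big1 ?addr0 // => i _.
    rewrite /F; case: ifP => // _; rewrite [P k _]fps_prod_lin ?mul0r //.
    rewrite -sum1_count (eq_bigl (fun i => i \in predC1 k)) // sum1_card cardC1 card_ord.
    by have := ltn_ord k; lia.
  by rewrite -E1 -E2 addnC.
have MJT (mu : seq nat) :
    \det (\matrix_(i < n, j < n) x i ^+ (nth 0 mu j + (n - j.+1))%N) =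
    JTdet h n mu * \det M.
  rewrite /JTdet -det_mulmx -[in LHS]det_tr; congr (\det _).
  apply/matrixP=> j k; rewrite !mxE powE (reindex_inj rev_ord_inj) /=.
  apply: eq_bigr => l _; rewrite !mxE.
  have lj := ltn_ord j; have ll := ltn_ord l.
  have E : ((n - l.+1 <= nth 0 mu j + (n - j.+1)) = (j <= nth 0 mu j + l))%N.
    move: (nth 0 mu j) => c.
    by apply/idP/idP; lia.
  rewrite E; case: ifP => [le|]; last by rewrite mul0r.
  rewrite mulrC; congr (h _ * _); lia.
have := MJT [::]; rewrite JTdet_nil // mul1r.
under [X in \det X]eq_mx do rewrite nth_nil add0n.
by move=> ->; exact: MJT.
Qed.

End JacobiTrudi.

Lemma rmorph_JTdet (K L : comNzRingType) (phi : {rmorphism K -> L}) g n nu :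
  phi (JTdet g n nu) = JTdet (phi \o g) n nu.
Proof.
rewrite /JTdet -det_map_mx; congr (\det _); apply/matrixP=> i j; rewrite !mxE.
by case: ifP => //; rewrite rmorph0.
Qed.

Section Alternants.
Variables (R : comNzRingType).

Lemma alternantE n nu : alternant R n nu =
  JTdet (\prod_(k < n) fps_geom 'X_k) n nu * alternant R n [::].
Proof.
rewrite /alternant JT_alternant; congr (_ * \det _).
by apply/matrixP=> i j; rewrite !mxE nth_nil.
Qed.
End Alternants.

Lemma trunc_prod (K : comNzRingType) (I : Type) (r : seq I) (f : I -> fps K) N m :
  (m <= N)%N -> (\prod_(k <- r) f k) m = (\prod_(k <- r) trunc N (f k))`_m.
Proof.
elim: r m => [|k r IHr] m le_mN; first by rewrite !big_nil coef1 fps1.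
rewrite !big_cons coefM fpsM; apply: eq_bigr => i _.
have le_im : (i <= m)%N by rewrite -ltnS.
rewrite coef_trunc ?(leq_trans le_im) // IHr //.
exact: leq_trans (leq_subr _ _) le_mN.
Qed.

Lemma fps_prodE (K : comNzRingType) (I : finType) (f : I -> fps K) M m :
  (m < M)%N ->
  (\prod_k f k) m =
  \sum_(b : {ffun I -> 'I_M} | (\sum_k b k == m)%N) \prod_k f k (b k).
Proof.
case: M => // M; rewrite ltnS => le_mM.
rewrite (trunc_prod _ _ le_mM) /trunc.
under eq_bigr do rewrite poly_def.
rewrite bigA_distr_bigA coef_sum [RHS]big_mkcond; apply: eq_bigr => b _ /=.
rewrite scaler_prod -(big_morph _ (exprD 'X) (expr0 'X)) coefZ coefXn eq_sym.
by case: eqP; rewrite ?mulr1 ?mulr0.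
Qed.

(** * Products of copies of one series, and the symmetry of their Cauchy kernel *)

Section Gser.
Variables (R : comNzRingType) (c : nat -> R).

Definition gser n : fps {mpoly R[n]} :=
  \prod_(k < n) ((fun i => c i *: 'X_k ^+ i) : fps {mpoly R[n]}).

Lemma gser0 n : c 0%N = 1 -> gser n 0%N = 1.
Proof.
move=> c0; rewrite /gser; elim/big_rec: _ => [|i f _ IH]; first by rewrite fps1.
by rewrite fpsM0 IH c0 expr0 scale1r mulr1.
Qed.

(** Each factor [gser n (mu j)] contributes a row of exponents, so the sum runs over the nonnegative
    integer matrices with row sums [mu] and column sums [a]; [M] bounds their entries. *)
Lemma gser_coefE n p (a : 'X_{1..n}) (mu : 'X_{1..p}) M :
  (mdeg a + mdeg mu < M)%N ->
  (\prod_(j < p) gser n (mu j))@_a =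
  \sum_(B : {ffun 'I_p -> {ffun 'I_n -> 'I_M}} |
        [forall j, \sum_k B j k == mu j]%N && [forall k, \sum_j B j k == a k]%N)
     \prod_j \prod_k c (B j k).
Proof.
move=> ltM.
under eq_bigr => j _.
  rewrite /gser (@fps_prodE _ _ _ M); last first.
    apply: leq_ltn_trans ltM; rewrite (leq_trans _ (leq_addl _ _)) //.
    by rewrite mdegE (bigD1 j) //= leq_addr.
  over.
rewrite bigA_distr_big_dep raddf_sum /= big_mkcondr /=.
apply: eq_big => [B|B _].
  by apply/familyP/forallP => h j; have := h j.
have -> : \prod_(i < p) \prod_(k < n) (c (B i k) *: 'X_k ^+ B i k) =
    (\prod_j \prod_k c (B j k)) *: 'X_[R, [multinom (\sum_j B j k)%N | k < n]].
  transitivity (\prod_(i < p) ((\prod_k c (B i k)) *: \prod_k 'X_k ^+ B i k : {mpoly R[n]})).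
    by apply: eq_bigr => i _; rewrite scaler_prod.
  rewrite scaler_prod [X in _ *: X]exchange_big /=; congr (_ *: _).
  rewrite mpolyXE_id; apply: eq_bigr => k _.
  by rewrite mnmE (big_morph _ (exprD 'X_k) (expr0 'X_k)).
rewrite mcoeffZ mcoeffX.
have -> : ([multinom (\sum_j B j k)%N | k < n] == a) =
   [forall k, \sum_j B j k == a k]%N.
  apply/eqP/forallP => [<- k|h]; first by rewrite mnmE.
  by apply/mnmP => k; rewrite mnmE; apply/eqP.
by case: ifP; rewrite ?mulr1 ?mulr0.
Qed.

(** Transposing the matrices of [gser_coefE] exchanges row sums and column sums and preserves the
    weights. *)
Lemma gser_coef_sym n p (a : 'X_{1..n}) (mu : 'X_{1..p}) :
  (\prod_(j < p) gser n (mu j))@_a = (\prod_(k < n) gser p (a k))@_mu.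
Proof.
pose M := (mdeg a + mdeg mu).+1.
rewrite (@gser_coefE _ _ _ _ M) // (@gser_coefE _ _ _ _ M); last by rewrite addnC.
pose tr n p (B : {ffun 'I_p -> {ffun 'I_n -> 'I_M}}) : {ffun 'I_n -> {ffun 'I_p -> 'I_M}} :=
  [ffun k => [ffun j => B j k]].
have trK n' p' : cancel (@tr n' p') (@tr p' n').
  by move=> B; apply/ffunP => j; rewrite ffunE; apply/ffunP => k; rewrite !ffunE.
rewrite (reindex (@tr p n)) /=; last by exists (@tr n p) => B _; exact: trK.
apply: eq_big => [B|B _].
  rewrite andbC; congr (_ && _); apply: eq_forallb => j;
    by under eq_bigr do rewrite !ffunE.
rewrite exchange_big; apply: eq_bigr => j _; apply: eq_bigr => k _.
by rewrite !ffunE.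
Qed.

Lemma gser_coef_mdeg n p (a : 'X_{1..n}) (mu : 'X_{1..p}) :
  mdeg a != mdeg mu -> (\prod_(j < p) gser n (mu j))@_a = 0.
Proof.
move=> neq; rewrite (gser_coefE (ltnSn _)) big_pred0 // => B.
apply: contraNF neq => /andP[/forallP h /forallP k].
rewrite !mdegE -(eq_bigr _ (fun j _ => eqP (h j))).
by rewrite -(eq_bigr _ (fun j _ => eqP (k j))) exchange_big.
Qed.

Lemma mcoeffXM n (m a : 'X_{1..n}) (f : {mpoly R[n]}) :
  ('X_[m] * f)@_a = if (m <= a)%MM then f@_(a - m) else 0.
Proof.
case: ifP => [le|nle].
  by rewrite mulrC -{1}(submK le) addmC mcoeffMX.
apply: memN_msupp_eq0; apply: contraFN nle.
move=> /msuppM_le/allpairsP[[m1 m2] /= [+ _ ->]].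
by rewrite msuppX inE => /eqP ->; apply: lem_addr.
Qed.

(** The exponent nu + delta. *)
Definition shift_mon n (nu : seq nat) : 'X_{1..n} :=
  [multinom (nth 0 nu i + (n - i.+1))%N | i < n].

Lemma mpoly_signZ n (b : bool) (p : {mpoly R[n]}) : (-1) ^+ b * p = (-1) ^+ b *: p.
Proof. by case: b; rewrite ?expr1 ?expr0 ?mulN1r ?mul1r ?scaleN1r ?scale1r. Qed.

Lemma alternant_expand n nu : alternant R n nu =
  \sum_(w : 'S_n) (-1) ^+ w *: 'X_[R, [multinom shift_mon n nu (w i) | i < n]].
Proof.
rewrite /alternant /determinant; apply: eq_bigr => w _.
apply: etrans (mpoly_signZ _ _) _; congr (_ *: _).
by rewrite mpolyXE_id; apply: eq_bigr => i _; rewrite mxE !mnmE.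
Qed.

(** The term of a permutation w in the alternant asks for the coefficient at nu + delta - w(delta)
    of the product of the [gser n (mu j)]. By [gser_coef_sym] this is the coefficient at [mu] of the
    product of the [gser p] of index nu_i - i + w(i), which is the term of w in the determinant. *)
Lemma alternant_gser_coef n p (mu : 'X_{1..p}) nu :
  (alternant R n [::] * \prod_(j < p) gser n (mu j))@_(shift_mon n nu) =
  (JTdet (gser p) n nu)@_mu.
Proof.
rewrite alternant_expand mulr_suml /JTdet /determinant !raddf_sum /=.
apply: eq_bigr => w _; rewrite -scalerAl mcoeffZ mcoeffXM.
apply: etrans (esym (congr1 (mcoeff mu) (mpoly_signZ _ _))); rewrite mcoeffZ.
set le := (_ <= _)%MM; set f := \prod_j _; set P := \prod_i _.
suff -> : P@_mu = if le then f@_(shift_mon n nu -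
     [multinom shift_mon n [::] (w i) | i < n])%MM else 0.
  by [].
have leE : le = [forall i : 'I_n, (i <= nth 0%N nu i + w i)%N].
  apply/mnm_lepP/forallP => h i; have := h i; rewrite !mnmE nth_nil;
  have := ltn_ord i; have := ltn_ord (w i); move: (nth _ _ _); lia.
rewrite leE /P; case: forallP => [h|/forallP].
  rewrite gser_coef_sym; congr (_@_mu); apply: eq_bigr => i _; rewrite mxE h.
  congr (gser p _); rewrite !mnmE nth_nil.
  have := ltn_ord i; have := ltn_ord (w i); have := h i; move: (nth _ _ _); lia.
rewrite negb_forall => /existsP[i ni].
by rewrite (bigD1 i) //= mxE (negPf ni) mul0r mcoeff0.
Qed.

End Gser.

(** * Partitions and the exponents nu + delta *)

Section Partitions.

Lemma intpart_sorted (nu : intpart) : sorted geq nu.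
Proof. by have /andP[] := valP nu. Qed.

Lemma intpart_gt0 (nu : intpart) : all (fun i => (0 < i)%N) nu.
Proof. by have /andP[] := valP nu. Qed.

Lemma geq_trans : transitive geq.
Proof. by move=> a b c /= ab ca; exact: leq_trans ca ab. Qed.

Lemma intpart_nth_le (nu : intpart) i j : (i <= j)%N -> (nth 0 nu j <= nth 0 nu i)%N.
Proof.
move=> ij; have [lt_j|le_j] := ltnP j (size nu); last by rewrite nth_default.
have lt_i := leq_ltn_trans ij lt_j.
exact: (sorted_leq_nth geq_trans leqnn 0%N (intpart_sorted nu)).
Qed.

Lemma intpart_ext (nu ka : intpart) : (forall i, nth 0 nu i = nth 0 ka i)%N -> nu = ka.
Proof.
move=> eq_nth; apply: val_inj => /=.
have le (a b : intpart) : (forall i, nth 0 a i = nth 0 b i)%N -> (size a <= size b)%N.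
  move=> e; rewrite leqNgt; apply/negP => lt.
  have := all_nthP 0%N (intpart_gt0 a) _ lt.
  by rewrite e nth_default.
apply: (@eq_from_nth _ 0%N) => [|i _]; last exact: eq_nth.
by apply/eqP; rewrite eqn_leq !le.
Qed.

Lemma nth_filter_pos (s : seq nat) i : sorted geq s ->
  nth 0%N [seq x <- s | (0 < x)%N] i = nth 0%N s i.
Proof.
elim: s i => [|x s IHs] i //= srt; case: posnP => [x0|_].
  have /allP s0 : all (geq x) s by apply: order_path_min srt; exact: geq_trans.
  have E : all (fun y => y == 0%N) s.
    by apply/allP => y /s0 /=; rewrite x0 leqn0.
  have -> : [seq x <- s | (0 < x)%N] = [::].
    apply/eqP; rewrite -[_ == _]negbK -has_filter -all_predC.
    by apply: sub_all E => y /eqP ->.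
  have s00 : nth 0%N s =1 (fun _ => 0%N).
    move=> j; have [lt|ge] := ltnP j (size s); last by rewrite nth_default.
    by have /eqP := all_nthP 0%N E _ lt.
  by rewrite nth_nil; case: i => //= i; rewrite s00.
by case: i => //= i; apply/IHs/(path_sorted srt).
Qed.

Lemma pos_part_proof (s : seq nat) : sorted geq s ->
  sorted geq [seq x <- s | (0 < x)%N] && all (fun i => (0 < i)%N) [seq x <- s | (0 < x)%N].
Proof.
move=> srt; rewrite sorted_filter ?filter_all //; exact: geq_trans.
Qed.

Lemma intpart_of_sorted (s : seq nat) : sorted geq s ->
  exists2 nu : intpart, (size nu <= size s)%N & forall i, nth 0%N nu i = nth 0%N s i.
Proof.
move=> srt; exists (IntPart (pos_part_proof srt)) => [|i] /=.
  by rewrite size_filter count_size.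
exact: nth_filter_pos.
Qed.

Lemma shift_mon_lt n (nu : intpart) (i j : 'I_n) : (i < j)%N ->
  (shift_mon n nu j < shift_mon n nu i)%N.
Proof.
move=> ij; rewrite !mnmE; have := intpart_nth_le nu (ltnW ij).
by have := ltn_ord j; lia.
Qed.

Lemma shift_mon_inj n (nu : intpart) : injective (shift_mon n nu).
Proof.
move=> i j e; case: (ltngtP (val i) (val j)) => [lt|lt|/val_inj //].
  by have := @shift_mon_lt n nu i j lt; rewrite e ltnn.
by have := @shift_mon_lt n nu j i lt; rewrite e ltnn.
Qed.

(** Both exponents are strictly decreasing, and a strictly decreasing list is determined by its set
    of values. *)
Lemma shift_mon_perm n (nu ka : intpart) (w : 'S_n) :
  (size nu <= n)%N -> (size ka <= n)%N ->
  (forall i, shift_mon n nu (w i) = shift_mon n ka i) -> w = 1%g /\ nu = ka.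
Proof.
move=> snu ska e.
pose f (m : intpart) := [seq shift_mon n m i | i <- enum 'I_n].
have srt m : sorted gtn (f m).
  rewrite sorted_map; have := iota_ltn_sorted 0 n; rewrite -val_enum_ord sorted_map.
  by apply: sub_sorted => i j; exact: shift_mon_lt.
have ff : f nu = f ka.
  apply: (@irr_sorted_eq _ gtn) => // [a b c|a|x].
  - by move=> /= ab ca; exact: ltn_trans ab.
  - by rewrite /= ltnn.
  apply/mapP/mapP => -[i _ ->]; last by exists (w i); rewrite ?mem_enum.
  by exists ((w^-1)%g i); rewrite ?mem_enum // -e permKV.
have e1 i : shift_mon n nu i = shift_mon n ka i.
  by have /eq_in_map h := ff; apply: h; rewrite mem_enum.
split; first by apply/permP => i; rewrite perm1; apply: (@shift_mon_inj _ nu); rewrite e e1.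
apply: intpart_ext => i; have [lt|ge] := ltnP i n; last first.
  by rewrite !nth_default ?(leq_trans _ ge).
by have := e1 (Ordinal lt); rewrite !mnmE => /eqP; rewrite eqn_add2r => /eqP.
Qed.

End Partitions.

(** * Antisymmetric polynomials *)

Section Antisymmetric.
Variables (R : idomainType) (n : nat).
Hypothesis R2 : 2%:R != 0 :> R.

Lemma msym_alternant nu (s : 'S_n) :
  msym s (alternant R n nu) = (-1) ^+ s *: alternant R n nu.
Proof.
rewrite !alternant_expand raddf_sum scaler_sumr (reindex_inj (mulgI s)) /=.
apply: eq_bigr => w _; rewrite msymZ msymX scalerA -signr_addb -odd_permM.
congr (_ *: 'X_[_]).
by apply/mnmP => i; rewrite !mnmE permM permKV.
Qed.

Lemma alternant_coef (nu ka : intpart) : (size nu <= n)%N -> (size ka <= n)%N ->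
  (alternant R n nu)@_(shift_mon n ka) = (nu == ka)%:R.
Proof.
move=> snu ska; rewrite alternant_expand raddf_sum /= (bigD1 (1%g : 'S_n)) //= [X in _ + X]big1.
  rewrite addr0 mcoeffZ mcoeffX odd_perm1 expr0 mul1r; congr ((_ : bool)%:R).
  apply/eqP/eqP => [e|->]; last by apply/mnmP => i; rewrite mnmE perm1.
  by case: (@shift_mon_perm n nu ka 1%g snu ska) => // i; rewrite -e mnmE.
move=> w w1; rewrite mcoeffZ mcoeffX; case: eqP => [e|_]; last by rewrite mulr0.
case/eqP: w1; case: (@shift_mon_perm n nu ka w snu ska) => // i.
by rewrite -e mnmE.
Qed.

(** The coefficient at an exponent with a repeated entry is its own opposite, hence 0 by [R2]. Any
    other exponent is sorted into some nu + delta by a permutation, which changes the coefficient by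
    a sign only. *)
Lemma antisym_eq0 (G : {mpoly R[n]}) :
  (forall s : 'S_n, msym s G = (-1) ^+ s *: G) ->
  (forall nu : intpart, (size nu <= n)%N -> G@_(shift_mon n nu) = 0) -> G = 0.
Proof.
move=> Gs G0; apply/mpolyP => m; rewrite mcoeff0.
have Gm (s : 'S_n) : G@_[multinom m (s i) | i < n] = (-1) ^+ s * G@_m.
  by rewrite -mcoeff_sym Gs mcoeffZ.
case: (boolP (injectiveb m)) => [/injectiveP m_inj|]; last first.
  case/injectivePn => i [j ij mij].
  have := Gm (tperm i j); rewrite odd_tperm ij expr1 mulN1r.
  have -> : [multinom m (tperm i j k) | k < n] = m.
    by apply/mnmP => k; rewrite mnmE; case: tpermP => // ->.
  move/eqP; rewrite -addr_eq0 -mulr2n -mulr_natl mulf_eq0 (negPf R2) /=.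
  by move/eqP.
have szt : size (sort geq m) == n by rewrite size_sort size_tuple.
have /tuple_permP[s ms] : perm_eq (Tuple szt) m by rewrite perm_sort.
have tE i : nth 0%N (sort geq m) i = if insub i is Some k then m (s k) else 0%N.
  case: insubP => [k lt_i vk|ge]; last first.
    by rewrite nth_default // (eqP szt) leqNgt.
  have /= -> := congr1 (fun t => nth 0%N t i) ms.
  by rewrite -vk -(tnth_nth 0%N [tuple tnth m (s i) | i < n] k) tnth_mktuple.
pose t := sort geq m.
have t_srt : sorted geq t by apply: sort_sorted => a b; exact: leq_total.
have t_lt i j : (i < j < n)%N -> (nth 0%N t j < nth 0%N t i)%N.
  case/andP=> ij jn; have i_n := ltn_trans ij jn; rewrite ltn_neqAle; apply/andP; split.
    rewrite !tE !insubT /=; apply/eqP => /m_inj/perm_inj/(congr1 val) /= e.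
    by rewrite e ltnn in ij.
  by apply: (sorted_leq_nth geq_trans leqnn 0%N t_srt); rewrite ?inE ?(eqP szt) // ltnW.
(* Strictly decreasing entries dominate those of delta, so that subtracting delta from the sorted
   exponent leaves a partition. *)
have t_ge i : (i < n)%N -> (n - i.+1 <= nth 0%N t i)%N.
  move=> lt_in; rewrite -(subnKC lt_in); move: (n - _)%N (subnKC lt_in) => k e.
  elim: k i lt_in e => [|k IHk] i lt_in e; first by rewrite addn0 subnn.
  have lt_i : (i.+1 < n)%N by lia.
  have := IHk i.+1 lt_i; have := t_lt i i.+1; lia.
pose u := mkseq (fun i => nth 0%N t i - (n - i.+1))%N n.
have u_srt : sorted geq u.
  apply/(sortedP 0%N) => i; rewrite size_mkseq => lt_i.
  rewrite !nth_mkseq //; last lia.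
  have := t_lt i i.+1; have := t_ge i; have := t_ge i.+1; rewrite /=; lia.
have [nu snu nuE] := intpart_of_sorted u_srt.
rewrite size_mkseq in snu.
have sE : shift_mon n nu = [multinom m (s i) | i < n].
  apply/mnmP => i; rewrite !mnmE nuE nth_mkseq // subnK ?t_ge //.
  by rewrite tE valK.
have := Gm s; rewrite -sE G0 // => /esym/eqP.
by rewrite mulf_eq0 signr_eq0 /= => /eqP.
Qed.

End Antisymmetric.

(** * Schur functions of rows and hooks *)

Definition intpart0 : intpart := @IntPart [::] isT.

Fact rowp_proof m : sorted geq (nseq (0 < m) m) && all (fun i => (0 < i)%N) (nseq (0 < m) m).
Proof. by case: m. Qed.
Definition rowp m : intpart := IntPart (rowp_proof m).

Lemma size_rowp m : (size (rowp m) <= 1)%N.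
Proof. by rewrite size_nseq; case: (0 < m)%N. Qed.

Lemma nth_rowp m i : nth 0%N (rowp m) i = if i is 0 then m else 0%N.
Proof. by case: m i => [|m] [|[|i]]. Qed.

(** The values in few variables follow from those in many by setting the last variables to 0. *)
Lemma symfun_ext (R : comNzRingType) (f g : symfun R) n0 :
  (forall n, (n0 <= n)%N -> f n = g n) -> f = g.
Proof.
move=> e; apply/val_inj/functional_extensionality_dep => n.
have [d] := ubnP (n0 - n)%N; elim: d n => // d IHd n lt_d.
have [/e //|lt_n] := leqP n0 n.
have /asboolP[_ fr _] := valP f; have /asboolP[_ gr _] := valP g.
rewrite -[LHS]fr -[RHS]gr; congr drop_last; apply: IHd; lia.
Qed.

Section Cramer.
Variables (R : idomainType) (n : nat).
Local Notation aD := (alternant R n [::]).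

Lemma alternant_nil_neq0 : aD != 0.
Proof.
have := @alternant_coef R n intpart0 intpart0 isT isT; rewrite eqxx.
by apply: contra_eq_neq => ->; rewrite mcoeff0 eq_sym oner_eq0.
Qed.

(** Take the rows of x_1, ..., x_n and once more that of x_k, with exponents a + n, n - 1, ..., 0,
    and expand the vanishing determinant along the repeated row. Removing the exponent n - 1 - i
    leaves the exponents of the hook (a|i) plus delta. *)
Lemma alternant_hook_Cramer a (k : 'I_n) :
  'X_k ^+ (a + n) * aD =
  \sum_(i < n) (-1) ^+ i * 'X_k ^+ (n - i.+1) * alternant R n (hook a i).
Proof.
pose e (j : 'I_n.+1) : nat := if unlift ord0 j is Some l then (n - (l : nat).+1)%N else (a + n)%N.
pose y (i : 'I_n.+1) : {mpoly R[n]} := if unlift ord_max i is Some l then 'X_l else 'X_k.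
pose B := \matrix_(i, j) y i ^+ e j.
have detB : \det B = 0.
  apply: (determinant_alternate (i1 := ord_max) (i2 := lift ord_max k)).
    by rewrite neq_lift.
  by move=> j; rewrite !mxE /y unlift_none liftK.
rewrite (expand_det_row _ ord_max) big_ord_recl in detB.
have E0 : B ord_max ord0 * cofactor B ord_max ord0 = (-1) ^+ n * ('X_k ^+ (a + n) * aD).
  rewrite mxE /y unlift_none /e unlift_none /cofactor addn0 mulrCA; congr (_ * (_ * \det _)).
  by apply/matrixP => i j; rewrite !mxE /y liftK /e liftK nth_nil add0n.
have detE (i : 'I_n) : \det (row' ord_max (col' (lift ord0 i) B)) = alternant R n (hook a i).
  rewrite /alternant; apply: congr1; apply/matrixP => p q; rewrite !mxE /y liftK; congr (_ ^+ _).
  have -> : nth 0%N (hook a i) q = if val q is 0 then a.+1 else if (q <= i)%N then 1%N else 0%N.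
    by rewrite /=; case: (val q) => [|q'] //=; rewrite nth_nseq.
  rewrite /e; case: unliftP => [t|] /(congr1 val); rewrite /= /bump /=;
    have := ltn_ord q; have := ltn_ord i; case: (val q) => [|q'] /=.
  - lia.
  - by case: ifP; lia.
  - lia.
  - by case: ifP; lia.
have E1 i : B ord_max (lift ord0 i) * cofactor B ord_max (lift ord0 i) =
    - (-1) ^+ n * ((-1) ^+ i * 'X_k ^+ (n - i.+1) * alternant R n (hook a i)).
  have -> : cofactor B ord_max (lift ord0 i) =
      (-1) ^+ (n + i.+1) * alternant R n (hook a i).
    rewrite /cofactor lift0 /=; congr (_ * _); exact: detE.
  rewrite mxE /y unlift_none /e liftK exprD exprS.
  by move: (alternant _ _ _) => al; ring.
move: detB; rewrite E0 (eq_bigr _ (fun i _ => E1 i)) -mulr_sumr mulNr => /eqP.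
rewrite subr_eq0 => /eqP; apply: mulfI.
by rewrite expf_neq0 // oppr_eq0 oner_eq0.
Qed.

Lemma det_first_col (t : nat) (n_gt0 : (0 < n)%N) :
  \det (\matrix_(i < n, j < n) ('X_i ^+ (if j == 0 :> nat then t else n - j.+1)%N : {mpoly R[n]}))
  = \sum_(k < n) 'X_k ^+ t * cofactor (\matrix_(i < n, j < n) ('X_i ^+ (n - j.+1)%N : {mpoly R[n]})) k (Ordinal n_gt0).
Proof.
rewrite (expand_det_col _ (Ordinal n_gt0)); apply: eq_bigr => k _; rewrite mxE /=.
congr (_ * (_ * \det _)); apply/matrixP => i j; by rewrite !mxE.
Qed.

Lemma det_first_col_row t : (n.-1 <= t)%N -> (0 < n)%N ->
  \det (\matrix_(i < n, j < n) ('X_i ^+ (if j == 0 :> nat then t else n - j.+1)%N : {mpoly R[n]}))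
  = alternant R n (rowp (t - n.-1)).
Proof.
move=> le_t n0; congr (\det _); apply/matrixP => i j; rewrite !mxE nth_rowp.
by case: (val j) => [|j'] //=; congr (_ ^+ _); lia.
Qed.

(** Column 0 then repeats column n - 1 - t. *)
Lemma det_first_col0 t : (t < n.-1)%N ->
  \det (\matrix_(i < n, j < n) ('X_i ^+ (if j == 0 :> nat then t else n - j.+1)%N : {mpoly R[n]}))
  = 0.
Proof.
move=> lt_t; rewrite -det_tr.
have n0 : (0 < n)%N by lia.
have n1 : (n - t.+1 < n)%N by lia.
apply: (determinant_alternate (i1 := Ordinal n0) (i2 := Ordinal n1)).
  by rewrite -val_eqE /=; lia.
move=> j; rewrite !mxE /=; case: eqP => [|_]; first by lia.
congr (_ ^+ _); lia.
Qed.

(** Divide [alternant_hook_Cramer] by the Vandermonde determinant, multiply by x_k^M, and sum over k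
    against the cofactors of the first Vandermonde column. A power x_k^t becomes the alternant of
    the row t - (n - 1), or 0 when t < n - 1, which cuts the sum at i = M. *)
Lemma hook_row_recurrence a M (q r : nat -> {mpoly R[n]}) :
  (forall i, (i < n)%N -> q i * aD = alternant R n (hook a i)) ->
  (forall m, r m * aD = alternant R n (rowp m)) -> (M < n)%N ->
  r (a + M.+1)%N = \sum_(i < M.+1) (-1) ^+ i * q i * r (M - i)%N.
Proof.
move=> qE rE lt_M; have n0 : (0 < n)%N by lia.
have D0 := alternant_nil_neq0.
have Cr k : 'X_k ^+ (a + n) = \sum_(i < n) (-1) ^+ i * q i * 'X_k ^+ (n - i.+1).
  apply: (mulIf D0); rewrite alternant_hook_Cramer mulr_suml.
  by apply: eq_bigr => i _; rewrite -qE //; ring.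
apply: (mulIf D0); rewrite rE.
have -> : (a + M.+1)%N = (a + n + M - n.-1)%N by lia.
rewrite -det_first_col_row //; last by lia.
rewrite (det_first_col _ n0).
under eq_bigr do rewrite exprD Cr mulr_suml mulr_suml.
rewrite exchange_big /=.
pose F i := if (i <= M)%N then (-1) ^+ i * q i * r (M - i)%N * aD else 0.
transitivity (\sum_(i < n) F i).
  apply: eq_bigr => i _.
  transitivity ((-1) ^+ i * q i * \sum_(k < n) 'X_k ^+ (n - i.+1 + M) *
      cofactor (\matrix_(i < n, j < n) ('X_i ^+ (n - j.+1)%N : {mpoly R[n]})) k (Ordinal n0)).
    by rewrite mulr_sumr; apply: eq_bigr => k _; rewrite exprD !mulrA.
  rewrite -det_first_col /F; have lt_i := ltn_ord i; have [le|le] := leqP i M.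
    have lt' : (n.-1 <= n - i.+1 + M)%N by lia.
    have E := det_first_col_row lt' n0.
    have e : (n - i.+1 + M - n.-1 = M - i)%N by lia.
    by rewrite e in E; rewrite E -rE mulrA.
  by rewrite det_first_col0 ?mulr0 //; lia.
have FE p : (M < p)%N -> \sum_(i < p) F i = \sum_(i < M.+1) F i.
  move=> /subnKC <-; rewrite big_split_ord /= [X in _ + X]big1 ?addr0 // => i _.
  by rewrite /F ifF //; lia.
rewrite FE // mulr_suml; apply: eq_bigr => i _.
by rewrite /F -ltnS ltn_ord.
Qed.

End Cramer.

(** * Hall-Littlewood type series *)

Section Compositions.
Local Open Scope nat_scope.

(* Compositions of [k + n] whose first part is at least [k]. *)
Fixpoint comps_acc k n : seq (seq nat) :=
  if n is n'.+1 then comps_acc k.+1 n' ++ [seq k :: c | c <- comps_acc 1 n']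
  else [:: [:: k]].

Definition comps d := if d is d'.+1 then comps_acc 1 d' else [:: [::]].

Lemma mem_comps_acc k n c : 0 < k ->
  (c \in comps_acc k n) = [&& all (fun i => 0 < i) c, sumn c == k + n & k <= head 0 c].
Proof.
elim: n k c => [|n IHn] k c k0.
  rewrite inE; case: c => [|i c] /=; first by case: k k0.
  apply/eqP/and3P => [[-> ->]|[/andP[_ c0] /eqP e le]] /=.
    by rewrite k0 addn0 eqxx leqnn.
  case: c c0 e => [|j c] /= c0 e; last by lia.
  by congr [:: _]; lia.
rewrite mem_cat IHn //; apply/idP/and3P => [/orP[/and3P[-> /eqP -> le]|]|[c0 /eqP e le]].
- by split=> //; [apply/eqP; lia | exact: ltnW].
- case/mapP => c'; rewrite IHn // => /and3P[c'0 /eqP e _] -> /=.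
  by rewrite k0 c'0 e leqnn; split=> //; apply/eqP; lia.
case: c c0 e le => [|i c] /=; first by case: k k0.
case/andP => i0 c0 e; rewrite leq_eqVlt => /orP[/eqP ki|lt]; last first.
  by rewrite i0 c0 lt andbT; apply/orP; left; apply/eqP; lia.
apply/orP; right; rewrite ki; apply/mapP; exists c => //.
rewrite IHn // c0 /=; apply/andP; split; first by apply/eqP; lia.
by case: c c0 e => [|j c] /=; lia.
Qed.

Lemma mem_comps d c : (c \in comps d) = all (fun i => 0 < i) c && (sumn c == d).
Proof.
case: d => [|d]; last first.
  rewrite mem_comps_acc // add1n; case: c => [|i c] //=.
  by case: (0 < i); rewrite ?andbT ?andbF.
by rewrite inE; case: c => [|[|i] c] //=; rewrite addSn andbF.
Qed.

Lemma comps_acc_uniq k n : 0 < k -> uniq (comps_acc k n).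
Proof.
elim: n k => [|n IHn] k k0 //=.
rewrite cat_uniq IHn //= map_inj_uniq ?IHn // => [|c c' [] //]; rewrite andbT.
apply/hasPn => _ /mapP[c _ ->]; rewrite mem_comps_acc //=.
by rewrite ltnn !andbF.
Qed.

Lemma comps_uniq d : uniq (comps d).
Proof. by case: d => [|d] //; apply: comps_acc_uniq. Qed.

(** Partitions are obtained from compositions, [insub] discarding those that are not weakly
    decreasing. *)
Definition intparts d : seq intpart := pmap insub (comps d).

Lemma intparts_uniq d : uniq (intparts d).
Proof. exact/pmap_sub_uniq/comps_uniq. Qed.

Lemma mem_intparts d (nu : intpart) : (nu \in intparts d) = (sumn nu == d).
Proof. by rewrite mem_pmap_sub mem_comps intpart_gt0. Qed.

Lemma size_le_sumn c : all (fun i => 0 < i) c -> size c <= sumn c.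
Proof. by elim: c => //= k c IHc /andP[k0 /IHc]; lia. Qed.

Lemma sumn_nth c n : size c <= n -> sumn c = \sum_(i < n) nth 0 c i.
Proof.
move=> le; rewrite sumnE (big_nth 0) big_mkord -(subnKC le) big_split_ord /=.
by rewrite [X in _ = _ + X]big1 ?addn0 // => i _; rewrite nth_default ?leq_addr.
Qed.

End Compositions.

Section CharacterExpansion.
Variables (R : idomainType) (s : R).
Let z := s - s^-1.

(** The coefficients of (1 - v / s) / (1 - s v). *)
Definition hl_coef (i : nat) : R := if i is i'.+1 then (s - s^-1) * s ^+ i' else 1.

Lemma exprA (C : comAlgType R) (a : R) i (x : C) : (a%:A ^+ i * x) = a ^+ i *: x.
Proof. by rewrite exprZn expr1n mulr_algl. Qed.

Lemma hl_factor n (k : 'I_n) :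
  ((fun i => hl_coef i *: 'X_k ^+ i) : fps {mpoly R[n]}) =
  fps_scale s%:A (fps_geom 'X_k) * fps_scale s^-1%:A (1 - fpsX 'X_k).
Proof.
rewrite rmorphB rmorph1 /= fps_scaleX mulrBr mulr1 mulrC.
apply/funext => i; rewrite fpsD fpsN fpsXM /fps_scale /fps_geom !exprA.
case: i => [|i] /=; first by rewrite subr0.
rewrite exprA mulr_algl -scalerAl -scalerAr -exprS scalerA -scalerBl.
by congr (_ *: _); rewrite exprS -mulrBl.
Qed.

Lemma hl_gser n : gser hl_coef n =
  fps_scale s%:A (\prod_k fps_geom 'X_k) * fps_scale s^-1%:A (\prod_k (1 - fpsX 'X_k)).
Proof.
rewrite !rmorph_prod -big_split /gser; apply: eq_bigr => k _; exact: hl_factor.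
Qed.

(** The coefficient of index k of [gser] is homogeneous of degree k, and the indices in each term of
    the determinant add up to |nu|. *)
Lemma JTdet_gser_mdeg n p (mu : 'X_{1..p}) nu : (size nu <= n)%N ->
  sumn nu != mdeg mu -> (JTdet (gser hl_coef p) n nu)@_mu = 0.
Proof.
move=> le_nu neq; rewrite /JTdet /determinant raddf_sum big1 //= => w _.
apply: etrans (congr1 (mcoeff mu) (mpoly_signZ _ _)) _; rewrite mcoeffZ.
case: (boolP [forall i : 'I_n, (i <= nth 0%N nu i + w i)%N]) => [/forallP h|]; last first.
  rewrite negb_forall => /existsP[i ni].
  by rewrite (bigD1 i) //= mxE (negPf ni) mul0r mcoeff0 mulr0.
pose a := [multinom (nth 0 nu i + w i - i)%N | i < n].
have -> : \prod_(i < n) (\matrix_(i0 < n, j < n) (if (i0 <= nth 0 nu i0 + j)%N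
     then gser hl_coef p (nth 0 nu i0 + j - i0)%N else 0)) i (w i) =
    \prod_(i < n) gser hl_coef p (a i).
  by apply: eq_bigr => i _; rewrite !mxE h mnmE.
rewrite gser_coef_mdeg ?mulr0 // eq_sym; apply: contra neq => /eqP <-.
(* Adding the sum of the row indices to both sides removes the truncated subtractions. *)
rewrite mdegE; apply/eqP; apply: (@addIn (\sum_(i < n) i)%N).
transitivity (\sum_(i < n) (nth 0 nu i + w i))%N.
  rewrite big_split (sumn_nth le_nu); congr (_ + _)%N.
  by rewrite [RHS](reindex_inj (@perm_inj _ w^-1))%g /=; apply: eq_bigr => i _; rewrite permKV.
by rewrite -big_split; apply: eq_bigr => i _; rewrite /a mnmE /= subnK.
Qed.

End CharacterExpansion.

(** * The Schur basis and the generators in the abstract algebra *)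

Section SchurBasis.
Variables (R : idomainType) (C : comAlgType R) (phi : {lrmorphism C -> symfun R}).
Hypotheses (phi_inj : injective phi).
Variable Q : intpart -> C.
Hypothesis Q_schur : forall nu, is_schur nu (phi (Q nu)).

Definition ev n (f : C) : {mpoly R[n]} := symfun_val (phi f) n.

Fact ev_additive n : zmod_morphism (ev n).
Proof. by move=> f g; rewrite /ev rmorphB. Qed.
Fact ev_multiplicative n : monoid_morphism (ev n).
Proof. by split=> [|f g]; rewrite /ev ?rmorph1 ?rmorphM. Qed.
HB.instance Definition _ n := GRing.isZmodMorphism.Build C {mpoly R[n]} (ev n) (ev_additive n).
HB.instance Definition _ n := GRing.isMonoidMorphism.Build C {mpoly R[n]} (ev n) (ev_multiplicative n).

Lemma evZ n a f : ev n (a *: f) = a *: ev n f.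
Proof. by rewrite /ev linearZ. Qed.

Lemma ev_inj n0 f g : (forall n, (n0 <= n)%N -> ev n f = ev n g) -> f = g.
Proof. by move=> e; apply/phi_inj/(symfun_ext e). Qed.

Lemma ev_sym n f : ev n f \is symmetric.
Proof. by have /asboolP[] := valP (phi f). Qed.

Lemma ev_Q n (nu : intpart) : (size nu <= n)%N -> ev n (Q nu) * alternant R n [::] = alternant R n nu.
Proof. exact: Q_schur. Qed.

Definition Qrow m : C := Q (rowp m).

Let H n : fps {mpoly R[n]} := \prod_(k < n) fps_geom 'X_k.

Lemma H0 n : H n 0%N = 1.
Proof.
rewrite /H; elim/big_rec: _ => [|i f _ IH]; first by rewrite fps1.
by rewrite fpsM0 IH mulr1.
Qed.

Lemma ev_Q_JT n (nu : intpart) : (size nu <= n)%N -> ev n (Q nu) = JTdet (H n) n nu.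
Proof.
by move=> le; apply: (mulIf (alternant_nil_neq0 R n)); rewrite ev_Q // alternantE.
Qed.

Lemma ev_Qrow n m : (0 < n)%N -> ev n (Qrow m) = H n m.
Proof.
move=> n0; rewrite ev_Q_JT ?(leq_trans (size_rowp m)) // -(JTdet1 _ (H0 n) n0).
rewrite /JTdet; congr (\det _); apply/matrixP => i j; rewrite !mxE.
by rewrite !nth_rowp; case: (val i) => [|[|i']].
Qed.

Lemma Qrow0 : Qrow 0 = 1.
Proof. by apply: (@ev_inj 1) => n n0; rewrite ev_Qrow // H0 rmorph1. Qed.

Lemma Q_JT (nu : intpart) n : (size nu <= n)%N -> Q nu = JTdet Qrow n nu.
Proof.
move=> le; apply: (@ev_inj (maxn 1 n)) => n'; rewrite geq_max => /andP[n'0 nn'].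
rewrite ev_Q_JT ?(leq_trans le) // rmorph_JTdet.
rewrite (JTdet_le (H0 n') le nn'); apply: JTdet_ext => m /=.
by rewrite ev_Qrow.
Qed.

Lemma Q_hook_recurrence a M :
  Qrow (a + M.+1)%N = \sum_(i < M.+1) (-1) ^+ i * Q (hook a i) * Qrow (M - i)%N.
Proof.
apply: (@ev_inj M.+1) => n lt_M.
rewrite (@hook_row_recurrence R n a M (fun i => ev n (Q (hook a i))) (fun m => ev n (Qrow m))) //.
- rewrite rmorph_sum; apply: eq_bigr => i _.
  by rewrite !rmorphM rmorphXn rmorphN1.
- by move=> i lt_i; rewrite ev_Q //= size_nseq.
- by move=> m; rewrite ev_Q // (leq_trans (size_rowp m)) //; lia.
Qed.

Variable s : R.
Hypothesis s_unit : s \is a GRing.unit.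
Local Notation z := (s - s^-1).

Variable A : nat -> C.
Hypothesis A_hooks : forall m, (0 < m)%N ->
  A m = \sum_(p : 'I_m * 'I_m | (p.1 + p.2 == m.-1)%N)
          ((-1) ^+ p.2 * s ^ (p.1%:Z - p.2%:Z)) *: Q (hook p.1 p.2).

Lemma A_hooks_sum m : (0 < m)%N ->
  A m = \sum_(a < m) ((-1) ^+ (m - a.+1) * (s ^+ a * s^-1 ^+ (m - a.+1))) *: Q (hook a (m - a.+1)).
Proof.
move=> m0; rewrite A_hooks // -(pair_big_dep xpredT (fun a b : 'I_m => (a + b == m.-1)%N)
  (fun a b : 'I_m => ((-1) ^+ b * s ^ (a%:Z - b%:Z)) *: Q (hook a b))) /=.
apply: eq_bigr => a _; rewrite (big_pred1 (rev_ord a)) /=; last first.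
  move=> b; rewrite /pred1 /= -(inj_eq val_inj) /=; have := ltn_ord a; have := ltn_ord b.
  by move=> *; apply/eqP/eqP; lia.
by rewrite exprzDr // -exprz_inv.
Qed.

Definition hook_series : fps C := fun m => if m is 0 then 1 else z *: A m.

(** For a fixed arm [a], the total power of s does not depend on [i], and what remains of the sum
    over [i] is [Q_hook_recurrence] for [Qrow m]. *)
Lemma hook_series_rec m :
  \sum_(i < m) s^-1 ^+ i *: (Qrow i * A (m - i)) =
  (\sum_(a < m) s ^+ a * s^-1 ^+ (m - a.+1)) *: Qrow m.
Proof.
pose G i a := (s ^+ a * s^-1 ^+ (m - a.+1)) *:
  ((-1) ^+ (m - i - a.+1) * Q (hook a (m - i - a.+1)) * Qrow i).
transitivity (\sum_(i < m) \sum_(a < m | (i + a < m)%N) G i a).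
  apply: eq_bigr => i _; have lt_i := ltn_ord i.
  rewrite A_hooks_sum; last lia.
  rewrite mulr_sumr scaler_sumr.
  rewrite (big_ord_widen_cond m xpredT (fun a =>
    s^-1 ^+ i *: (Qrow i * (((-1) ^+ (m - i - a.+1) * (s ^+ a * s^-1 ^+ (m - i - a.+1))) *:
      Q (hook a (m - i - a.+1)))))); last lia.
  apply: eq_big => [a|a]; first by have := ltn_ord a; lia.
  move=> lt_a; rewrite /G -scalerAr scalerA mulrC.
  have -> : (m - a.+1 = i + (m - i - a.+1))%N by lia.
  rewrite exprD; move: (m - i - a.+1)%N => b; move: (s^-1) => t.
  rewrite -signr_odd -[in RHS]signr_odd; case: (odd b);
   rewrite ?expr0 ?expr1 ?mulN1r ?mul1r ?mulNr ?scaleNr ?scalerN.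
  - by congr (- (_ *: _)); ring.
  - by congr (_ *: _); ring.
rewrite (exchange_big_dep xpredT) //= scaler_suml; apply: eq_bigr => a _.
have lt_a := ltn_ord a.
rewrite -scaler_sumr; congr (_ *: _).
have -> : Qrow m = Qrow (a + (m - a.+1).+1)%N by congr Qrow; lia.
rewrite Q_hook_recurrence [RHS](reindex_inj rev_ord_inj) /=.
rewrite (big_ord_widen m (fun i => (-1) ^+ ((m - a.+1).+1 - i.+1) *
  Q (hook a ((m - a.+1).+1 - i.+1)) * Qrow (m - a.+1 - ((m - a.+1).+1 - i.+1)))); last lia.
apply: eq_big => [i|i lt_i]; first lia.
have -> : (m - i - a.+1 = (m - a.+1).+1 - i.+1)%N by lia.
by congr (_ * Qrow _); lia.
Qed.

Lemma exprB_unit m : s ^+ m - s^-1 ^+ m = z * \sum_(a < m) s ^+ a * s^-1 ^+ (m - a.+1).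
Proof.
rewrite subrXX; congr (_ * _); rewrite [RHS](reindex_inj rev_ord_inj) /=.
apply: eq_bigr => i _; congr (_ ^+ _ * _ ^+ _); have := ltn_ord i; lia.
Qed.

(** The generating series identity H(s v) = H(v / s) (1 + z sum_m A_m v^m). After multiplication by
    z the scalar in [hook_series_rec] is s^m - s^-m, and the term i = m of the product supplies the
    missing s^-m. *)
Lemma hook_series_eq :
  fps_scale s%:A Qrow = fps_scale s^-1%:A Qrow * hook_series.
Proof.
apply/funext => m; rewrite fpsM big_ord_recr /= subnn mulr1 /fps_scale !exprA.
have -> : \sum_(i < m) (s^-1%:A ^+ i * Qrow i) * hook_series (m - i)%N =
    z *: \sum_(i < m) s^-1 ^+ i *: (Qrow i * A (m - i)).
  rewrite scaler_sumr; apply: eq_bigr => i _; rewrite exprA.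
  have -> : hook_series (m - i)%N = z *: A (m - i).
    by rewrite /hook_series; have := ltn_ord i; case E: (m - i)%N => //; lia.
  by rewrite -scalerAr -scalerAl.
by rewrite hook_series_rec scalerA -exprB_unit -scalerDl subrK.
Qed.

Lemma ev_hook_series n m : (0 < n)%N -> ev n (hook_series m) = gser (hl_coef s) n m.
Proof.
move=> n0; have evA (a : R) : ev n a%:A = a%:A by rewrite evZ rmorph1.
have EH : fps_map (ev n) Qrow = H n by apply/funext => k; exact: ev_Qrow.
have /(congr1 (fps_map (ev n))) := hook_series_eq.
rewrite fps_mapM !fps_map_scale EH /= !evA => E.
have HP : H n * \prod_k (1 - fpsX 'X_k) = 1.
  by rewrite /H -big_split big1 //= => k _; rewrite mulrC fps_geomV.
suff -> : gser (hl_coef s) n = fps_map (ev n) hook_series by [].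
by rewrite hl_gser E mulrAC -rmorphM HP rmorph1 mul1r.
Qed.

End SchurBasis.

Definition seq_mon p (mu : seq nat) : 'X_{1..p} := [multinom nth 0 mu j | j < p].

Section FpsUnique.
Variables (R : idomainType) (s : R) (p : nat).
Hypothesis s_gen : forall m, (0 < m)%N -> s ^+ m - s^-1 ^+ m != 0.

(** In degree m the equation expresses (s^m - s^-m) f_m through the f_i with i < m, and the scalar
    on the left is nonzero. *)
Lemma scale_series_unique (Y f g : fps {mpoly R[p]}) : Y 0%N = 1 -> f 0%N = g 0%N ->
  fps_scale s%:A f = fps_scale s^-1%:A f * Y ->
  fps_scale s%:A g = fps_scale s^-1%:A g * Y -> f = g.
Proof.
move=> Y0 fg0 fE gE; apply/eqP; rewrite -subr_eq0; apply/eqP.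
set D := f - g.
have DE : fps_scale s%:A D = fps_scale s^-1%:A D * Y.
  by rewrite /D !rmorphB /= mulrBl fE gE.
apply/funext => m; elim/ltn_ind: m => -[_|m IHm]; first by rewrite /D fpsD fpsN fg0 subrr.
have := congr1 (fun h : fps _ => h m.+1) DE.
rewrite fpsM big_ord_recr /= subnn Y0 mulr1 big1 ?add0r => [|i _]; last first.
  by rewrite /fps_scale IHm // fps0 mulr0 mul0r.
rewrite /fps_scale !exprA => /eqP; rewrite -subr_eq0 -scalerBl => /eqP D0.
apply/mpolyP => a; have /(congr1 (mcoeff a)) := D0.
rewrite mcoeffZ fps0 !mcoeff0 => /eqP; rewrite mulf_eq0 (negPf (s_gen _)) //=.
by move=> /eqP.
Qed.
End FpsUnique.

(** * The form on products of generators *)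

Section Pairing.
Variables (R : idomainType) (C : comAlgType R) (phi : {lrmorphism C -> symfun R}).
Hypotheses (phi_inj : injective phi).
Variable Q : intpart -> C.
Hypothesis Q_schur : forall nu, is_schur nu (phi (Q nu)).
Variable s : R.
Hypotheses (R2 : 2%:R != 0 :> R) (s_unit : s \is a GRing.unit).
Hypothesis s_gen : forall m, (0 < m)%N -> s ^+ m - s^-1 ^+ m != 0.
Local Notation z := (s - s^-1).
Variable A : nat -> C.
Hypothesis A_hooks : forall m, (0 < m)%N ->
  A m = \sum_(p : 'I_m * 'I_m | (p.1 + p.2 == m.-1)%N)
          ((-1) ^+ p.2 * s ^ (p.1%:Z - p.2%:Z)) *: Q (hook p.1 p.2).

Local Notation G p := (gser (hl_coef s) p).

Lemma mdeg_seq_mon p mu : (size mu <= p)%N -> mdeg (seq_mon p mu) = sumn mu.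
Proof.
by move=> le; rewrite (sumn_nth le) mdegE; apply: eq_bigr => i _; rewrite mnmE.
Qed.

(** Multiplied by the Vandermonde alternant, both sides become antisymmetric, so only the
    coefficients at nu + delta need comparison: on the left they are given by [alternant_gser_coef],
    on the right only the term of [nu] contributes. *)
Lemma A_expand (mu : seq nat) : all (fun i => (0 < i)%N) mu ->
  z ^+ size mu *: \prod_(m <- mu) A m =
  \sum_(nu <- intparts (sumn mu))
     (JTdet (G (size mu)) (sumn mu) nu)@_(seq_mon (size mu) mu) *: Q nu.
Proof.
move=> mu_gt0; set d := sumn mu; set p := size mu; set mm := seq_mon _ _.
have G0 : G p 0%N = 1 by exact: gser0.
apply: (ev_inj phi_inj (n0 := maxn 1 d)) => n; rewrite geq_max => /andP[n0 dn].
set f := ev _ _ _.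
have fE : f = \prod_(j < p) G n (mm j).
  rewrite /f evZ rmorph_prod (big_nth 0%N) big_mkord /p.
  transitivity (\prod_(i < size mu) (z *: ev phi n (A (nth 0%N mu i)))).
    by rewrite scaler_prod prodr_const card_ord.
  apply: eq_bigr => i _; rewrite mnmE.
  rewrite -(ev_hook_series phi_inj Q_schur s_unit A_hooks _ n0) -evZ /hook_series.
  by have := all_nthP 0%N mu_gt0 i (ltn_ord i); case: (nth 0%N mu i).
have szd (nu : intpart) : sumn nu = d -> (size nu <= d)%N.
  by move=> <-; apply/size_le_sumn/intpart_gt0.
apply: (mulIf (alternant_nil_neq0 R n)); rewrite rmorph_sum mulr_suml.
set T := \sum_(nu <- _) _.
have TE : T = \sum_(nu <- intparts d) (JTdet (G p) d nu)@_mm *: alternant R n nu.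
  rewrite /T big_seq [RHS]big_seq; apply: eq_bigr => nu.
  rewrite mem_intparts => /eqP /szd le_nu.
  by rewrite /= evZ -scalerAl (ev_Q Q_schur) // (leq_trans le_nu).
apply/eqP; rewrite -subr_eq0; apply/eqP/antisym_eq0 => // [w|nu le_nu].
  rewrite rmorphB rmorphM /= msym_alternant scalerBr -scalerAr.
  have /issymP -> : f \is symmetric by exact: ev_sym.
  congr (_ - _); rewrite TE raddf_sum scaler_sumr; apply: eq_bigr => nu _.
  by rewrite /= msymZ msym_alternant scalerA scalerA mulrC.
rewrite mcoeffB mulrC fE alternant_gser_coef TE (raddf_sum (mcoeff (shift_mon n nu))) /=.
apply/eqP; rewrite subr_eq0; apply/eqP.
transitivity (\sum_(ka <- intparts d | ka == nu) (JTdet (G p) d ka)@_mm); last first.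
  rewrite big_mkcond big_seq [RHS]big_seq; apply: eq_bigr => ka.
  rewrite mem_intparts => /eqP /szd le_ka.
  rewrite mcoeffZ alternant_coef // ?(leq_trans le_ka) //.
  by case: eqP; rewrite ?mulr1 ?mulr0.
have [nu_in|nu_out] := boolP (nu \in intparts d).
  rewrite (big_rem nu) //= eqxx big1_seq ?addr0 => [|ka /andP[/eqP -> ]]; last first.
    by rewrite mem_rem_uniqF // intparts_uniq.
  rewrite mem_intparts in nu_in; have le_d := szd _ (eqP nu_in).
  by rewrite (JTdet_le G0 le_d dn).
(* A partition of another size: no term on the right, and a determinant of the wrong degree on the
   left. *)
rewrite big1_seq => [|ka /andP[/eqP -> nu_in]]; last by rewrite nu_in in nu_out.
by rewrite JTdet_gser_mdeg // mdeg_seq_mon // -mem_intparts.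
Qed.

Section Form.
Variable form : {biscalar C}.
Hypothesis form_Q : forall la mu, form (Q la) (Q mu) = (la == mu)%:R.

(** By [A_expand] the two products involve only Q's indexed by partitions of two different
    integers. *)
Lemma form_A_unbalanced (la mu : seq nat) :
  all (fun i => (0 < i)%N) la -> all (fun i => (0 < i)%N) mu -> sumn la != sumn mu ->
  z ^+ (size la + size mu) * form (\prod_(m <- mu) A m) (\prod_(m <- la) A m) = 0.
Proof.
move=> la_gt0 mu_gt0 ne.
rewrite exprD -mulrA -linearZl_LR /= -linearZr_LR /= !A_expand //.
rewrite linear_sumr big1_seq // => nu /=; rewrite mem_intparts => /eqP e.
rewrite linearZr_LR linear_sumlz big1_seq ?mulr0 // => ka /=; rewrite mem_intparts => /eqP e'.
rewrite linearZl_LR /= form_Q; case: eqP => [kn|_]; last by rewrite mulr0.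
by move: ne; rewrite -e -e' kn eqxx.
Qed.
End Form.

Variables (p : nat) (Y : fps {mpoly R[p]}) (Theta : {lrmorphism C -> {mpoly R[p]}}).
Hypotheses (Y0 : Y 0%N = 1) (YE : fps_scale s%:A (G p) = fps_scale s^-1%:A (G p) * Y).
Hypothesis ThetaA : forall m, (0 < m)%N -> z *: Theta (A m) = Y m.

(** Applying [Theta] to [hook_series_eq] shows that the images of the [Qrow m] solve F(s v) = F(v /
    s) Y(v). So does [G p] by [YE], with the same constant term. *)
Lemma Theta_Qrow m : Theta (Qrow Q m) = G p m.
Proof.
have ThA (a : R) : Theta a%:A = a%:A by rewrite linearZ /= rmorph1.
suff -> : G p = fps_map Theta (Qrow Q) by [].
have YT : fps_map Theta (hook_series s A) = Y.
  by apply/funext => -[|k]; rewrite /fps_map /= ?rmorph1 ?Y0 // linearZ /= ThetaA.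
apply: (scale_series_unique s_gen Y0) => //.
  by rewrite gser0 // /fps_map (Qrow0 phi_inj Q_schur) rmorph1.
have /(congr1 (fps_map Theta)) := hook_series_eq phi_inj Q_schur s_unit A_hooks.
by rewrite fps_mapM !fps_map_scale /= !ThA YT.
Qed.

Lemma Theta_Q (nu : intpart) n : (size nu <= n)%N -> Theta (Q nu) = JTdet (G p) n nu.
Proof.
move=> le; rewrite (Q_JT phi_inj Q_schur le) rmorph_JTdet.
by apply: JTdet_ext => m; exact: Theta_Qrow.
Qed.

Variable form : {biscalar C}.
Hypothesis form_Q : forall la mu, form (Q la) (Q mu) = (la == mu)%:R.

(** Up to the power of z, the coordinate of A_mu on Q_nu is the coefficient at [mu] of
    [Theta (Q nu)], by [A_expand] and [Theta_Q]. Pairing with A_mu thus amounts to applying [Theta]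
    and taking that coefficient, and [Theta] is multiplicative on A_la. *)
Lemma form_A (la mu : seq nat) :
  all (fun i => (0 < i)%N) la -> all (fun i => (0 < i)%N) mu -> size mu = p ->
  z ^+ (size la + size mu) * form (\prod_(m <- mu) A m) (\prod_(m <- la) A m) =
  (\prod_(m <- la) Y m)@_(seq_mon p mu).
Proof.
move=> la_gt0 mu_gt0 mup.
have -> : \prod_(m <- la) Y m = Theta (z ^+ size la *: \prod_(m <- la) A m).
  rewrite linearZ rmorph_prod; elim: la la_gt0 => [|m la IHla] /=.
    by rewrite !big_nil expr0 scale1r.
  case/andP => m0 /IHla; rewrite !big_cons => ->.
  by rewrite -ThetaA // exprS -scalerAl -scalerAr !scalerA.
rewrite exprD -mulrA -linearZl_LR /= -linearZr_LR /= !A_expand // mup.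
rewrite linear_sumr
  (linear_sum Theta) (raddf_sum (mcoeff (seq_mon p mu))) /=; apply: eq_big_seq => nu nu_in.
have le_nu : (size nu <= sumn la)%N.
  by move: nu_in; rewrite mem_intparts => /eqP <-; apply/size_le_sumn/intpart_gt0.
rewrite linearZr_LR linearZ /= mcoeffZ (Theta_Q le_nu); congr (_ * _); rewrite linear_sumlz.
(* If |nu| differs from |mu|, Q_nu does not occur in A_mu and the determinant has no term of degree
   |mu|. *)
have [nu_mu|nu_mu] := boolP (nu \in intparts (sumn mu)).
  rewrite (big_rem nu) //= linearZl_LR /= form_Q eqxx mulr1 big1_seq ?addr0 => [|ka /= ka_in].
    move: nu_mu; rewrite mem_intparts => /eqP e.
    have le' : (size nu <= sumn mu)%N by rewrite -e; apply/size_le_sumn/intpart_gt0.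
    case: (leqP (sumn la) (sumn mu)) => h.
      by rewrite (JTdet_le _ le_nu h) // gser0.
    by rewrite (JTdet_le _ le' (ltnW h)) // gser0.
  rewrite linearZl_LR /= form_Q; case: eqP => [e|_]; last by rewrite mulr0.
  by move: ka_in; rewrite e mem_rem_uniqF // intparts_uniq.
rewrite big1_seq => [|ka /= ka_in]; last first.
  rewrite linearZl_LR /= form_Q; case: eqP => [e|_]; last by rewrite mulr0.
  by rewrite -e ka_in in nu_mu.
by rewrite JTdet_gser_mdeg // mdeg_seq_mon ?mup // -mem_intparts.
Qed.

End Pairing.

(** * The kernel series and its recursion *)

Section KernelSeries.
Variables (R : comUnitRingType) (K : comAlgType R) (s : R).
Hypothesis s_unit : s \is a GRing.unit.
Local Notation z := (s - s^-1).

Lemma fpsXD (c d : K) : fpsX (c + d) = fpsX c + fpsX d.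
Proof. by apply/funext => n; rewrite fpsD /fpsX; case: eqP; rewrite ?addr0. Qed.

Lemma fpsX_mul (a b c d : K) : a * b = c * d -> fpsX a * fpsX b = fpsX c * fpsX d.
Proof.
move=> e; apply/funext => -[|[|[|n]]]; rewrite !fpsXM //= /fpsX /= ?mulr0 //.
Qed.

(** With t the series variable, this is (1 - v t)^2 / ((1 - s^2 v t) (1 - s^-2 v t)). *)
Definition ker (v : K) : fps K :=
  (1 - fpsX v) ^+ 2 * (fps_geom (s ^+ 2 *: v) * fps_geom (s^-1 ^+ 2 *: v)).

Definition ker_step (v : K) : fps K := fun k => (z ^+ 2 * k%:R) *: v ^+ k.

Lemma ker_stepE v : ker_step v = fpsX (z ^+ 2 *: v) * fps_geom v ^+ 2.
Proof.
apply/funext => -[|n]; rewrite fpsXM /ker_step ?mulr0 ?scale0r //.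
rewrite [fps_geom v ^+ 2]expr2 fpsM (eq_bigr (fun _ => v ^+ n)) => [|i _].
  by rewrite sumr_const card_ord mulrnAr mulr1 -scalerAl mulrnAr -exprS -scaler_nat scalerA mulr_natr.
by rewrite /fps_geom -exprD subnKC // -ltnS.
Qed.

(** The denominator of [ker v] equals (1 - v t)^2 - z^2 v t, whence ker v = 1 / (1 - z^2 v t / (1 -
    v t)^2). *)
Lemma ker_rec v : ker v = 1 + ker_step v * ker v.
Proof.
have gE := fps_geomV v.
have g1 := fps_geomV (s ^+ 2 *: v); have g2 := fps_geomV (s^-1 ^+ 2 *: v).
have E : (1 - fpsX (s ^+ 2 *: v)) * (1 - fpsX (s^-1 ^+ 2 *: v)) =
    (1 - fpsX v) ^+ 2 - fpsX (z ^+ 2 *: v).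
  have -> : z ^+ 2 *: v = s ^+ 2 *: v + s^-1 ^+ 2 *: v - (v + v).
    rewrite -scalerDl -mulr2n -scaler_nat -scalerBl; congr (_ *: _).
    by rewrite sqrrB mulrV // addrAC.
  have XX : fpsX (s ^+ 2 *: v) * fpsX (s^-1 ^+ 2 *: v) = fpsX v * fpsX v.
    apply: fpsX_mul; rewrite -scalerAl -scalerAr scalerA -exprMn mulrV //.
    by rewrite expr1n scale1r.
  have XN (c d : K) : fpsX (c - d) = fpsX c - fpsX d.
    apply/eqP; rewrite eq_sym subr_eq -fpsXD subrK //.
  rewrite XN !fpsXD.
  move: XX; move: (fpsX (s ^+ 2 *: v)) (fpsX (s^-1 ^+ 2 *: v)) (fpsX v) => x y w XX.
  by ring: XX.
apply/eqP; rewrite -subr_eq0; apply/eqP.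
rewrite ker_stepE /ker.
move: gE g1 g2 E.
move: (fps_geom v) (fps_geom (s ^+ 2 *: v)) (fps_geom (s^-1 ^+ 2 *: v)) => g h k.
move: (fpsX v) (fpsX (s ^+ 2 *: v)) (fpsX (s^-1 ^+ 2 *: v)) (fpsX (z ^+ 2 *: v)).
move=> x y w t gE g1 g2 E.
have -> : (1 - x) ^+ 2 * (h * k) - (1 + t * g ^+ 2 * ((1 - x) ^+ 2 * (h * k))) =
   (h * k) * ((1 - x) ^+ 2 - t * ((1 - x) * g) ^+ 2) - 1 by ring.
rewrite gE expr1n mulr1 -E.
have -> : h * k * ((1 - y) * (1 - w)) = ((1 - y) * h) * ((1 - w) * k) by ring.
by rewrite g1 g2 mulr1 subrr.
Qed.

Lemma ker0 v : ker v 0%N = 1.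
Proof. by rewrite ker_rec fpsD fpsM0 /ker_step mulr0 scale0r mul0r addr0. Qed.

(** Here c(t) = (1 - v t / s) / (1 - s v t); each of c(s t) and 1 / c(t / s) brings one factor 1 - v
    t to the numerator of [ker v]. *)
Lemma scale_ker v (c := fps_scale s%:A (fps_geom v) * fps_scale s^-1%:A (1 - fpsX v)) :
  fps_scale s%:A c = fps_scale s^-1%:A c * ker v.
Proof.
rewrite /c !rmorphM !rmorphB !rmorph1 /= !fps_scaleX !fps_scale_geom.
rewrite !mulr_algl !scalerA divrr // mulVr // scale1r -!expr2.
have gE := fps_geomV v; have g2 := fps_geomV (s^-1 ^+ 2 *: v).
rewrite /ker.
move: gE g2.
move: (fps_geom v) (fps_geom (s ^+ 2 *: v)) (fps_geom (s^-1 ^+ 2 *: v)) => g h k.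
move: (fpsX v) (fpsX (s^-1 ^+ 2 *: v)) => x y gE g2.
have -> : g * (1 - y) * ((1 - x) ^+ 2 * (h * k)) =
  ((1 - x) * g) * ((1 - y) * k) * (h * (1 - x)) by ring.
by rewrite gE g2 !mul1r.
Qed.

Variable x : nat -> K.
Definition kerP ptr : fps K := \prod_(i < ptr) ker (x i).

Lemma kerP0 ptr : kerP ptr 0%N = 1.
Proof.
rewrite /kerP; elim/big_rec: _ => [|i f _ IH]; first by rewrite fps1.
by rewrite fpsM0 IH ker0 mulr1.
Qed.

(* The factor of smallest index is used first; a monomial of [kerP ptr] is read
   as a sequence of steps of nonincreasing indices below [ptr]. *)
Lemma kerP_rec ptr m : kerP ptr m.+1 =
  \sum_(i < ptr) \sum_(k < m.+1) (z ^+ 2 * k.+1%:R) *: (x i ^+ k.+1 * kerP i.+1 (m - k)%N).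
Proof.
have -> : kerP ptr = 1 + \sum_(i < ptr) ker_step (x i) * kerP i.+1.
  elim: ptr => [|ptr IHptr]; first by rewrite big_ord0 addr0 /kerP big_ord0.
  rewrite big_ord_recr /= addrA -IHptr {1 3}/kerP big_ord_recr /=.
  by rewrite {1}ker_rec -/(kerP ptr); ring.
rewrite fpsD fps1 add0r fps_sum; apply: eq_bigr => i _.
rewrite fpsM big_ord_recl /ker_step mulr0 scale0r mul0r add0r.
by apply: eq_bigr => k _; rewrite -scalerAl.
Qed.

End KernelSeries.

(** * Rulings as paths of involutions *)

Section PathSums.
Variables (R : comNzRingType).

Definition fcons (S : finType) E (x : S) (g : {ffun 'I_E -> S}) : {ffun 'I_E.+1 -> S} :=
  [ffun k => if unlift ord0 k is Some j then g j else x].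

Lemma fcons0 (S : finType) E (x : S) (g : {ffun 'I_E -> S}) : fcons x g ord0 = x.
Proof. by rewrite ffunE unlift_none. Qed.

Lemma fconsS (S : finType) E (x : S) (g : {ffun 'I_E -> S}) k : fcons x g (lift ord0 k) = g k.
Proof. by rewrite ffunE liftK. Qed.

Lemma big_fcons (S : finType) E (F : {ffun 'I_E.+1 -> S} -> R) :
  \sum_f F f = \sum_x \sum_(g : {ffun 'I_E -> S}) F (fcons x g).
Proof.
rewrite pair_big /= (reindex (fun p : S * {ffun 'I_E -> S} => fcons p.1 p.2)) //=.
exists (fun f => (f ord0, [ffun k => f (lift ord0 k)])) => [[x g] _ | f _] /=.
  by rewrite fcons0; congr (_, _); apply/ffunP => k; rewrite ffunE fconsS.
apply/ffunP => k; rewrite ffunE; case: unliftP => [j|] -> //.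
by rewrite ffunE.
Qed.

Section Paths.
Variables (S : finType) (T : Type) (t0 : T) (V : S -> bool) (W : T -> S -> S -> R).

(** The entry (x, y) of a product of transfer matrices, every state after the first being restricted
    to [V]; the test on the first state appears as a factor in [path_sum_from]. *)
Fixpoint amp (ws : seq T) (x y : S) : R :=
  if ws is w :: ws' then \sum_(x' | V x') W w x x' * amp ws' x' y else (x == y)%:R.

Lemma path_sum_from ws x y :
  \sum_(f : {ffun 'I_(size ws).+1 -> S} | f ord0 == x)
     (\prod_k (V (f k))%:R) *
     (\prod_(k < size ws) W (nth t0 ws k) (f (inord k)) (f (inord k.+1))) *
     (f ord_max == y)%:R = (V x)%:R * amp ws x y.
Proof.
elim: ws x => [|w ws IHws] x /=.
  rewrite (big_pred1 [ffun=> x]) => [|f].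
    by rewrite big_ord1 big_ord0 mulr1 !ffunE.
  apply/eqP/eqP => [<-|->]; last by rewrite ffunE.
  by apply/ffunP => k; rewrite ffunE [k]ord1.
rewrite big_mkcond big_fcons (bigD1 x) //= [X in _ + X]big1 ?addr0; last first.
  by move=> x' /negPf xx'; apply: big1 => g _; rewrite fcons0 xx'.
rewrite [in RHS]big_mkcond mulr_sumr (partition_big (fun g : {ffun 'I_(size ws).+1 -> S} => g ord0) predT) //=.
apply: eq_bigr => x' _.
transitivity ((V x)%:R * W w x x' * ((V x')%:R * amp ws x' y)); last first.
  by case: (V x'); rewrite ?mul1r ?mul0r ?mulr0 // mulrA.
rewrite -IHws mulr_sumr; apply: eq_big => // g /eqP gx'.
rewrite fcons0 eqxx big_ord_recl [X in _ * X * _ = _]big_ord_recl /= fcons0.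
have e0 : inord 0 = ord0 :> 'I_(size ws).+2 by apply: val_inj; rewrite /= inordK.
have e1 k : (k <= size ws)%N -> inord k.+1 = lift ord0 (inord k) :> 'I_(size ws).+2.
  by move=> le; apply: val_inj; rewrite /= /bump /= !inordK.
have e2 : ord_max = lift ord0 ord_max :> 'I_(size ws).+2 by apply: val_inj.
rewrite e0 fcons0 e1 // fconsS {1}e2 fconsS.
have -> : inord 0 = ord0 :> 'I_(size ws).+1 by apply: val_inj; rewrite /= inordK.
rewrite gx' (eq_bigr (fun k => (V (g k))%:R)) => [|k _]; last by rewrite fconsS.
rewrite [X in _ * (_ * X) * _](eq_bigr (fun k : 'I_(size ws) => W (nth t0 ws k) (g (inord k)) (g (inord k.+1)))); last first.
  by move=> k _; rewrite /bump /= add1n !e1 ?fconsS // ltnW.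
by rewrite -!mulrA; congr (_ * _); rewrite mulrCA !mulrA.
Qed.

Lemma path_sum ws :
  \sum_(f : {ffun 'I_(size ws).+1 -> S})
     (\prod_k (V (f k))%:R) *
     (\prod_(k < size ws) W (nth t0 ws k) (f (inord k)) (f (inord k.+1))) *
     (f ord_max == f ord0)%:R = \sum_(x | V x) amp ws x x.
Proof.
rewrite (partition_big (fun f : {ffun 'I_(size ws).+1 -> S} => f ord0) predT) //= [RHS]big_mkcond.
apply: eq_bigr => x _; transitivity ((V x)%:R * amp ws x x); last first.
  by case: (V x); rewrite ?mul1r ?mul0r.
by rewrite -path_sum_from; apply: eq_bigr => f /eqP ->.
Qed.

End Paths.
End PathSums.

Section Rulings.
Variables (R : comUnitRingType) (z : R).

(* The dependent type [ruling_data L] unfolds to functions whose sizes depend on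
   the gap; when all gaps have the same size they can be replaced by a constant. *)
Definition dcomp m (sz : 'I_m.+1 -> nat)
    (rho : {dffun forall k, {ffun 'I_(sz k) -> 'I_(sz k)}}) (k i : nat) : nat :=
  let k' := inord k in if insub i is Some j then val (rho k' j) else i.

Lemma dcomp_companion L (rho : ruling_data L) :
  companion rho = @dcomp (size (events L)) (fun k => size (gap L k)) rho.
Proof. by []. Qed.

Definition app N (f : {ffun 'I_N -> 'I_N}) (i : nat) : nat :=
  if insub i is Some j then val (f j) else i.

Lemma app_ord N (f : {ffun 'I_N -> 'I_N}) (j : 'I_N) : app f j = f j.
Proof. by rewrite /app valK. Qed.

Lemma sum_const_dffun m (sz : 'I_m.+1 -> nat) N (F : (nat -> nat -> nat) -> R) :
  (forall k, sz k = N) ->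
  \sum_(rho : {dffun forall k, {ffun 'I_(sz k) -> 'I_(sz k)}}) F (dcomp rho) =
  \sum_(f : {ffun 'I_m.+1 -> {ffun 'I_N -> 'I_N}}) F (fun k => app (f (inord k))).
Proof.
move=> szN; have -> : sz = (fun=> N) by apply/funext.
rewrite (reindex (fun f : {ffun 'I_m.+1 -> {ffun 'I_N -> 'I_N}} =>
  f : {dffun forall k : 'I_m.+1, {ffun 'I_N -> 'I_N}})) //=.
by exists id.
Qed.

Variables (o : seq bool).
Let N := size o.
Local Notation S := {ffun 'I_N -> 'I_N}.

Definition valid (f : S) : bool :=
  [forall j, (f (f j) == j) && (nth true o (f j) != nth true o j)].

Definition same_strands (g g' : nat -> nat) : bool :=
  [forall j : 'I_N, g' j == g j].
Definition crossed_strands i (g g' : nat -> nat) : bool :=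
  [forall j : 'I_N, g' (transpose i j) == transpose i (g j)].
Definition normal_strands i (g : nat -> nat) : bool :=
  let lo j := minn j (g j) in
  let hi j := maxn j (g j) in
  [|| hi i < lo i.+1, hi i.+1 < lo i,
      (lo i < lo i.+1) && (hi i.+1 < hi i)
    | (lo i.+1 < lo i) && (hi i < hi i.+1)]%N.
Definition cross_ok i (g g' : nat -> nat) : bool :=
  [&& g i != i.+1, g' i != i.+1
    & crossed_strands i g g'
      || [&& same_strands g g', normal_strands i g & normal_strands i g']].

Definition step_weight i (f f' : S) : R :=
  if cross_ok i (app f) (app f') then
    if same_strands (app f) (app f') then z else 1
  else 0.

Lemma forall_ord_eq n m (A : nat -> bool) : n = m ->
  [forall j : 'I_n, A j] = [forall j : 'I_m, A j].
Proof. by move=> ->. Qed.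

Lemma dcomp_ord m (sz : 'I_m.+1 -> nat) rho k (j : 'I_(sz k)) :
  @dcomp m sz rho k j = rho k j.
Proof. by rewrite /dcomp inord_val valK. Qed.

Lemma prod_if (I : finType) (P : pred I) (a : I -> R) :
  \prod_k (if P k then a k else 0) = if [forall k, P k] then \prod_k a k else 0.
Proof.
case: ifP => [/forallP h|/negbT]; first by apply: eq_bigr => k _; rewrite h.
by rewrite negb_forall => /existsP[k nk]; rewrite (bigD1 k) //= (negPf nk) mul0r.
Qed.

Definition closed_path m (ws : seq nat) (c : nat -> nat -> nat) : bool :=
  [&& [forall k : 'I_m.+1, forall j : 'I_N,
        (c k (c k j) == j) && (nth true o (c k j) != nth true o j)],
      [forall j : 'I_N, c m j == c 0%N j]
    & [forall k : 'I_m, cross_ok (nth 0%N ws k) (c k) (c k.+1)]].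

Definition path_weight m ws c : R := if closed_path m ws c then
  z ^+ #|[set k : 'I_m | same_strands (c k) (c k.+1)]| else 0.

Lemma path_weightE ws (f : {ffun 'I_(size ws).+1 -> S}) :
  path_weight (size ws) ws (fun k => app (f (inord k))) =
  (\prod_k (valid (f k))%:R) *
  (\prod_(k < size ws) step_weight (nth 0%N ws k) (f (inord k)) (f (inord k.+1))) *
  (f ord_max == f ord0)%:R.
Proof.
rewrite /path_weight.
have -> : \prod_k (valid (f k))%:R = [forall k, valid (f k)]%:R :> R.
  transitivity (\prod_(k < (size ws).+1) if valid (f k) then 1 else 0 : R).
    by apply: eq_bigr => k _; case: valid.
  by rewrite prod_if big1 //; case: ifP.
rewrite /step_weight prod_if.
have -> : \prod_(k < size ws) (if same_strands (app (f (inord k))) (app (f (inord k.+1)))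
      then z else 1) = z ^+ #|[set k : 'I_(size ws) |
        same_strands (app (f (inord k))) (app (f (inord k.+1)))]|.
  rewrite -big_mkcond prodr_const; congr (_ ^+ _); apply: eq_card => k.
  by rewrite !inE.
rewrite /closed_path.
have -> : [forall k : 'I_(size ws).+1, forall j : 'I_N,
    (app (f (inord k)) (app (f (inord k)) j) == j) &&
    (nth true o (app (f (inord k)) j) != nth true o j)] = [forall k, valid (f k)].
  apply: eq_forallb => k; apply: eq_forallb => j.
  by rewrite inord_val !app_ord.
have -> : [forall j : 'I_N, app (f (inord (size ws))) j == app (f (inord 0)) j] =
    (f ord_max == f ord0).
  have -> : inord (size ws) = ord_max :> 'I_(size ws).+1 by apply: val_inj; rewrite /= inordK.
  have -> : inord 0 = ord0 :> 'I_(size ws).+1 by apply: val_inj; rewrite /= inordK.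
  apply/forallP/eqP => [h|-> //]; apply/ffunP => j.
  by apply/val_inj/eqP; have := h j; rewrite !app_ord.
case: [forall k, valid (f k)]; case: (_ == _); case: [forall k : 'I_(size ws), _];
  by rewrite /= ?mul0r ?mulr0 ?mul1r ?mulr1.
Qed.

(** When all events are crossings and all gaps carry the same orientations, a ruling is a closed
    path of involutions of one fixed set. Its index is the number of switches, so the ruling
    polynomial is the trace of a product of transfer matrices. *)
Lemma ruling_poly2_amp (L : front) (ws : seq nat) :
  events L = [seq Crossing i | i <- ws] ->
  (forall k, gap L k = o) ->
  ruling_poly2 z L = \sum_(f | valid f) amp valid step_weight ws f f.
Proof.
move=> evE gapE.
have szE : size (events L) = size ws by rewrite evE size_map.
have gapN k : size (gap L k) = N by rewrite gapE.
have nthE k : nth true (gap L k) = nth true o by rewrite gapE.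
transitivity (\sum_(rho : ruling_data L) path_weight (size (events L)) ws (companion rho)).
  rewrite /ruling_poly2 big_mkcond /=; apply: eq_bigr => rho _.
  have compE (k : 'I_(size (events L)).+1) (j : 'I_(size (gap L k))) :
      companion rho k j = rho k j.
    by rewrite dcomp_companion dcomp_ord.
  have cr k : (k < size ws)%N -> event_cond rho k =
      cross_ok (nth 0%N ws k) (companion rho k) (companion rho k.+1).
    move=> lt_k; rewrite /event_cond /event_at evE (nth_map 0%N) //.
    rewrite /crossing_cond /cross_ok /crossed_at /switched_at.
    rewrite (forall_ord_eq (fun j => companion rho k.+1 (transpose (nth 0%N ws k) j)
       == transpose (nth 0%N ws k) (companion rho k j)) (gapN k)).
    by rewrite (forall_ord_eq (fun j => companion rho k.+1 j == companion rho k j) (gapN k)).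
  have -> : normal_ruling rho && two_graded rho =
      closed_path (size (events L)) ws (companion rho).
    rewrite /normal_ruling /two_graded /closed_path.
    rewrite (forall_ord_eq (fun j => companion rho (size (events L)) j == companion rho 0 j) (gapN 0)).
    have -> : [forall k : 'I_(size (events L)), event_cond rho k] =
       [forall k : 'I_(size (events L)), cross_ok (nth 0%N ws k) (companion rho k) (companion rho k.+1)].
      by apply: eq_forallb => k; rewrite cr // -szE.
    set A := [forall k, _]; set B := [forall j, _]; set C := [forall k, _]; set D := [forall k, _].
    rewrite -andbA [B && C && D]andbC andbA; congr (_ && _).
    apply/andP/forallP => [[/forallP h1 /forallP h2] k|h].
      rewrite -(forall_ord_eq (fun j => (companion rho k (companion rho k j) == j) &&
        (nth true o (companion rho k j) != nth true o j)) (gapN k)).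
      apply/forallP => j; rewrite !compE val_eqE.
      have /forallP/(_ j)/andP[-> _] := h1 k.
      by have /forallP/(_ j) := h2 k; rewrite nthE.
    have {}h (k : 'I_(size (events L)).+1) (j : 'I_(size (gap L k))) :
       (companion rho k (companion rho k j) == j) && (nth true o (companion rho k j) != nth true o j).
      have hk := h k; move: j; apply/forallP.
      by rewrite (forall_ord_eq (fun j => (companion rho k (companion rho k j) == j) &&
        (nth true o (companion rho k j) != nth true o j)) (gapN k)) hk.
    split; apply/forallP => k; apply/forallP => j; have := h k j; rewrite !compE => /andP[h1 h2].
      (* A strand that is its own companion would have the orientation of its companion, against the
         grading. *)
      rewrite -[_ == j]val_eqE h1 /=; apply: contraNneq h2 => e.
      by rewrite e.
    by rewrite nthE.
  rewrite /path_weight; case: ifP => // _.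
  rewrite /ruling_index.
  have -> : count is_right_cusp (events L) = 0%N by rewrite evE count_map; elim: (ws).
  rewrite subr0 -exprnP; congr (_ ^+ _); apply: eq_card => k; rewrite !inE.
  have lt_k : (k < size ws)%N by rewrite -szE.
  move: (nat_of_ord k) lt_k => i lt_i; rewrite /is_switch /event_at evE (nth_map 0%N) //.
  by rewrite /switched_at (forall_ord_eq (fun j => companion rho i.+1 j == companion rho i j) (gapN i)).
rewrite -(path_sum 0%N).
transitivity (\sum_(rho : ruling_data L) path_weight (size (events L)) ws (dcomp rho)) => //.
rewrite (sum_const_dffun (path_weight (size (events L)) ws) (fun k => gapN k)) szE.
by apply: eq_bigr => f _; rewrite path_weightE.
Qed.

End Rulings.

Lemma transposeK i : involutive (transpose i).
Proof.
move=> j; rewrite /transpose; case: (j =P i) => [->|ji].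
  by rewrite eqxx; case: eqP => //; lia.
by case: (j =P i.+1) => [->|ji1]; [rewrite eqxx | do 2 case: eqP => //].
Qed.

Lemma transpose_lt i N j : (i.+1 < N)%N -> (j < N)%N -> (transpose i j < N)%N.
Proof. by rewrite /transpose; case: eqP => [|_]; [lia | case: eqP; lia]. Qed.

Lemma nth_transpose (T : eqType) (x0 : T) p c x q j :
  nth x0 (p ++ x :: c :: q) (transpose (size p) j) = nth x0 (p ++ c :: x :: q) j.
Proof.
rewrite /transpose; case: eqP => [->|ne1].
  by rewrite !nth_cat ltnn subnn ltnNge leqnSn /= subSnn.
case: eqP => [->|ne2]; first by rewrite !nth_cat ltnn subnn ltnNge leqnSn /= subSnn.
rewrite !nth_cat; case: ltnP => // le.
by have [k ->] : exists k, (j - size p)%N = k.+2 by exists (j - size p).-2; lia.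
Qed.

Lemma index_transpose (T : eqType) (v : T) p c x q : c != x -> uniq (p ++ c :: x :: q) ->
  index v (p ++ x :: c :: q) = transpose (size p) (index v (p ++ c :: x :: q)).
Proof.
move=> cx; rewrite cat_uniq => /and3P[_ /hasPn h _].
have cp : c \notin p by apply: h; rewrite inE eqxx.
have xp : x \notin p by apply: h; rewrite !inE eqxx orbT.
rewrite !index_cat; case: ifP => [vp|_].
  by have := vp; rewrite -index_mem /transpose => lt; rewrite !ifF //; apply/eqP; lia.
rewrite /= /transpose; have [{v}<-|xv] := eqVneq x v.
  rewrite (negPf cx) addn0 addn1 eqxx ifF //; apply/eqP; lia.
have [_|cv] := eqVneq c v; first by rewrite addn0 addn1 eqxx.
by rewrite !ifF //; apply/eqP; lia.
Qed.

Section Words.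
Variables (R : comUnitRingType) (z : R) (n n' : nat).
Let o := nseq n true ++ nseq n' false.
Local Notation N := (size o).
Local Notation S := {ffun 'I_(size o) -> 'I_(size o)}.
Local Notation ampz := (amp (@valid o) (@step_weight R z o)).

Lemma size_strands : N = (n + n')%N.
Proof. by rewrite size_cat !size_nseq. Qed.

Lemma nth_strands i : (i < n + n')%N -> nth true o i = (i < n)%N.
Proof.
by move=> lt; rewrite nth_cat size_nseq !nth_nseq; case: (ltnP i n) => // le; rewrite ifT //; lia.
Qed.

Lemma app_lt (f : S) j : (j < N)%N -> (app f j < N)%N.
Proof. by move=> lt; rewrite /app insubT /=. Qed.

Lemma validP (f : S) : reflect
  (forall j, (j < n + n')%N -> app f (app f j) = j /\ (app f j < n)%N = ~~ (j < n)%N)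
  (valid f).
Proof.
apply: (iffP forallP) => [h j|h j].
  rewrite -size_strands => lt; have [J ->] : exists J : 'I_N, j = J by exists (Ordinal lt).
  have := h J; rewrite !app_ord => /andP[/eqP -> ne]; split=> //.
  by move: ne; rewrite !nth_strands -?size_strands //; do 2 case: (_ < n)%N.
have := h j; rewrite -size_strands !app_ord => /(_ (ltn_ord j)) [h1 h2].
rewrite -val_eqE /= h1 eqxx /= !nth_strands -?size_strands // h2.
by case: (_ < n)%N.
Qed.

Lemma ffun_appP (f g : S) : (forall j, (j < n + n')%N -> app f j = app g j) -> f = g.
Proof.
move=> h; apply/ffunP => j; apply: val_inj; rewrite /= -!app_ord; apply: h.
by rewrite -size_strands.
Qed.

(** As [i.+1 != n], strands i and i+1 lie on the same side and their companions on the other. The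
    two intervals therefore overlap, and normality means nested, that is f(i+1) < f(i). The only
    possible next states are [f'], where the strands cross, and [f], at a switch. *)
Lemma amp_step i ws (f f' g : S) : (i.+1 < n + n')%N -> (i.+1 != n)%N ->
  valid f -> valid f' ->
  (forall j, (j < n + n')%N -> app f' (transpose i j) = transpose i (app f j)) ->
  ampz (i :: ws) f g =
    ampz ws f' g + (if (app f i.+1 < app f i)%N then z * ampz ws f g else 0).
Proof.
move=> lt_i ne_i vf vf' cr.
have /validP vfP := vf; have /validP vfP' := vf'.
have lt_i' : (i < n + n')%N by lia.
have [fi fi_n] := vfP _ lt_i'; have [fi1 fi1_n] := vfP _ lt_i.
have [fi' fi_n'] := vfP' _ lt_i'; have [fi1' fi1_n'] := vfP' _ lt_i.
have sz := size_strands.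
have crossE (h : S) : crossed_strands o i (app f) (app h) = (h == f').
  apply/forallP/eqP => [cr' |-> j]; last by rewrite cr // -sz.
  apply: ffun_appP => j lt_j; have lt_t := transpose_lt lt_i lt_j.
  rewrite -{1}[j](transposeK i) -[in RHS](transposeK i j) cr //.
  by rewrite -sz in lt_t; have /eqP := cr' (Ordinal lt_t).
have sameE (h : S) : same_strands o (app f) (app h) = (h == f).
  apply/forallP/eqP => [e |-> //]; apply: ffun_appP => j lt_j.
  by rewrite -sz in lt_j; have /eqP := e (Ordinal lt_j).
have ff' : f' != f.
  apply/eqP => e; have := cr i lt_i'; rewrite e /transpose eqxx.
  case: eqP => [e1|_]; first by move: fi_n; rewrite e1; lia.
  case: eqP => [e1|_ e2]; first by move: fi_n; rewrite e1; lia.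
  by have := fi1; rewrite e2 fi; lia.
have fi_ne : app f i != i.+1 by apply/eqP => e; move: fi_n; rewrite e; lia.
have fi_ne' : app f' i != i.+1 by apply/eqP => e; move: fi_n'; rewrite e; lia.
have normE : normal_strands i (app f) = (app f i.+1 < app f i)%N.
  move: fi_n fi1_n; rewrite /normal_strands; move: (app f i) (app f i.+1) => p q hp hq.
  apply/idP/idP; lia.
rewrite /= (bigD1 f') //= {1}/step_weight /cross_ok fi_ne fi_ne' crossE eqxx sameE.
rewrite (negPf ff') mul1r; congr (_ + _).
rewrite (bigD1 f) /=; last by rewrite vf eq_sym.
rewrite {1}/step_weight /cross_ok fi_ne crossE eq_sym (negPf ff') sameE eqxx normE andbb.
rewrite big1 ?addr0 => [|h /andP[/andP[_ hf'] hf]].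
  by rewrite /=; case: (_ < _)%N; rewrite ?mul0r.
have e1 := crossE h; have e2 := sameE h; rewrite /step_weight /cross_ok e1 e2.
by rewrite (negPf hf') (negPf hf) !andbF mul0r.
Qed.

End Words.

(** * Crossings acting on pairs of words *)

Lemma index_iota0 n x : (x < n)%N -> index x (iota 0 n) = x.
Proof.
move=> lt; rewrite -{1}[x](add0n x) -(nth_iota 0 0 lt) index_uniq ?size_iota //.
exact: iota_uniq.
Qed.

Section Matchings.
Variables (R : comUnitRingType) (z : R) (n : nat).
Local Notation o := (nseq n true ++ nseq n false).
Local Notation N := (size o).
Local Notation S := {ffun 'I_(size o) -> 'I_(size o)}.
Local Notation ampz := (amp (@valid o) (@step_weight R z o)).

(* The i-th top strand is paired with the j-th bottom strand when
   [nth 0 t i = nth 0 b j]. *)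
Definition match_nat (t b : seq nat) (j : nat) : nat :=
  if (j < n)%N then (n + index (nth 0 t j) b)%N else index (nth 0%N b (j - n)) t.
Definition matching t b : S := [ffun j : 'I_(size o) => insubd j (match_nat t b j)].

Definition wordb (t : seq nat) := perm_eq t (iota 0 n).

Lemma wordb_size t : wordb t -> size t = n.
Proof. by move=> /perm_size; rewrite size_iota. Qed.
Lemma wordb_uniq t : wordb t -> uniq t.
Proof. by move=> /perm_uniq; rewrite iota_uniq. Qed.
Lemma wordb_mem t : wordb t -> forall x, (x \in t) = (x < n)%N.
Proof. by move=> /perm_mem h x; rewrite h mem_iota. Qed.
Lemma wordb_nth t i : wordb t -> (i < n)%N -> (nth 0%N t i < n)%N.
Proof. by move=> h lt; rewrite -(wordb_mem h) mem_nth // wordb_size. Qed.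
Lemma wordb_index t x : wordb t -> (x < n)%N -> (index x t < n)%N.
Proof. by move=> h lt; have := wordb_mem h x; rewrite lt -index_mem wordb_size. Qed.

Lemma match_nat_lt t b j : wordb t -> wordb b -> (j < n + n)%N -> (match_nat t b j < n + n)%N.
Proof.
move=> ht hb lt; rewrite /match_nat; case: (ltnP j n) => h.
  by have := wordb_index hb (wordb_nth ht h); lia.
have lt' : (j - n < n)%N by lia.
by have := wordb_index ht (wordb_nth hb lt'); lia.
Qed.

Lemma app_matching t b j : wordb t -> wordb b -> (j < n + n)%N ->
  app (matching t b) j = match_nat t b j.
Proof.
move=> ht hb; rewrite -(size_strands n n) => lt.
have [J ->] : exists J : 'I_N, j = J by exists (Ordinal lt).
have lt_m : (match_nat t b J < N)%N.
  have lt_J : (J < n + n)%N by rewrite -[X in (_ < X)%N](size_strands n n).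
  by rewrite [X in (_ < X)%N](size_strands n n) match_nat_lt.
by rewrite app_ord ffunE val_insubd lt_m.
Qed.

Lemma matching_valid t b : wordb t -> wordb b -> valid (matching t b).
Proof.
move=> ht hb; apply/validP => j lt; have lt' := match_nat_lt ht hb lt.
rewrite !app_matching //; case: (ltnP j n) => h.
  have h1 := wordb_index hb (wordb_nth ht h).
  have -> : match_nat t b j = (n + index (nth 0%N t j) b)%N by rewrite /match_nat h.
  split; last by apply/negbTE; rewrite -leqNgt leq_addr.
  rewrite /match_nat ifF; last by apply/negbTE; rewrite -leqNgt leq_addr.
  rewrite addKn nth_index ?(wordb_mem hb) ?wordb_nth //.
  by rewrite index_uniq ?wordb_uniq ?wordb_size.
have h0 : (j - n < n)%N by lia.
have h1 := wordb_index ht (wordb_nth hb h0).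
have -> : match_nat t b j = index (nth 0%N b (j - n)) t by rewrite /match_nat ltnNge h.
rewrite /match_nat h1; split=> //.
rewrite nth_index ?(wordb_mem ht) ?wordb_nth //.
by rewrite index_uniq ?wordb_uniq ?wordb_size // subnKC.
Qed.

Lemma app_lt_strands (f : S) j : (j < n + n)%N -> (app f j < n + n)%N.
Proof. have := @app_lt n n f j; have := size_strands n n; lia. Qed.

(** Label each pair by the position of its top strand; [b] lists the labels met along the bottom
    strands. *)
Lemma matching_surj (f : S) : valid f ->
  exists2 b, wordb b & f = matching (iota 0 n) b.
Proof.
move=> /validP vf; pose b := mkseq (fun j => app f (n + j)) n.
have bE j : (j < n)%N -> nth 0%N b j = app f (n + j) by move=> lt; rewrite nth_mkseq.
have b_lt j : (j < n)%N -> (app f (n + j) < n)%N.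
  by move=> lt; have [|_] := vf (n + j)%N; lia.
have hb : wordb b.
  apply: uniq_perm; rewrite ?iota_uniq //.
    apply/mkseq_uniqP => i j; rewrite !inE => hi hj e.
    have [|+ _] := vf (n + i)%N; first lia.
    by rewrite e; have [|-> _] := vf (n + j)%N; lia.
  move=> x; rewrite mem_iota /=; apply/mapP/idP => [[j]|lt].
    by rewrite mem_iota => lt ->; exact: b_lt.
  have [|e h] := vf x; first lia.
  exists (app f x - n)%N; first by rewrite mem_iota; have := @app_lt_strands f x; lia.
  by rewrite subnKC ?e //; lia.
have hi : wordb (iota 0 n) by exact: perm_refl.
exists b => //; apply: ffun_appP => j lt; rewrite app_matching // /match_nat.
case: (ltnP j n) => h; last first.
  have lt' : (j - n < n)%N by lia.
  by rewrite bE // subnKC // index_iota0 // -(subnKC h) b_lt.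
have [|e h'] := vf j; first lia.
have lt2 := app_lt_strands f lt.
have e1 : nth 0%N b (app f j - n) = j by rewrite bE ?subnKC ?e //; lia.
have lt3 : (app f j - n < n)%N by lia.
have e2 : index j b = (app f j - n)%N by rewrite -{1}e1 index_uniq ?wordb_uniq ?wordb_size.
by rewrite nth_iota // add0n e2; lia.
Qed.

Lemma matching_inj b b' : wordb b -> wordb b' ->
  matching (iota 0 n) b = matching (iota 0 n) b' -> b = b'.
Proof.
move=> hb hb' e; have hi : wordb (iota 0 n) by exact: perm_refl.
apply: (@eq_from_nth _ 0%N) => [|j]; rewrite !wordb_size // => lt.
have := congr1 (fun f => app f (n + j)) e; rewrite !app_matching; [|lia..].
have nj : (n + j < n)%N = false by lia.
by rewrite /match_nat nj !addKn !index_iota0 ?wordb_nth.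
Qed.

Lemma sum_valid (F : S -> R) :
  \sum_(f | valid f) F f = \sum_(b <- permutations (iota 0 n)) F (matching (iota 0 n) b).
Proof.
rewrite -big_enum -(big_map (matching (iota 0 n)) predT F); apply: perm_big.
apply: uniq_perm; rewrite ?enum_uniq //.
  rewrite map_inj_in_uniq ?permutations_uniq // => b b'.
  by rewrite !mem_permutations; exact: matching_inj.
move=> f; rewrite mem_enum unfold_in; apply/idP/mapP => [/matching_surj[b hb ->]|[b]].
  by exists b; rewrite // mem_permutations.
by rewrite mem_permutations => hb ->; apply: matching_valid => //; exact: perm_refl.
Qed.

Lemma perm_swap (T : eqType) (p : seq T) c x q s :
  perm_eq (p ++ c :: x :: q) s -> perm_eq (p ++ x :: c :: q) s.
Proof.
apply: perm_trans; rewrite perm_cat2l.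
by rewrite -[x :: c :: q]/([:: x; c] ++ q) -[c :: x :: q]/([:: c; x] ++ q) perm_cat2r (perm_catC [:: x] [:: c]).
Qed.

Lemma match_nat_swap_top p c x q b j : wordb (p ++ c :: x :: q) -> wordb b ->
  match_nat (p ++ x :: c :: q) b (transpose (size p) j) =
  transpose (size p) (match_nat (p ++ c :: x :: q) b j).
Proof.
move=> ht hb; have szt := wordb_size ht; rewrite size_cat /= in szt.
have cx : c != x.
  have := wordb_uniq ht; rewrite cat_uniq => /and3P[_ _] /=.
  by rewrite inE negb_or -andbA => /and3P[].
rewrite /match_nat; case: (ltnP j n) => h.
  rewrite transpose_lt //; last lia.
  by rewrite nth_transpose /transpose !ifF //; apply/eqP; lia.
have tj : transpose (size p) j = j by rewrite /transpose !ifF //; apply/eqP; lia.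
rewrite tj ltnNge h /=; apply: index_transpose => //; exact: wordb_uniq ht.
Qed.

Lemma match_nat_swap_bot p c x q t j : wordb (p ++ c :: x :: q) -> wordb t ->
  (j < n + n)%N ->
  match_nat t (p ++ x :: c :: q) (transpose (n + size p) j) =
  transpose (n + size p) (match_nat t (p ++ c :: x :: q) j).
Proof.
move=> hb ht lt_j; have szt := wordb_size hb; rewrite size_cat /= in szt.
have cx : c != x.
  have := wordb_uniq hb; rewrite cat_uniq => /and3P[_ _] /=.
  by rewrite inE negb_or -andbA => /and3P[].
have tD k : transpose (n + size p) (n + k) = (n + transpose (size p) k)%N.
  by rewrite /transpose -addnS !eqn_add2l; do 2 case: eqP => // _.
rewrite /match_nat; case: (ltnP j n) => h.
  have tj : transpose (n + size p) j = j by rewrite /transpose !ifF //; apply/eqP; lia.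
  rewrite tj h tD; congr (_ + _)%N; apply: index_transpose => //; exact: wordb_uniq hb.
rewrite -(subnKC h) tD !ifF; try lia.
rewrite !addKn nth_transpose.
have lt_jn : (j - n < n)%N by lia.
have lt_t := wordb_index ht (wordb_nth hb lt_jn).
by rewrite /transpose !ifF //; apply/eqP; lia.
Qed.

(** [amp_step] read on words: crossing exchanges two adjacent letters of one word, and nestedness
    compares their positions in the other. *)
Lemma amp_top p c x q b ws g : wordb (p ++ c :: x :: q) -> wordb b ->
  ampz (size p :: ws) (matching (p ++ c :: x :: q) b) g =
  ampz ws (matching (p ++ x :: c :: q) b) g +
  (if (index x b < index c b)%N then z * ampz ws (matching (p ++ c :: x :: q) b) g else 0).
Proof.
move=> ht hb; have ht' := perm_swap ht; have szt := wordb_size ht; rewrite size_cat /= in szt.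
rewrite (@amp_step _ _ n n _ _ _ (matching (p ++ x :: c :: q) b));
  [|lia|lia|exact: matching_valid|exact: matching_valid|].
  have lt1 : (size p < n)%N by lia.
  have lt2 : ((size p).+1 < n)%N by lia.
  rewrite !app_matching //; [|lia..]; rewrite /match_nat lt1 lt2.
  by rewrite !nth_cat ltnn subnn [((size p).+1 < size p)%N]ltnNge leqnSn subSnn /= ltn_add2l.
move=> j lt_j; have lt_t : (transpose (size p) j < n + n)%N by apply: transpose_lt => //; lia.
rewrite !app_matching //; exact: match_nat_swap_top.
Qed.

Lemma amp_bot p c x q t ws g : wordb (p ++ c :: x :: q) -> wordb t ->
  ampz ((n + size p)%N :: ws) (matching t (p ++ c :: x :: q)) g =
  ampz ws (matching t (p ++ x :: c :: q)) g +
  (if (index x t < index c t)%N then z * ampz ws (matching t (p ++ c :: x :: q)) g else 0).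
Proof.
move=> hb ht; have hb' := perm_swap hb; have szt := wordb_size hb; rewrite size_cat /= in szt.
rewrite (@amp_step _ _ n n _ _ _ (matching t (p ++ x :: c :: q)));
  [|lia|lia|exact: matching_valid|exact: matching_valid|].
  have ge1 : (n + size p < n)%N = false by lia.
  have ge2 : ((n + size p).+1 < n)%N = false by lia.
  rewrite !app_matching //; [|lia..]; rewrite /match_nat ge1 ge2.
  by rewrite -addnS !addKn !nth_cat ltnn subnn [((size p).+1 < size p)%N]ltnNge leqnSn subSnn.
move=> j lt_j; have lt_t : (transpose (n + size p) j < n + n)%N by apply: transpose_lt => //; lia.
rewrite !app_matching //; exact: match_nat_swap_bot.
Qed.

End Matchings.

(** * Sweeping blocks of crossings over words *)

Fixpoint blocks (i : nat) (la : seq nat) : seq nat :=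
  if la is m :: la' then iota i m.-1 ++ blocks (i + m) la' else [::].

Fixpoint compss (a : seq nat) : seq (seq (seq nat)) :=
  if a is m :: a' then [seq c :: C | c <- comps m, C <- compss a'] else [:: [::]].

Definition ivals (C : seq (seq nat)) (segs : seq (seq nat)) : seq (seq (seq nat)) :=
  [seq reshape p.1 p.2 | p <- zip C segs].

(** Normality of the switches in one block: the heads are the letters carried successively, and at a
    switch the letter picked up must have a smaller [r] than the one put down. *)
Definition heads_desc (r : nat -> nat) (Is : seq (seq nat)) : bool :=
  sorted (fun I J => r (head 0%N J) < r (head 0%N I))%N Is.

Section Sweeps.
Variables (R : comUnitRingType) (z : R).

(* Sweeping a block of crossings: the letter [c] is carried to the right; at a
   switch it is put down and the next letter is picked up. *)
Fixpoint bsum (f : seq nat -> R) (r : nat -> nat) acc c w : R :=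
  if w is x :: w' then
    bsum f r (rcons acc x) c w' +
    (if (r x < r c)%N then z * bsum f r (rcons acc c) x w' else 0)
  else f (rcons acc c).

Fixpoint blsum (f : seq nat -> R) (r : nat -> nat) acc (segs : seq (seq nat)) : R :=
  if segs is seg :: segs' then
    if seg is c :: w then bsum (fun out => blsum f r out segs') r acc c w
    else blsum f r acc segs'
  else f acc.

Lemma bsum_eq f f' r acc c w :
  (forall out, perm_eq out (acc ++ c :: w) -> f out = f' out) ->
  bsum f r acc c w = bsum f' r acc c w.
Proof.
elim: w acc c => [|x w IHw] acc c ff' /=.
  by rewrite ff' // -cats1.
have e1 : bsum f r (rcons acc x) c w = bsum f' r (rcons acc x) c w.
  by apply: IHw => out h; apply: ff'; rewrite cat_rcons in h; apply: (perm_trans h); exact: perm_swap.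
have e2 : bsum f r (rcons acc c) x w = bsum f' r (rcons acc c) x w.
  by apply: IHw => out h; apply: ff'; rewrite cat_rcons in h.
by rewrite e1 e2.
Qed.

Lemma blsum_eq f f' r acc segs :
  (forall out, perm_eq out (acc ++ flatten segs) -> f out = f' out) ->
  blsum f r acc segs = blsum f' r acc segs.
Proof.
elim: segs acc => [|[|c w] segs IHs] acc ff' /=; first by rewrite ff' // cats0.
  exact: IHs.
apply: bsum_eq => out h; apply: IHs => out' h'; apply: ff'.
by rewrite (permPl h') /= -cat_cons catA perm_cat2r.
Qed.

(** Each switch ends an interval, whose first letter has been carried past the others and put down
    last; the interval is thereby rotated by one. The word [u] holds the letters passed by [c] since
    the last switch, so the first part of the composition is at least (size u).+1. *)
Lemma bsum_comps f r acc u c w :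
  bsum f r (acc ++ u) c w =
  \sum_(k <- comps_acc (size u).+1 (size w))
    (if heads_desc r (reshape k (c :: u ++ w)) then
       z ^+ (size k).-1 * f (acc ++ flatten (map (rot 1) (reshape k (c :: u ++ w))))
     else 0).
Proof.
elim: w acc u c => [|x w IHw] acc u c /=.
  rewrite big_seq1 cats0 /= take_oversize // /heads_desc /= mul1r cats0.
  by rewrite /rot /= take0 drop0 -cats1 catA.
rewrite big_cat [rcons (acc ++ u) x]rcons_cat IHw size_rcons cat_rcons; congr (_ + _).
rewrite big_map -[rcons _ c]cats0 IHw.
case: ifP => rx; last first.
  rewrite big1_seq // => k /=; rewrite mem_comps_acc // => /and3P[_ _].
  rewrite /heads_desc take_size_cat // drop_size_cat //.
  by case: k => [|[|i] k] //= _; rewrite rx.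
rewrite mulr_sumr; apply: eq_big_seq => k; rewrite mem_comps_acc // => /and3P[_ _].
rewrite /= take_size_cat // drop_size_cat //; case: k => [|[|i] k] //= _.
rewrite /heads_desc /= rx; case: ifP => _; last by rewrite mulr0.
by rewrite /= mulrA -exprS !rot1_cons rcons_cat -catA.
Qed.

Lemma blsum_comps f r acc segs : all (fun s => s != [::]) segs ->
  blsum f r acc segs =
  \sum_(C <- compss (map size segs))
    (if all (heads_desc r) (ivals C segs) then
       z ^+ sumn [seq (size c).-1 | c <- C] *
       f (acc ++ flatten (map (rot 1) (flatten (ivals C segs))))
     else 0).
Proof.
elim: segs acc => [|[|c w] segs IHs] acc //=.
  by move=> _; rewrite big_seq1 /= cats0 mul1r.
move=> ne; rewrite big_allpairs_dep -[acc in LHS]cats0 (bsum_comps _ r acc [::]) /=.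
apply: eq_bigr => k _.
case: ifP => hd; last by rewrite big1 // => C _; rewrite /ivals /= hd.
rewrite IHs // mulr_sumr; apply: eq_bigr => C _.
rewrite /ivals /=; case: ifP => _; last by rewrite mulr0.
by rewrite mulrA -exprD map_cat flatten_cat catA.
Qed.

Section Reading.
Variables (r : nat -> nat) (nxt : nat -> nat).

(* Amplitude for a sweep to turn the word [.. y :: w] into its image under
   [nxt], when the letter [c] is carried at the position of [y]. *)
Fixpoint rd c y w : R :=
  if w is x :: w' then
    (x == nxt y)%:R * rd c x w' +
    (if (r x < r c)%N then z * ((c == nxt y)%:R * rd x x w') else 0)
  else (c == nxt y)%:R.

Definition rds seg : R := if seg is c :: w then rd c c w else 1.

Lemma eqseq_rcons_nat (a b : seq nat) x y : (rcons a x == rcons b y) = (a == b) && (x == y).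
Proof. exact: eqseq_rcons. Qed.

(** What lies to the left of the carried letter is final, so a prescribed output can be tested
    letter by letter during the sweep. *)
Lemma bsum_rd (G : R) T acc c y w :
  bsum (fun out => (out == T ++ nxt y :: map nxt w)%:R * G) r acc c w =
  (acc == T)%:R * rd c y w * G.
Proof.
elim: w T acc c y => [|x w IHw] T acc c y /=.
  by rewrite cats1 eqseq_rcons_nat; case: (acc == T); rewrite /= ?mul1r ?mul0r.
have E acc' c' : bsum (fun out => (out == T ++ [:: nxt y, nxt x & map nxt w])%:R * G) r acc' c' w =
    (acc' == rcons T (nxt y))%:R * rd c' x w * G.
  by rewrite -IHw cat_rcons.
rewrite !E !eqseq_rcons_nat; case: (acc == T); last by rewrite /= !mul0r mulr0 if_same addr0.
rewrite /= !mul1r mulrDl; congr (_ + _).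
by case: ifP => _; rewrite ?mul0r // !mulrA.
Qed.

Lemma blsum_rd T acc segs :
  blsum (fun out => (out == T ++ map nxt (flatten segs))%:R) r acc segs =
  (acc == T)%:R * \prod_(seg <- segs) rds seg.
Proof.
elim: segs T acc => [|[|c w] segs IHs] T acc /=.
- by rewrite cats0 big_nil mulr1.
- by rewrite big_cons mul1r IHs.
rewrite big_cons mulrA -bsum_rd; apply: bsum_eq => out _.
rewrite -(IHs (T ++ nxt c :: map nxt w)); apply: blsum_eq => out' _.
by rewrite -catA /= map_cat.
Qed.
End Reading.
End Sweeps.

Section RulingWords.
Variables (R : comUnitRingType) (z : R) (n : nat).
Local Notation o := (nseq n true ++ nseq n false).
Local Notation S := {ffun 'I_(size o) -> 'I_(size o)}.
Local Notation ampz := (amp (@valid o) (@step_weight R z o)).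
Local Notation wordb := (wordb n).

Lemma amp_block_top p c w q b ws g : wordb (p ++ c :: w ++ q) -> wordb b ->
  ampz (iota (size p) (size w) ++ ws) (matching n (p ++ c :: w ++ q) b) g =
  bsum z (fun out => ampz ws (matching n (out ++ q) b) g) (index^~ b) p c w.
Proof.
elim: w p c => [|x w IHw] p c ht hb; first by rewrite /= cat_rcons.
rewrite [iota _ _ ++ _]/= amp_top // -[p ++ x :: _]cat_rcons -[p ++ c :: _]cat_rcons.
have e y : (size p).+1 = size (rcons p y) by rewrite size_rcons.
rewrite {1}(e x) IHw ?cat_rcons //; last exact: perm_swap.
by rewrite [in RHS]/=; congr (_ + _); case: ifP => // _; rewrite (e c) -cat_rcons IHw ?cat_rcons.
Qed.

Lemma amp_block_bot p c w q t ws g : wordb (p ++ c :: w ++ q) -> wordb t ->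
  ampz (iota (n + size p) (size w) ++ ws) (matching n t (p ++ c :: w ++ q)) g =
  bsum z (fun out => ampz ws (matching n t (out ++ q)) g) (index^~ t) p c w.
Proof.
elim: w p c => [|x w IHw] p c ht hb; first by rewrite /= cat_rcons.
rewrite [iota _ _ ++ _]/= amp_bot // -[p ++ x :: _]cat_rcons -[p ++ c :: _]cat_rcons -addnS.
have e y : (size p).+1 = size (rcons p y) by rewrite size_rcons.
rewrite {1}(e x) IHw ?cat_rcons //; last exact: perm_swap.
by rewrite [in RHS]/=; congr (_ + _); case: ifP => // _; rewrite (e c) -cat_rcons IHw ?cat_rcons.
Qed.

Lemma amp_blocks_top p segs b ws g : wordb (p ++ flatten segs) -> wordb b ->
  ampz (blocks (size p) (map size segs) ++ ws) (matching n (p ++ flatten segs) b) g =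
  blsum z (fun out => ampz ws (matching n out b) g) (index^~ b) p segs.
Proof.
elim: segs p => [|[|c w] segs IHs] p ht hb /=; first by rewrite cats0.
  by rewrite addn0 IHs.
rewrite -catA amp_block_top //; apply: bsum_eq => out h.
have szo : size out = (size p + (size w).+1)%N by rewrite (perm_size h) size_cat.
rewrite -szo; apply: IHs => //.
by apply: perm_trans ht; rewrite /= -cat_cons catA perm_cat2r.
Qed.

Lemma amp_blocks_bot p segs t ws g : wordb (p ++ flatten segs) -> wordb t ->
  ampz (blocks (n + size p) (map size segs) ++ ws) (matching n t (p ++ flatten segs)) g =
  blsum z (fun out => ampz ws (matching n t out) g) (index^~ t) p segs.
Proof.
elim: segs p => [|[|c w] segs IHs] p ht hb /=; first by rewrite cats0.
  by rewrite addn0 IHs.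
rewrite -catA amp_block_bot //; apply: bsum_eq => out h.
have szo : size out = (size p + (size w).+1)%N by rewrite (perm_size h) size_cat.
rewrite -addnA -szo; apply: IHs => //.
by apply: perm_trans ht; rewrite /= -cat_cons catA perm_cat2r.
Qed.

(** A matching is unchanged when the letters of both words are relabelled together; relabelling by
    [nth 0 t'] turns the identity word into [t'] and [b] into its image. *)
Lemma matching_closed t' b b' : wordb t' -> wordb b -> wordb b' ->
  (matching n t' b' == matching n (iota 0 n) b) = (b' == map (nth 0%N t') b).
Proof.
move=> ht' hb hb'; have hi : wordb (iota 0 n) by exact: perm_refl.
apply/eqP/eqP => [e|->].
  apply: (@eq_from_nth _ 0%N) => [|j]; rewrite ?size_map !(wordb_size hb', wordb_size hb) // => lt.
  have := congr1 (fun f => app f (n + j)) e; rewrite !app_matching //; [|lia..].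
  have nj : (n + j < n)%N = false by lia.
  rewrite /match_nat nj !addKn index_iota0 ?wordb_nth // => ej.
  rewrite (nth_map 0%N) ?(wordb_size hb) // -ej nth_index //.
  by rewrite (wordb_mem ht') wordb_nth.
have hm : wordb (map (nth 0%N t') b).
  have e : map (nth 0%N t') (iota 0 n) = t'.
    by rewrite -[RHS](mkseq_nth 0%N) (wordb_size ht').
  by apply: (perm_trans (perm_map (nth 0%N t') hb)); rewrite e.
apply: ffun_appP => j lt_j; rewrite !app_matching // /match_nat; case: ifP => h.
  rewrite nth_iota // add0n; congr (_ + _)%N.
  have jb : j \in b by rewrite (wordb_mem hb).
  have <- : nth 0%N (map (nth 0%N t') b) (index j b) = nth 0%N t' j.
    by rewrite (nth_map 0%N) ?index_mem // nth_index.
  by rewrite index_uniq ?size_map ?index_mem // (wordb_uniq hm).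
have lt' : (j - n < n)%N by lia.
rewrite (nth_map 0%N) ?(wordb_size hb) // index_uniq ?(wordb_size ht') ?(wordb_uniq ht') ?wordb_nth //.
by rewrite index_iota0 ?wordb_nth.
Qed.

End RulingWords.

(** * Summation over words by removal of intervals *)

Lemma perm_prefix_permutations (T : eqType) (J s s' : seq T) : uniq s -> perm_eq (J ++ s') s ->
  perm_eq [seq b <- permutations s | prefix J b] [seq J ++ b | b <- permutations s'].
Proof.
move=> us ps; apply: uniq_perm.
- exact/filter_uniq/permutations_uniq.
- rewrite map_inj_in_uniq ?permutations_uniq // => b b' _ _ e.
  by have := congr1 (drop (size J)) e; rewrite !drop_size_cat.
move=> b; rewrite mem_filter mem_permutations; apply/andP/mapP => [[/prefixP[b' ->]] h|[b' + ->]].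
  exists b' => //; rewrite mem_permutations -(perm_cat2l J); apply: (perm_trans h).
  by rewrite perm_sym.
rewrite mem_permutations => h; rewrite prefix_prefix; split=> //.
by apply: perm_trans ps; rewrite perm_cat2l.
Qed.

Section Removal.
Variables (R : comUnitRingType) (z : R) (r nxt : nat -> nat).
Local Notation rd := (rd z r nxt).
Local Notation rds := (rds z r nxt).
Local Notation letters B := (flatten (flatten B)).

(* The intervals of each top block are listed from the last one to the first. *)
Definition tops_ok b (B : seq (seq (seq nat))) : bool :=
  all (sorted (fun I J => index (head 0 I) b < index (head 0 J) b)%N) B.

(** In the application, [nxt] rotates each interval and [r] is the position in the top word after
    its sweep. Since the blocks are listed in reverse, [r] decreases inside a block while it
    increases from block to block. *)
Definition wf_ivals (B : seq (seq (seq nat))) : Prop :=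
  [/\ uniq (letters B),
      all (fun I => (I != [::]) && fcycle nxt I) (flatten B),
      all (pairwise (fun I J => allrel (fun x y => r y < r x)%N I J)) B
    & pairwise (fun Is Js => allrel (fun x y => r x < r y)%N (flatten Is) (flatten Js)) B].

(** The weight of reading [b] when [m] letters of the current bottom block remain and the blocks
    [ms] follow; [ok] is the normality condition that a preceding switch puts on the first
    letter. *)
Definition start (ok : pred nat) m ms b : R :=
  if b is x :: b' then
    if ok x then rd x x (take m.-1 b') * \prod_(seg <- reshape ms (drop m.-1 b')) rds seg
    else 0
  else 0.

Definition Zst B m ms ok : R :=
  \sum_(b <- permutations (letters B)) (if tops_ok b B then start ok m ms b else 0).

(** The removal process with only the lengths of the intervals kept. An interval of length k has k
    starting letters; after a switch the next one comes from a block of index at most i, hence the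
    bound i.+1; a new bottom block starts without restriction. [N] is fuel, at least the number of
    remaining letters in every use. *)
Fixpoint Zn N (C : seq (seq nat)) m ms ptr : R :=
  if N is N'.+1 then
    \sum_(i < ptr)
      (if nth [::] C i is k :: c then
         if (k <= m)%N then
           k%:R * (if m == k then
                     if ms is m' :: ms' then Zn N' (set_nth [::] C i c) m' ms' (size C) else 1
                   else z * Zn N' (set_nth [::] C i c) (m - k)%N ms i.+1)
         else 0
       else 0)
  else 0.

(** Before its cycle closes, [c] is never the letter required at the current place, so it cannot be
    put down, and the letters read are forced to be successive images under [nxt]. *)
Lemma rd_chain (c y : nat) (js w : seq nat) : fpath nxt y js -> c \notin js ->
  rd c y w = if prefix js w then rd c (last y js) (drop (size js) w) else 0.
Proof.
elim: js y w => [|a js IHjs] y w /=; first by rewrite prefix0s drop0.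
case/andP => /eqP <- pjs; rewrite inE negb_or => /andP[cy cjs].
case: w => [|v w] /=; first by rewrite (negPf cy).
rewrite (negPf cy) mul0r mulr0 if_same addr0 [nxt y == v]eq_sym.
by case: eqP => [->|_]; rewrite ?mul0r // mul1r IHjs.
Qed.

(** When the cycle closes, [c] itself is required: it is put down at a switch or at the end of the
    block. *)
Lemma rd_closed (c y : nat) (w : seq nat) : nxt y = c -> c \notin w ->
  rd c y w = if w is x :: w' then if (r x < r c)%N then z * rd x x w' else 0 else 1.
Proof.
case: w => [|x w] /= ->; first by rewrite eqxx.
rewrite inE negb_or => /andP[cx _]; rewrite [x == c]eq_sym (negPf cx) mul0r add0r.
by rewrite eqxx mul1r.
Qed.

Definition next_start ms b : R :=
  if ms is m' :: ms' then start predT m' ms' b else 1.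

(** By [rd_chain] and [rd_closed] the word must begin with the whole cycle of its first letter, and
    this cycle has to fit inside the current bottom block. *)
Lemma start_chain ok m ms (x : nat) (js b : seq nat) : (0 < m)%N -> uniq (x :: js) -> fcycle nxt (x :: js) ->
  x \notin b -> all (fun i => (0 < i)%N) ms -> size b = (m + sumn ms - 1)%N ->
  start ok m ms (x :: b) =
  if prefix js b && (size js < m)%N then
    if ok x then
      if m == (size js).+1 then next_start ms (drop (size js) b)
      else z * start (fun y => r y < r x)%N (m - (size js).+1)%N ms (drop (size js) b)
    else 0
  else 0.
Proof.
case: m => // m _ /= /andP[xjs ujs]; rewrite rcons_path => /andP[pjs /eqP lastx] xb ms0 szb.
case: (ok x); last by rewrite if_same.
rewrite (rd_chain (take m b) pjs xjs) ltnS.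
have -> : prefix js (take m b) = prefix js b && (size js <= m)%N.
  apply/idP/andP => [h|[/prefixP[b' ->] le]].
    split; first exact: prefix_trans h (prefix_take _ _).
    by rewrite (leq_trans (size_prefix h)) // size_take_min geq_minl.
  by rewrite take_cat ltnNge le /= prefix_prefix.
case: ifP => [/andP[pre le]|_]; last by rewrite mul0r.
have [b' bE] : exists b' : seq nat, b = js ++ b'.
  by case/prefixP: pre => b' ->; exists b'.
move: xb szb; rewrite {}bE => xb szb; rewrite take_cat ltnNge le /= [drop m _]drop_cat ltnNge le /= !drop_size_cat //.
rewrite eqSS subSS; rewrite mem_cat negb_or in xb; case/andP: xb => _ xb.
rewrite size_cat in szb.
rewrite rd_closed //; last by apply: contra xb; exact: mem_take.
have [mE|ne] := eqVneq m (size js).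
  rewrite [in take _ _]mE [in drop _ _]mE subnn take0 drop0 mul1r /next_start.
  case: ms ms0 szb => [|m' ms] /=; first by rewrite big_nil.
  case/andP => m'0 _ szb; rewrite big_cons.
  have : (0 < size b')%N by lia.
  case: m' b' m'0 {xb szb} => [|m'] [|x' b'] //= _ _.
have : (0 < size b')%N by lia.
have [k ->] : exists k, (m - size js)%N = k.+1 by exists (m - size js).-1; lia.
case: b' {szb xb} => [|x' b'] //= _.
by case: ifP; rewrite ?mul0r ?mulr0 // mulrA.
Qed.

Lemma lettersE (B1 : seq (seq (seq nat))) Is B2 :
  letters (B1 ++ Is :: B2) = letters B1 ++ flatten Is ++ letters B2.
Proof.
rewrite !flatten_cat; congr (_ ++ _).
Qed.

Lemma letters_pop B1 (I : seq nat) Is B2 :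
  perm_eq (letters (B1 ++ (I :: Is) :: B2)) (I ++ letters (B1 ++ Is :: B2)).
Proof.
by rewrite !lettersE -[flatten (I :: Is)]/(I ++ flatten Is) -catA perm_catCA.
Qed.

Lemma wf_pop B1 (I : seq nat) Is B2 :
  wf_ivals (B1 ++ (I :: Is) :: B2) -> wf_ivals (B1 ++ Is :: B2).
Proof.
case=> uB nB rB sB; split.
- by move: uB; rewrite (perm_uniq (letters_pop _ _ _ _)) cat_uniq => /and3P[].
- have e Js : flatten (Js :: B2) = Js ++ flatten B2 by [].
  move: nB; rewrite !flatten_cat !e !all_cat [all _ (I :: Is)]/=.
  by move=> /and3P[-> /andP[_ ->] ->].
- by move: rB; rewrite !all_cat /= => /andP[-> /andP[/andP[_ ->] ->]].
have e : flatten (I :: Is) = I ++ flatten Is by [].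
move: sB; rewrite !pairwise_cat !pairwise_cons !allrel_consr => /and3P[/andP[h1 ->] -> /andP[h2 ->]].
rewrite !andbT; apply/andP; split.
  move: h1; apply: sub_all => Js; rewrite e /allrel; apply: sub_all => y /=.
  by rewrite all_cat => /andP[].
by move: h2; apply: sub_all => Js; rewrite e /allrel all_cat => /andP[].
Qed.

Lemma wf_nonempty B (I : seq nat) : wf_ivals B -> I \in flatten B -> I != [::].
Proof. by case=> _ /allP nB _ _ /nB /andP[]. Qed.

Lemma head_mem (I : seq nat) : I != [::] -> head 0%N I \in I.
Proof. by case: I => //= x I _; rewrite inE eqxx. Qed.

(** Deleting the prefix [J] lowers the positions of all other heads by the same amount, and [I],
    made of the letters of [J], precedes the rest of its block. *)
Lemma tops_ok_pop B1 (I : seq nat) Is B2 (J b : seq nat) :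
  wf_ivals (B1 ++ (I :: Is) :: B2) -> J =i I ->
  tops_ok (J ++ b) (B1 ++ (I :: Is) :: B2) = tops_ok b (B1 ++ Is :: B2).
Proof.
move=> wfB JI; have wfB' := wf_pop wfB; case: (wfB) => uB _ _ _.
rewrite (perm_uniq (letters_pop _ _ _ _)) cat_uniq in uB.
have IB : I \in flatten (B1 ++ (I :: Is) :: B2).
  by rewrite flatten_cat mem_cat /= inE eqxx orbT.
have shift K : K \in flatten (B1 ++ Is :: B2) ->
    index (head 0%N K) (J ++ b) = (size J + index (head 0%N K) b)%N.
  move=> KB; rewrite index_cat JI ifF //; apply: contraTF uB => KI.
  rewrite negb_and; apply/orP; right; rewrite negb_and; apply/orP; left; rewrite negbK.
  apply/hasP; exists (head 0%N K) => //; apply/flattenP; exists K => //.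
  exact/head_mem/(wf_nonempty wfB').
have sortedE Ks : {subset Ks <= flatten (B1 ++ Is :: B2)} ->
    sorted (fun K L => index (head 0 K) (J ++ b) < index (head 0 L) (J ++ b))%N Ks =
    sorted (fun K L => index (head 0 K) b < index (head 0 L) b)%N Ks.
  move=> sub; apply: (@eq_in_sorted _ (mem (flatten (B1 ++ Is :: B2)))).
    by move=> K L KB LB; rewrite !shift // ltn_add2l.
  by apply/allP => K /sub.
have subB Ks : Ks \in B1 ++ Is :: B2 -> {subset Ks <= flatten (B1 ++ Is :: B2)}.
  by move=> h K KK; apply/flattenP; exists Ks.
rewrite /tops_ok !all_cat /=; congr (_ && (_ && _)).
- by apply: eq_in_all => Ks h; apply: sortedE; apply: subB; rewrite mem_cat h.
- have subI : {subset Is <= flatten (B1 ++ Is :: B2)}.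
    by apply: subB; rewrite mem_cat inE eqxx orbT.
  have IJ : head 0%N I \in J by rewrite JI head_mem // (wf_nonempty wfB IB).
  rewrite -(sortedE _ subI); case: Is subI {IB wfB wfB' uB sortedE subB} shift => //= K Ks subI shift.
  rewrite (shift K (subI _ (mem_head _ _))) index_cat IJ.
  by rewrite (leq_trans _ (leq_addr _ _)) // index_mem.
by apply: eq_in_all => Ks h; apply: sortedE; apply: subB; rewrite mem_cat inE h !orbT.
Qed.

Lemma uniq_flatten_mem (T : eqType) (ss : seq (seq T)) s : uniq (flatten ss) -> s \in ss -> uniq s.
Proof.
move=> u /splitPr h; case: h u => s1 s2; rewrite flatten_cat cat_uniq => /and3P[_ _] /=.
by rewrite cat_uniq => /andP[].
Qed.

Lemma start_rot B (I : seq nat) (x : nat) (b : seq nat) m ms ok :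
  wf_ivals B -> I \in flatten B -> x \in I -> perm_eq (x :: b) (letters B) ->
  (0 < m)%N -> all (fun i => (0 < i)%N) ms -> size (letters B) = (m + sumn ms)%N ->
  start ok m ms (x :: b) =
  if prefix (rot (index x I) I) (x :: b) && (size I <= m)%N then
    if ok x then
      if m == size I then next_start ms (drop (size I) (x :: b))
      else z * start (fun y => r y < r x)%N (m - size I)%N ms (drop (size I) (x :: b))
    else 0
  else 0.
Proof.
move=> wfB IB xI pb m0 ms0 szB.
have [uB /allP nB _ _] := wfB; have /andP[nI cI] := nB _ IB.
have uI : uniq I := uniq_flatten_mem uB IB.
have := rot_index xI; set js := _ ++ _ => rotE.
have szI : size I = (size js).+1 by rewrite -(size_rot (index x I)) rotE.
have xb : x \notin b.
  have : uniq (x :: b) by rewrite (perm_uniq pb).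
  by rewrite cons_uniq => /andP[].
rewrite (@start_chain ok m ms x js b) //.
- by rewrite rotE /= eqxx szI.
- by rewrite -rotE rot_uniq.
- by rewrite -rotE rot_cycle.
- by have := perm_size pb; rewrite szB /=; lia.
Qed.

(** Otherwise the predecessor of [I] in its block would have its head before that of [I], hence
    inside a prefix of [b] consisting of letters of [I]. *)
Lemma tops_ok_head B (Is : seq (seq nat)) (I : seq nat) (b : seq nat) :
  wf_ivals B -> Is \in B -> I \in Is -> tops_ok b B -> head 0%N b \in I ->
  prefix (rot (index (head 0%N b) I) I) b -> I = head [::] Is.
Proof.
move=> wfB IsB IIs /allP/(_ _ IsB) srt xI pre.
have [uB _ _ _] := wfB.
have IB : I \in flatten B by apply/flattenP; exists Is.
have [p [lt_p IE]] : exists p, (p < size Is)%N /\ I = nth [::] Is p.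
  by exists (index I Is); rewrite index_mem nth_index.
case: p lt_p IE => [|p] lt_p IE; first by rewrite -nth0.
have /(sortedP [::])/(_ p lt_p) := srt; rewrite -IE; set K := nth [::] Is p => lt_KI.
have KIs : K \in Is by rewrite mem_nth // ltnW.
have KB : K \in flatten B by apply/flattenP; exists Is.
have hK := head_mem (wf_nonempty wfB KB); have hI := head_mem (wf_nonempty wfB IB).
have KI : head 0%N K \notin I.
  apply/negP => h; have [_ _ /allP/(_ _ IsB)/(pairwiseP [::]) rB _] := wfB.
  have := rB p p.+1; rewrite !inE -IE => /(_ (ltnW lt_p) lt_p (ltnSn p)) /allrelP/(_ _ _ hK h).
  by rewrite ltnn.
have [J [b' [JI bE]]] : exists (J b' : seq nat), J =i I /\ b = J ++ b'.
  case/prefixP: pre => b' bE; exists (rot (index (head 0%N b) I) I), b'.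
  by split=> // y; rewrite mem_rot.
move: lt_KI; rewrite {}bE !index_cat !JI (negPf KI) hI ltnNge => /negP[].
by apply: leq_trans (leq_addr _ _); exact: index_size.
Qed.

(** A word of nonzero weight begins with a rotation of the first listed interval of some block, and
    its first letter determines both the block and the rotation. *)
Lemma Zst_split B m ms ok : wf_ivals B -> (0 < m)%N -> all (fun i => (0 < i)%N) ms ->
  size (letters B) = (m + sumn ms)%N ->
  Zst B m ms ok = \sum_(i < size B)
    (if nth [::] B i is K :: Is then
       \sum_(x <- K) \sum_(b <- permutations (letters (set_nth [::] B i Is)))
         (if tops_ok b (set_nth [::] B i Is) then
            start ok m ms (rot (index x K) K ++ b) else 0)
     else 0).
Proof.
move=> wfB m0 ms0 szB; have [uB _ _ _] := wfB.
pose g b := if tops_ok b B then start ok m ms b else 0.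
pose hl := flatten (map (head [::]) B).
have hlB (x : nat) : x \in hl -> exists2 I, I \in map (head [::]) B & x \in I.
  by move/flattenP => [I h1 h2]; exists I.
have hl_uniq : uniq hl.
  apply: subseq_uniq uB; rewrite /hl; elim: (B) => //= Is B' IHB.
  rewrite flatten_cat; apply: cat_subseq => //.
  by case: Is => //= J Js; exact: prefix_subseq.
have gE b : b \in permutations (letters B) -> g b = \sum_(x <- hl | head 0%N b == x) g b.
  rewrite mem_permutations => pb.
  case: b pb => [|x b] pb; first by have := perm_size pb; rewrite szB /=; lia.
  have [x_hl|x_hl] := boolP (x \in hl).
    rewrite (big_rem x) //= eqxx big1_seq ?addr0 // => y /andP[/eqP <-].
    by rewrite mem_rem_uniqF.
  rewrite big1_seq => [|y /andP[/eqP <- xh]]; last by rewrite xh in x_hl.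
  rewrite /g; case: ifP => // tops.
  have /flattenP[I IB xI] : x \in letters B by rewrite -(perm_mem pb) mem_head.
  have /flattenP[Is IsB IIs] := IB.
  rewrite (start_rot ok wfB IB xI pb m0 ms0 szB); case: andP => // -[pre _].
  have Ih := tops_ok_head wfB IsB IIs tops xI pre.
  case/negP: x_hl; apply/flattenP; exists I => //.
  by apply/mapP; exists Is.
rewrite /Zst (eq_big_seq _ gE) (exchange_big_dep predT) //= /hl big_flatten big_map (big_nth [::]) big_mkord.
apply: eq_bigr => i _; move: (nat_of_ord i) (ltn_ord i) => {}i lt_i.
have [B1 [B2 [Is [BE szi]]]] : exists B1 B2 Is, B = B1 ++ Is :: B2 /\ size B1 = i.
  exists (take i B), (drop i.+1 B), (nth [::] B i); split; last by rewrite size_take lt_i.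
  by rewrite -drop_nth // cat_take_drop.
have nthE : nth [::] B i = Is by rewrite BE nth_cat szi ltnn subnn.
have t1 : take i B = B1 by rewrite BE -szi take_size_cat.
have t2 : drop i.+1 B = B2 by rewrite BE -cat_rcons drop_size_cat // size_rcons szi.
have setE Js : set_nth [::] B i Js = B1 ++ Js :: B2.
  by rewrite set_nthE lt_i t1 t2.
rewrite nthE; case: Is BE nthE t2 => [|I Is] BE nthE t2; first by rewrite big_nil.
apply: eq_big_seq => x xI; rewrite setE.
set J := rot (index x I) I.
have JI : J =i I by move=> y; rewrite mem_rot.
have IB : I \in flatten B by apply/flattenP; exists (I :: Is); rewrite ?BE ?mem_cat ?mem_head ?orbT.
have JE : J = x :: behead J by rewrite /J rot_index.
have pJ : perm_eq (J ++ letters (B1 ++ Is :: B2)) (letters B).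
  by rewrite BE perm_sym (permPl (letters_pop _ _ _ _)) perm_cat2r perm_sym perm_rot.
transitivity (\sum_(b <- permutations (letters B) | prefix J b) g b).
  rewrite big_mkcond [RHS]big_mkcond; apply: eq_big_seq => b; rewrite mem_permutations => pb.
  case: b pb => [|y b] pb; first by have := perm_size pb; rewrite szB /=; lia.
  have -> : (head 0%N (y :: b) == x) = (y == x) by [].
  have [yx|yx] := eqVneq y x; last by rewrite JE prefix_cons eq_sym (negPf yx).
  case: ifP => // npre; rewrite /g; case: ifP => // _.
  by rewrite yx in pb npre *; rewrite (start_rot ok wfB IB xI pb m0 ms0 szB) npre.
rewrite -[LHS]big_filter (perm_big _ (perm_prefix_permutations uB pJ)) big_map.
by apply: eq_bigr => b _; rewrite /g BE tops_ok_pop // -BE.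
Qed.

Lemma nth_split (T : Type) (x0 : T) s i y : (i < size s)%N -> nth x0 s i = y ->
  exists s1 s2, [/\ s = s1 ++ y :: s2, size s1 = i & forall y', set_nth x0 s i y' = s1 ++ y' :: s2].
Proof.
move=> lt_i <-; exists (take i s), (drop i.+1 s); split.
- by rewrite -drop_nth // cat_take_drop.
- by rewrite size_take lt_i.
- by move=> y'; rewrite set_nthE lt_i.
Qed.

(** Translates the condition at a bottom switch into one on block indices: [r] decreases on passing
    to an earlier block or to the rest of the same block, and increases towards later blocks. *)
Lemma wf_ltr B1 (K : seq nat) Is B2 x i (L : seq nat) Ls y :
  let B := B1 ++ Is :: B2 in
  wf_ivals (B1 ++ (K :: Is) :: B2) -> x \in K -> (i < size B)%N -> nth [::] B i = L :: Ls ->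
  y \in L -> (r y < r x)%N = (i < (size B1).+1)%N.
Proof.
move=> B [uB nB rB]; rewrite pairwise_cat pairwise_cons allrel_consr.
move=> /and3P[/andP[h1 _] _ /andP[h2 _]] xK lt_i nthB yL.
have yLs : y \in flatten (L :: Ls) by rewrite /= mem_cat yL.
have xKs : x \in flatten (K :: Is) by rewrite /= mem_cat xK.
rewrite ltnS; case: (ltngtP i (size B1)) => hi.
- have LB : L :: Ls \in B1 by rewrite -nthB nth_cat hi mem_nth.
  by have /allrelP := allP h1 _ LB; apply.
- have LB : L :: Ls \in B2.
    have hi' : (i < size B1)%N = false by lia.
    move: lt_i nthB; rewrite /B nth_cat hi' size_cat.
    have [k ->] : exists k, i = (size B1 + k.+1)%N by exists (i - size B1).-1; lia.
    rewrite addKn ltn_add2l => lt_k <-; exact: mem_nth.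
  by have /allrelP/(_ _ _ xKs yLs) := allP h2 _ LB; lia.
move: nthB; rewrite /B nth_cat hi ltnn subnn /= => IsE.
have KB : K :: Is \in B1 ++ (K :: Is) :: B2 by rewrite mem_cat mem_head orbT.
have := allP rB _ KB; rewrite pairwise_cons IsE => /andP[/= /andP[/allrelP h _] _].
exact: h.
Qed.

(** The induction keeps [ok] dependent on the block index alone, through [ptr]; [wf_ltr]
    reestablishes this after each switch. *)
Lemma Zst_Zn N B m ms ok ptr : wf_ivals B -> (0 < m)%N -> all (fun i => (0 < i)%N) ms ->
  size (letters B) = (m + sumn ms)%N -> (size (letters B) <= N)%N -> (ptr <= size B)%N ->
  (forall i K Is x, (i < size B)%N -> nth [::] B i = K :: Is -> x \in K -> ok x = (i < ptr)%N) ->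
  Zst B m ms ok = Zn N (map (map size) B) m ms ptr.
Proof.
elim: N B m ms ok ptr => [|N IHN] B m ms ok ptr wfB m0 ms0 szB leN le_ptr okE; first lia.
rewrite Zst_split // [Zn _ _ _ _ _]/= (big_ord_widen (size B) (fun i =>
  if nth [::] (map (map size) B) i is k :: c then
         if (k <= m)%N then
           k%:R * (if m == k then
                     if ms is m' :: ms' then Zn N (set_nth [::] (map (map size) B) i c) m' ms' (size (map (map size) B)) else 1
                   else z * Zn N (set_nth [::] (map (map size) B) i c) (m - k)%N ms i.+1)
         else 0
       else 0) le_ptr) [RHS]big_mkcond.
apply: eq_bigr => i _; move: (nat_of_ord i) (ltn_ord i) => {}i lt_i.
rewrite (nth_map [::]) //; case nthE: (nth [::] B i) => [|K Is]; first by rewrite if_same.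
have [B1 [B2 [BE szi setE]]] := nth_split lt_i nthE.
have mset : set_nth [::] (map (map size) B) i (map size Is) = map (map size) (B1 ++ Is :: B2).
  by rewrite -setE !set_nthE size_map lt_i map_cat map_cons map_take map_drop.
rewrite setE map_cons; cbv iota; rewrite mset size_map.
have wfB' : wf_ivals (B1 ++ Is :: B2) by move: wfB; rewrite BE; exact: wf_pop.
have [uB nB _ _] := wfB.
have KB : K \in flatten B by apply/flattenP; exists (K :: Is); rewrite ?BE ?mem_cat ?mem_head ?orbT.
have K0 := wf_nonempty wfB KB; have szK : (0 < size K)%N by case: (K) K0.
have szB' : (size K + size (letters (B1 ++ Is :: B2)) = m + sumn ms)%N.
  by rewrite -szB BE (perm_size (letters_pop _ _ _ _)) size_cat.
have szBB : size (B1 ++ Is :: B2) = size B by rewrite BE !size_cat.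
set V := (if (i < ptr)%N then _ else _).
(* The contribution is the same for all starting letters [x] of [K], which produces the factor
   [size K]. *)
transitivity (\sum_(x <- K) if (size K <= m)%N && (i < ptr)%N then
    (if m == size K then
       if ms is m' :: ms' then Zn N (map (map size) (B1 ++ Is :: B2)) m' ms' (size B) else 1
     else z * Zn N (map (map size) (B1 ++ Is :: B2)) (m - size K)%N ms i.+1) else 0); last first.
  rewrite big_const_seq count_predT iter_addr_0 /V.
  by case: (i < ptr)%N; case: (size K <= m)%N; rewrite /= ?mul0rn // mulr_natl.
apply: eq_big_seq => x xK; set J := rot (index x K) K.
have JE : J = x :: behead J by rewrite /J rot_index.
have szJ : size J = size K by rewrite size_rot.
transitivity (\sum_(b <- permutations (letters (B1 ++ Is :: B2)))
   if tops_ok b (B1 ++ Is :: B2) then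
     if (size K <= m)%N && (i < ptr)%N then
       if m == size K then next_start ms b
       else z * start (fun y => r y < r x)%N (m - size K)%N ms b
     else 0
   else 0).
  apply: eq_big_seq => b; rewrite mem_permutations => pb; case: ifP => // _.
  have pJ : perm_eq (J ++ b) (letters B).
    rewrite BE perm_sym (permPl (letters_pop _ _ _ _)) perm_sym.
    by rewrite (perm_trans (_ : perm_eq _ (K ++ b))) ?perm_cat2l // perm_cat2r perm_rot.
  have pre : prefix J (J ++ b) by apply: prefix_prefix.
  have dr : drop (size K) (J ++ b) = b by rewrite -szJ drop_size_cat.
  move: pJ pre dr; rewrite {1 3 4 5}JE cat_cons => pJ pre dr.
  rewrite (start_rot ok wfB KB xK pJ m0 ms0 szB) dr -/J pre /= (okE _ _ _ _ lt_i nthE xK).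
  by case: (_ <= _)%N; case: (i < ptr)%N.
case: (leqP (size K) m) => le_K /=; last by rewrite big1 // => b _; rewrite if_same.
case: (i < ptr)%N; last by rewrite big1 // => b _; rewrite if_same.
have [mK|mK] := eqVneq m (size K).
  (* If no bottom block follows, all letters have been used and the empty word is the only one
     left. *)
  case: ms ms0 szB szB' {V} => [|m' ms] ms0 szB szB'.
    have l0 : letters (B1 ++ Is :: B2) = [::].
      by apply/size0nil; move: szB' => /=; lia.
    have tops : tops_ok [::] (B1 ++ Is :: B2).
      apply/allP => -[|L Ls] // LB.
      have LB' : L \in flatten (B1 ++ Is :: B2) by apply/flattenP; exists (L :: Ls); rewrite ?mem_head.
      have : head 0%N L \in letters (B1 ++ Is :: B2).
        by apply/flattenP; exists L => //; exact/head_mem/(wf_nonempty wfB').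
      by rewrite l0.
    by rewrite l0 /= big_seq1 tops.
  have /andP[m'0 ms0'] := ms0.
  rewrite -/(Zst (B1 ++ Is :: B2) m' ms predT).
  have sz' : size (letters (B1 ++ Is :: B2)) = (m' + sumn ms)%N by move: szB' => /=; lia.
  apply: (IHN _ _ _ _ _ wfB' m'0 ms0' sz'); [lia | by rewrite szBB |].
  by move=> j L Ls y lt_j _ _; rewrite -szBB lt_j.
transitivity (z * Zst (B1 ++ Is :: B2) (m - size K) ms (fun y => r y < r x)%N).
  rewrite mulr_sumr; apply: eq_bigr => b _; case: ifP => _ //; by rewrite mulr0.
have sz' : size (letters (B1 ++ Is :: B2)) = (m - size K + sumn ms)%N by lia.
have m'0 : (0 < m - size K)%N by lia.
congr (_ * _); apply: (IHN _ _ _ _ _ wfB' m'0 ms0 sz'); [lia | by rewrite szBB |].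
move=> j L Ls y lt_j nthj yL; rewrite -szi.
by apply: (wf_ltr _ xK lt_j nthj yL); rewrite -BE.
Qed.

End Removal.

(** * From rulings to the removal recursion *)

Lemma fpath_map (T : eqType) (f : T -> T) x p : map f (belast x p) = p -> fpath f x p.
Proof. by elim: p x => //= y p IHp x [-> /IHp ->]; rewrite eqxx. Qed.

Lemma fcycle_rot1 (T : eqType) (f : T -> T) s : map f s = rot 1 s -> fcycle f s.
Proof.
by case: s => //= x s; rewrite rot1_cons => e; apply: fpath_map; rewrite belast_rcons.
Qed.

Lemma pairwise_flatten (T : Type) (rho : rel T) (ss : seq (seq T)) : pairwise rho (flatten ss) ->
  all (pairwise rho) ss /\ pairwise (fun s s' => allrel rho s s') ss.
Proof.
elim: ss => //= s ss IHs; rewrite pairwise_cat => /and3P[h -> /IHs[-> ->]]; split=> //.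
rewrite andbT; elim: ss h {IHs} => //= s' ss IHs; rewrite allrel_catr => /andP[-> h].
exact: IHs.
Qed.

Lemma pairwise_index_flatten (T : eqType) (ss : seq (seq T)) (p : seq T) : uniq (p ++ flatten ss) ->
  pairwise (fun s s' => allrel (fun x y => index x (p ++ flatten ss) < index y (p ++ flatten ss))%N s s') ss.
Proof.
elim: ss p => //= s ss IHs p; rewrite catA => u; rewrite IHs // andbT.
apply/allP => s' s'ss; apply/allrelP => x y xs ys.
have yss : y \in flatten ss by apply/flattenP; exists s'.
have yps : y \notin p ++ s.
  move: u; rewrite cat_uniq => /and3P[_ /hasPn h _]; exact: h.
rewrite !(index_cat _ (p ++ s)) (negPf yps) mem_cat xs orbT.
by apply: leq_trans (leq_addr _ _); rewrite index_mem mem_cat xs orbT.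
Qed.

Lemma pairwise_rev (T : Type) (rho : rel T) s :
  pairwise rho (rev s) = pairwise (fun x y => rho y x) s.
Proof. by elim: s => //= x s IHs; rewrite rev_cons pairwise_rcons all_rev IHs. Qed.

Lemma mem_compss a C : (C \in compss a) = all2 (fun c m => c \in comps m) C a.
Proof.
elim: a C => [|m a IHa] [|c C] //=; first by apply/allpairsP => -[[? ?] []].
apply/allpairsP/andP => [[[c' C'] /= [h1 h2 [-> ->]]]|[h1 h2]].
  by rewrite -IHa.
by exists (c, C); split; rewrite // IHa.
Qed.

Lemma ivalsK C segs : all2 (fun c seg => sumn c == size seg) C segs ->
  map flatten (ivals C segs) = segs /\ map shape (ivals C segs) = C.
Proof.
elim: C segs => [|c C IHC] [|s segs] //= /andP[/eqP e /IHC [h1 h2]].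
rewrite /ivals /= -/(ivals C segs) h1 h2 reshapeKr ?reshapeKl ?e //.
Qed.

Section RulingSum.
Variables (R : comUnitRingType) (z : R).

Section Intervals.
Variables (la : seq nat) (C : seq (seq nat)).
Let n := sumn la.
Hypotheses (C_la : C \in compss la).
Let segs := reshape la (iota 0 n).
Let Iv := ivals C segs.
Let t' := flatten (map (rot 1) (flatten Iv)).

Lemma segs_shape : map size segs = la.
Proof. by apply: reshapeKl; rewrite size_iota. Qed.

Lemma flatten_segs : flatten segs = iota 0 n.
Proof. by apply: reshapeKr; rewrite size_iota. Qed.

Lemma Iv_facts : map flatten Iv = segs /\ map shape Iv = C.
Proof.
apply: ivalsK; move: C_la; rewrite mem_compss -segs_shape.
elim: (C) (segs) => [|c C' IHC] [|s ss] //= /andP[+ /IHC ->].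
by rewrite mem_comps andbT => /andP[].
Qed.

Lemma flatten_Iv : flatten (flatten Iv) = iota 0 n.
Proof.
have [h _] := Iv_facts; rewrite -flatten_segs -h.
by elim: (Iv) => //= Is B IHB; rewrite flatten_cat IHB.
Qed.

Lemma Iv_nonempty (I : seq nat) : I \in flatten Iv -> I != [::].
Proof.
have [_ shE] := Iv_facts.
move/flattenP => [Is IsIv IIs]; have : shape Is \in C by rewrite -shE map_f.
move=> shC; have : all (fun c => all (fun i => (0 < i)%N) c) C.
  move: C_la; rewrite mem_compss; elim: (C) (la) => [|c C' IHC] [|m a] //= /andP[+ /IHC ->].
  by rewrite mem_comps => /andP[->].
move=> /allP/(_ _ shC)/allP/(_ (size I)); rewrite map_f // => /(_ isT).
by case: (I).
Qed.

Lemma t'_perm : perm_eq t' (iota 0 n).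
Proof.
rewrite -flatten_Iv /t'; elim: (flatten Iv) => //= I ss IHs.
by apply: perm_cat => //; rewrite perm_rot.
Qed.

(** As a list of values, [t'] is the image of 0, ..., n-1 under [nth 0 t']; as a word, it is the
    concatenation of the rotated intervals. Cutting both at the same places gives the claim. *)
Lemma map_nxt_Iv : map (map (nth 0%N t')) (flatten Iv) = map (rot 1) (flatten Iv).
Proof.
apply: eq_from_flatten_shape.
  rewrite -map_flatten flatten_Iv -/t'; have := perm_size t'_perm; rewrite size_iota => <-.
  exact: mkseq_nth.
by rewrite /shape -!map_comp; apply: eq_map => I /=; rewrite size_map size_rot.
Qed.

(** Positions in [t'] increase along the concatenated intervals; reversing each block gives the
    order demanded by [wf_ivals]. *)
Lemma wf_Iv : wf_ivals (index^~ t') (nth 0%N t') (map rev Iv).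
Proof.
have pB : perm_eq (flatten (flatten (map rev Iv))) (iota 0 n).
  rewrite -flatten_Iv; elim: (Iv) => //= Is B IHB; rewrite !flatten_cat.
  by apply: perm_cat => //; apply: perm_flatten; rewrite perm_rev.
have memB (I : seq nat) : I \in flatten (map rev Iv) -> I \in flatten Iv.
  move=> /flattenP[Js /mapP[Is IsB ->]]; rewrite mem_rev => h.
  by apply/flattenP; exists Is.
have pw : pairwise (fun s s' => allrel (fun x y => index x t' < index y t')%N s s') (flatten Iv).
  have /(@pairwise_index_flatten _ _ [::]) : uniq ([::] ++ t') by rewrite /= (perm_uniq t'_perm) iota_uniq.
  rewrite pairwise_map /= -/t'; apply: sub_pairwise => I J /allrelP h.
  by apply/allrelP => x y xI yJ; apply: h; rewrite mem_rot.
have [pw1 pw2] := pairwise_flatten pw.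
split.
- by rewrite (perm_uniq pB) iota_uniq.
- apply/allP => I /memB IIv; rewrite Iv_nonempty //=; apply: fcycle_rot1.
  have := map_nxt_Iv; move: IIv; elim: (flatten Iv) => //= J ss IHs.
  by rewrite inE => /predU1P[->|/IHs h] [].
- rewrite all_map; apply: sub_all pw1 => Is /= h.
  rewrite pairwise_rev; apply: sub_pairwise h => I J.
  by rewrite allrelC.
rewrite pairwise_map; apply: sub_pairwise pw2 => Is Js /= /allrelP h.
apply/allrelP => x y /flattenP[I]; rewrite mem_rev => IIs xI /flattenP[J]; rewrite mem_rev => JJs yJ.
by have /allrelP := h I J IIs JJs; apply.
Qed.

Lemma tops_ok_Iv b : all (heads_desc (index^~ b)) Iv = tops_ok b (map rev Iv).
Proof. by rewrite /tops_ok all_map; apply: eq_all => Is; rewrite /= rev_sorted. Qed.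

Lemma sizes_Iv : map (map size) (map rev Iv) = map rev C.
Proof.
have [_ <-] := Iv_facts; rewrite -!map_comp; apply: eq_map => Is /=.
by rewrite map_rev.
Qed.

Lemma size_Iv : size Iv = size la.
Proof.
have [h _] := Iv_facts; have := congr1 size h.
by rewrite size_map => ->; rewrite -(size_map size segs) segs_shape.
Qed.

Lemma reading_sum m ms : (0 < m)%N -> all (fun i => (0 < i)%N) ms -> (m + sumn ms)%N = n ->
  \sum_(b <- permutations (iota 0 n))
    (if all (heads_desc (index^~ b)) Iv then
       \prod_(seg <- reshape (m :: ms) b) rds z (index^~ t') (nth 0%N t') seg
     else 0) =
  Zn z n (map rev C) m ms (size la).
Proof.
move=> m0 ms0 mE.
have pB : perm_eq (flatten (flatten (map rev Iv))) (iota 0 n).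
  rewrite -flatten_Iv; elim: (Iv) => //= Is B IHB; rewrite !flatten_cat.
  by apply: perm_cat => //; apply: perm_flatten; rewrite perm_rev.
have szB : size (flatten (flatten (map rev Iv))) = n by rewrite (perm_size pB) size_iota.
rewrite -sizes_Iv -size_Iv -(size_map rev Iv).
have szE : size (flatten (flatten (map rev Iv))) = (m + sumn ms)%N by rewrite szB mE.
have leN : (size (flatten (flatten (map rev Iv))) <= n)%N by rewrite szB.
rewrite -(@Zst_Zn R z (index^~ t') (nth 0%N t') n _ m ms predT _ wf_Iv m0 ms0 szE leN (leqnn _)); last first.
  by move=> i K Is x -> _ _.
rewrite /Zst; have pp : perm_eq (permutations (iota 0 n)) (permutations (flatten (flatten (map rev Iv)))).
  apply: uniq_perm; rewrite ?permutations_uniq // => b; rewrite !mem_permutations.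
  by rewrite perm_sym -(permPl pB) perm_sym || (apply/idP/idP => h; apply: (perm_trans h); rewrite // perm_sym).
rewrite -(perm_big _ pp); apply: eq_big_seq => b; rewrite mem_permutations => pb.
rewrite tops_ok_Iv; case: ifP => // _.
case: b pb => [|x b] pb; first by have := perm_size pb; rewrite size_iota /=; lia.
have [m' ->] : exists m', m = m'.+1 by exists m.-1; lia.
by rewrite /= big_cons.
Qed.

End Intervals.
(** The trace runs over the matchings of the identity word with [b]. Once the cuts [C] are chosen,
    the top sweep gives a word t' independent of [b], which enters only through normality. By
    [matching_closed] the bottom sweep must then turn [b] into its image under [nth 0 t'], and
    [reading_sum] adds up over [b]. *)
Lemma ruling_sum (L : front) la m ms : all (fun i => (0 < i)%N) la -> (0 < m)%N ->
  all (fun i => (0 < i)%N) ms -> (m + sumn ms)%N = sumn la ->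
  events L = [seq Crossing i | i <- blocks 0 la ++ blocks (sumn la) (m :: ms)] ->
  (forall k, gap L k = nseq (sumn la) true ++ nseq (sumn la) false) ->
  ruling_poly2 z L = \sum_(C <- compss la)
    z ^+ sumn [seq (size c).-1 | c <- C] * Zn z (sumn la) (map rev C) m ms (size la).
Proof.
move=> la0 m0 ms0 mE evE gapE; set n := sumn la in mE evE gapE *.
have hi : wordb n (iota 0 n) by exact: perm_refl.
pose segs := reshape la (iota 0 n).
have segE : map size segs = la by exact: segs_shape.
have fsegE : flatten segs = iota 0 n by exact: flatten_segs.
have seg0 : all (fun s => s != [::]) segs.
  move: la0; rewrite -segE all_map; apply: sub_all => s /=.
  by case: s.
rewrite (ruling_poly2_amp z evE gapE) sum_valid.
transitivity (\sum_(b <- permutations (iota 0 n)) \sum_(C <- compss la)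
   z ^+ sumn [seq (size c).-1 | c <- C] *
   (if all (heads_desc (index^~ b)) (ivals C segs) then
      \prod_(seg <- reshape (m :: ms) b) rds z
         (index^~ (flatten (map (rot 1) (flatten (ivals C segs)))))
         (nth 0%N (flatten (map (rot 1) (flatten (ivals C segs))))) seg else 0)).
  apply: eq_big_seq => b; rewrite mem_permutations => hb.
  have szb : size b = n by rewrite (wordb_size hb).
  have shb : map size (reshape (m :: ms) b) = m :: ms by rewrite -[LHS]/(shape _) reshapeKl // szb /= mE.
  have flb : flatten (reshape (m :: ms) b) = b by rewrite reshapeKr // szb /= mE.
  rewrite -[in blocks 0 _]segE -[in matching n (iota 0 n) b]fsegE.
  rewrite -[0%N]/(size (Nil nat)) -[flatten segs]/([::] ++ flatten segs).
  rewrite amp_blocks_top ?fsegE // blsum_comps // segE.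
  apply: eq_big_seq => C C_la; case: ifP => _; last by rewrite mulr0.
  congr (_ * _); rewrite cat0s.
  set t' := flatten _.
  have ht' : wordb n t' by exact: t'_perm.
  have := @amp_blocks_bot R z n [::] (reshape (m :: ms) b) t' [::] (matching n (iota 0 n) b).
  rewrite [size [::]]/= addn0 shb cats0 !cat0s flb => -> //.
  have := @blsum_rd R z (index^~ t') (nth 0%N t') [::] [::] (reshape (m :: ms) b).
  rewrite eqxx mul1r flb cat0s => <-; apply: blsum_eq => out; rewrite cat0s flb => hout.
  have ho : wordb n out by exact: perm_trans hout hb.
  by rewrite -(matching_closed ht' hb ho).
rewrite exchange_big; apply: eq_big_seq => C C_la.
rewrite -mulr_sumr; congr (_ * _).
by rewrite -(reading_sum C_la m0 ms0 mE).
Qed.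

End RulingSum.

(** * Comparison with the kernel series *)

Section CompositionSums.
Variable R : comNzRingType.

Lemma big_compss_cat a1 x a2 (F : seq (seq nat) -> R) :
  \sum_(C <- compss (a1 ++ x :: a2)) F C =
  \sum_(C1 <- compss a1) \sum_(c <- comps x) \sum_(C2 <- compss a2) F (C1 ++ c :: C2).
Proof.
elim: a1 F => [|m a1 IHa] F /=; first by rewrite big_allpairs_dep big_seq1.
rewrite !big_allpairs_dep; apply: eq_bigr => c _.
by rewrite IHa.
Qed.

Lemma size_compss a C : C \in compss a -> size C = size a.
Proof.
rewrite mem_compss; elim: a C => [|m a IHa] [|c C] //= /andP[_ /IHa ->] //.
Qed.

Lemma big_comps_head x (H : nat -> seq nat -> R) :
  \sum_(c <- comps x) (if c is k :: c' then H k c' else 0) =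
  \sum_(k < x) \sum_(c <- comps (x - k.+1)%N) H k.+1 c.
Proof.
case: x => [|x]; first by rewrite big_seq1 big_ord0.
transitivity (\sum_(c <- [seq k :: c | k <- iota 1 x.+1, c <- comps (x.+1 - k)])
   (if c is k :: c' then H k c' else 0)).
  apply: perm_big; apply: uniq_perm; first exact: comps_uniq.
    apply: allpairs_uniq_dep => [|k _|]; [exact: iota_uniq | exact: comps_uniq |].
    by move=> [k c] [k' c'] _ _ /= [-> ->].
  move=> c; rewrite mem_comps; apply/idP/allpairsPdep => [|[k [c' [+ + ->]]]].
    case: c => [|k c] //= /andP[/andP[k0 c0] /eqP e]; exists k, c; split=> //.
      by rewrite (mem_iota 1 x.+1); lia.
    by rewrite mem_comps c0 /=; apply/eqP; lia.
  rewrite (mem_iota 1 x.+1) mem_comps => /andP[k0 lt] /andP[c0 /eqP e] /=.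
  by rewrite k0 c0 e /=; apply/eqP; lia.
rewrite big_allpairs_dep (iotaDl 1 0) big_map -[X in iota 0 X]subn0 -/(index_iota 0 x.+1) big_mkord.
by apply: eq_bigr => k _; rewrite add1n.
Qed.

(** Splits off the first part of the i-th composition, as one step of [Zn] does. *)
Lemma big_compss_nth i a (G : nat -> seq (seq nat) -> R) : (i < size a)%N ->
  \sum_(C <- compss a) (if nth [::] C i is k :: c then G k (set_nth [::] C i c) else 0) =
  \sum_(k < nth 0%N a i) \sum_(C <- compss (set_nth 0%N a i (nth 0 a i - k.+1)%N)) G k.+1 C.
Proof.
move=> lt_i; have [a1 [a2 [aE sza1 setE]]] := nth_split lt_i (erefl (nth 0%N a i)).
under [RHS]eq_bigr do rewrite setE big_compss_cat.
rewrite {1}aE big_compss_cat [RHS]exchange_big /=; apply: eq_big_seq => C1 /size_compss sz1.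
rewrite sza1 in sz1.
have E c C2 : (if nth [::] (C1 ++ c :: C2) i is k :: c0 then
     G k (set_nth [::] (C1 ++ c :: C2) i c0) else 0) =
   if c is k :: c' then G k (C1 ++ c' :: C2) else 0.
  rewrite nth_cat -sz1 ltnn subnn /=; case: c => // k c.
  rewrite set_nthE size_cat /= ifT; last lia.
  rewrite take_size_cat // -(cat_rcons (k :: c)) drop_size_cat ?size_rcons //.
under eq_bigr do under eq_bigr do rewrite E.
rewrite -(big_comps_head _ (fun k c => \sum_(C2 <- compss a2) G k (C1 ++ c :: C2))).
by apply: eq_bigr => -[|k c] _ //; rewrite big1.
Qed.

Lemma compss_uniq a : uniq (compss a).
Proof.
elim: a => //= m a IHa; apply: allpairs_uniq; rewrite ?comps_uniq //.
by move=> [c C] [c' C'] _ _ /= [-> ->].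
Qed.

Lemma big_compss_rev a (F : seq (seq nat) -> R) :
  \sum_(C <- compss a) F (map rev C) = \sum_(C <- compss a) F C.
Proof.
rewrite -(big_map (map rev) predT F); apply: perm_big; apply: uniq_perm.
- rewrite map_inj_uniq ?compss_uniq //; exact/inj_map/(can_inj revK).
- exact: compss_uniq.
have revC C : (map rev C \in compss a) = (C \in compss a).
  rewrite !mem_compss; elim: C a => [|c C IHC] [|m a] //=; rewrite IHC.
  by rewrite !mem_comps all_rev sumn_rev.
move=> C; apply/mapP/idP => [[C' h ->]|h]; first by rewrite revC.
exists (map rev C); first by rewrite revC.
by rewrite mapK //; exact: revK.
Qed.

Lemma big_ord_ltn_swap n m (V : nat -> R) :
  \sum_(k < n) (if (k < m)%N then V k else 0) = \sum_(k < m) (if (k < n)%N then V k else 0).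
Proof.
wlog le : n m / (n <= m)%N.
  by move=> W; case: (leqP n m) => [/W //|/ltnW /W ->].
rewrite -[RHS]big_mkcond -(big_ord_widen _ V le); apply: eq_bigr => k _.
by rewrite (leq_trans (ltn_ord k)).
Qed.

End CompositionSums.

Section RulingCoefficient.
Variables (R : idomainType) (s : R) (p : nat).
Local Notation z := (s - s^-1).

Definition mvar (i : nat) : {mpoly R[p]} := if insub i is Some j then 'X_j else 0.
Local Notation kerp := (kerP s mvar).

Lemma mvar_coef i k a (f : {mpoly R[p]}) : (i < p)%N -> size a = p ->
  (mvar i ^+ k * f)@_(seq_mon p a) =
  if (k <= nth 0 a i)%N then f@_(seq_mon p (set_nth 0%N a i (nth 0 a i - k)%N)) else 0.
Proof.
move=> lt_i sza; rewrite /mvar insubT mpolyXn mcoeffXM.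
have -> : (U_(Sub i lt_i) *+ k <= seq_mon p a)%MM = (k <= nth 0 a i)%N.
  apply/mnm_lepP/idP => [/(_ (Sub i lt_i))|le j].
    by rewrite mulmnE mnm1E eqxx mul1n mnmE.
  rewrite mulmnE mnm1E mnmE -val_eqE /=; case: eqP => [<-|_]; last by rewrite mul0n.
  by rewrite mul1n.
case: ifP => // le; congr (f@_ _); apply/mnmP => j.
rewrite mnmBE mulmnE mnm1E !mnmE -val_eqE /= nth_set_nth /= [val j == i]eq_sym.
by case: eqP => [<-|_]; rewrite ?mul1n ?mul0n ?subn0.
Qed.

Lemma sum_compss0 (a : seq nat) : sumn a = 0%N -> \sum_(C <- compss a) z ^+ sumn (map size C) = 1.
Proof.
move=> a0; have -> : compss a = [:: nseq (size a) [::]].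
  by elim: a a0 => //= -[|x] // a IHa /IHa ->.
rewrite big_seq1; have -> : sumn (map size (nseq (size a) (Nil nat))) = 0%N.
  by elim: (size a).
by [].
Qed.

Hypothesis s_unit : s \is a GRing.unit.

(** [Zn] satisfies by definition the recursion [kerP_rec] of the kernel. Of the weight z^2 k of an
    interval, one z comes from the power counting all parts of [C]; the other comes from the bottom
    switch that follows it or, at the end of a bottom block, from the prefactor. *)
Lemma Zn_sum N a m ms ptr : size a = p -> (0 < m)%N -> all (fun i => (0 < i)%N) ms ->
  sumn a = (m + sumn ms)%N -> (sumn a <= N)%N -> (ptr <= p)%N ->
  z ^+ (size ms).+1 * \sum_(C <- compss a) (z ^+ sumn (map size C) * Zn z N C m ms ptr) =
  (kerp ptr m * \prod_(m' <- ms) kerp p m')@_(seq_mon p a).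
Proof.
elim: N a m ms ptr => [|N IHN] a m ms ptr sza m0 ms0 saE leN le_ptr; first lia.
case: m m0 saE => // m _ saE.
rewrite kerP_rec // mulr_suml raddf_sum /=.
(* The term in which a first part [k] is removed from the i-th composition; its leading z accounts
   for this part, absent from [C]. *)
pose G i k C := z * z ^+ sumn (map size C) * (if (k <= m.+1)%N then
  k%:R * (if m.+1 == k then if ms is m' :: ms' then Zn z N C m' ms' p else 1
          else z * Zn z N C (m.+1 - k)%N ms i.+1) else 0).
transitivity (z ^+ (size ms).+1 * \sum_(i < ptr) \sum_(C <- compss a)
   (if nth [::] C i is k :: c then G i k (set_nth [::] C i c) else 0)).
  congr (_ * _); rewrite exchange_big /=; apply: eq_big_seq => C hC.
  rewrite mulr_sumr; apply: eq_bigr => i _.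
  have szC := size_compss hC; have lt_i : (i < size C)%N by rewrite szC sza (leq_trans (ltn_ord i)).
  case nthE: (nth [::] C i) => [|k c]; first by rewrite mulr0.
  rewrite /G szC sza; congr (_ * _).
  have [C1 [C2 [CE _ ->]]] := nth_split lt_i nthE.
  by rewrite CE !map_cat !sumn_cat /= -exprS; congr (_ ^+ _); lia.
rewrite mulr_sumr; apply: eq_bigr => i _; rewrite big_compss_nth; last first.
  by rewrite sza (leq_trans (ltn_ord i)).
have lt_i : (i < p)%N by rewrite (leq_trans (ltn_ord i)).
move: (nat_of_ord i) lt_i => {}i lt_i; set n := nth 0%N a i.
have lt_i' : (i < size a)%N by rewrite sza.
pose a' k := set_nth 0%N a i (n - k.+1)%N.
pose V k := z ^+ 2 * k.+1%:R * (kerp i.+1 (m - k)%N * \prod_(m' <- ms) kerp p m')@_(seq_mon p (a' k)).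
rewrite mulr_suml raddf_sum /=.
transitivity (\sum_(k < m.+1) (if (k < n)%N then V k else 0)); last first.
  apply: eq_bigr => k _; rewrite -scalerAl mcoeffZ -[_ * _ * \prod_(_ <- _) _]mulrA mvar_coef // -/n.
  by case: ifP => _; rewrite ?mulr0.
(* The removed length is bounded both by the i-th entry of [a] and by the room left in the bottom
   block; the two sums use these bounds in opposite roles. *)
rewrite -big_ord_ltn_swap mulr_sumr; apply: eq_bigr => k _.
have lt_k := ltn_ord k; move: (nat_of_ord k) lt_k => {}k lt_k.
rewrite /G ltnS; case: leqP => [le_k|_]; last first.
  by rewrite big1 ?mulr0 // => C _; rewrite mulr0.
have [a1 [a2 [aE _ setE]]] := nth_split lt_i' (erefl n).
have sza' : size (a' k) = p by rewrite /a' setE -sza aE !size_cat.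
have sa' : sumn (a' k) = (m - k + sumn ms)%N.
  by rewrite /a' setE; move: saE; rewrite aE !sumn_cat /=; lia.
rewrite /V eqSS; have [ek|ne] := eqVneq m k.
  rewrite -ek subnn kerP0 // mul1r ek in sa' *.
  case: (ms) ms0 sa' saE => [|m' ms'] ms0 sa' saE.
    have a0 : sumn (a' k) = 0%N by [].
    rewrite big_nil mcoeff1; have -> : (seq_mon p (a' k) == 0%MM) = true.
      by rewrite -mdeg_eq0 mdeg_seq_mon ?sza' ?leqnn // a0.
    rewrite -[RHS]mulr1 -[X in _ = _ * X](sum_compss0 a0) !mulr_sumr.
    by apply: eq_bigr => C _; rewrite [size _]/= expr1 [nat_of_bool _]/= mulr1n; ring.
  have /andP[m'0 ms'0] := ms0.
  rewrite big_cons -IHN //; try lia.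
    rewrite !mulr_sumr; apply: eq_bigr => C _; rewrite [size _]/= !exprS; ring.
rewrite -IHN //; try lia.
rewrite !mulr_sumr; apply: eq_bigr => C _; rewrite subSS !exprS; ring.
Qed.

End RulingCoefficient.

(** * The fronts of the theorem *)

(** A top block cut into q intervals has q - 1 switches, so the factor z ^+ size a raises the count
    from switches to intervals. *)
Lemma sumn_size_pred (a : seq nat) (C : seq (seq nat)) : all (fun i => (0 < i)%N) a -> C \in compss a ->
  sumn (map size C) = (size a + sumn [seq (size c).-1 | c <- C])%N.
Proof.
rewrite mem_compss; elim: a C => [|m a IHa] [|c C] //= /andP[m0 a0] /andP[+ /(IHa _ a0) ->].
move: (c : seq nat) => {}c; rewrite mem_comps => /andP[_ /eqP cm].
have : (0 < size c)%N by case: c cm m0 => //= <-.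
by lia.
Qed.

Lemma ruling_coef (R : idomainType) (s : R) (L : front) la mu : s \is a GRing.unit ->
  all (fun i => (0 < i)%N) la -> all (fun i => (0 < i)%N) mu -> sumn mu = sumn la ->
  mu != [::] ->
  events L = [seq Crossing i | i <- blocks 0 la ++ blocks (sumn la) mu] ->
  (forall k, gap L k = nseq (sumn la) true ++ nseq (sumn la) false) ->
  (s - s^-1) ^+ (size la + size mu) * ruling_poly2 (s - s^-1) L =
  (\prod_(m <- mu) kerP s (@mvar R (size la)) (size la) m)@_(seq_mon (size la) la).
Proof.
move=> s_unit la0; case: mu => // m ms /= /andP[m0 ms0] mE _ evE gapE.
have e := esym mE.
rewrite big_cons -(Zn_sum s_unit (erefl _) m0 ms0 e (leqnn _) (leqnn _)).
rewrite (ruling_sum _ la0 m0 ms0 mE evE gapE).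
rewrite addnC exprD -mulrA; congr (_ * _).
(* Reversing compositions permutes them and preserves their numbers of parts. *)
rewrite -[in RHS]big_compss_rev mulr_sumr.
apply: eq_big_seq => C hC; rewrite mulrA -exprD -(sumn_size_pred la0) //.
rewrite -map_comp; congr (_ ^+ sumn _ * _).
by apply: eq_map => c; rewrite /= size_rev.
Qed.

Definition preserves (o : seq bool) (es : seq front_event) :=
  all (fun e => event_step o e == o) es.

Lemma preserves_foldl o es k : preserves o es -> foldl event_step o (take k es) = o.
Proof. by elim: es k => [|e es IHes] [|k] //= /andP[/eqP -> /IHes]. Qed.

Definition swaps_equal (o : seq bool) (ws : seq nat) :=
  all (fun i => (i.+1 < size o)%N && (nth true o i == nth true o i.+1)) ws.

(** Crossing two strands of equal orientation leaves the list of orientations unchanged, which makes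
    all gaps equal to the base. *)
Lemma swaps_equal_preserves o ws : swaps_equal o ws -> preserves o (map Crossing ws).
Proof.
rewrite /preserves all_map; apply: sub_all => i /andP[lt /eqP e] /=.
by rewrite -[eqbRHS](cat_take_drop i o) (drop_nth true (ltnW lt)) (drop_nth true lt) e.
Qed.

Lemma swaps_equal_blocks o i la b :
  (forall j, (i <= j < i + sumn la)%N -> (j < size o)%N /\ nth true o j = b) ->
  swaps_equal o (blocks i la).
Proof.
rewrite /swaps_equal; elim: la i => //= m la IHla i h; rewrite all_cat IHla; last by move=> j ?; apply: h; lia.
rewrite andbT; apply/allP => j; rewrite mem_iota => hj.
have [|_ ->] := h j; first lia.
by have [|-> ->] := h j.+1; rewrite ?eqxx //; lia.
Qed.

Lemma events_A (la : seq nat) i :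
  [seq shift_event i e | e <- events (foldr (fun m L => front_mul (frontA m) L) front_empty la)] =
  [seq Crossing j | j <- blocks i la].
Proof.
elim: la i => //= m la IHla i; rewrite !map_cat size_nseq -map_comp; congr (_ ++ _).
  by rewrite -{2}[i]addn0 iotaDl -!map_comp; apply: eq_map => j.
rewrite -[RHS]IHla -map_comp; apply: eq_map => -[j|j b|j] /=; by rewrite addnA.
Qed.

Lemma events_Aneg (mu : seq nat) i :
  [seq shift_event i e |
    e <- events (foldr (fun m L => front_mul (front_rev (frontA m)) L) front_empty mu)] =
  [seq Crossing j | j <- blocks i mu].
Proof.
elim: mu i => //= m mu IHmu i; rewrite !map_cat size_map size_nseq -!map_comp; congr (_ ++ _).
  by rewrite -{2}[i]addn0 iotaDl -!map_comp; apply: eq_map => j.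
rewrite -[RHS]IHmu; apply: eq_map => -[j|j b|j] /=; by rewrite addnA.
Qed.

Lemma shift_event0 es : map (shift_event 0) es = es.
Proof. by rewrite -[RHS]map_id; apply: eq_map => -[]. Qed.

Lemma size_base_A (la : seq nat) :
  base (foldr (fun m L => front_mul (frontA m) L) front_empty la) = nseq (sumn la) true.
Proof. by elim: la => //= m la ->; rewrite nseqD. Qed.

Lemma size_base_Aneg (mu : seq nat) :
  base (foldr (fun m L => front_mul (front_rev (frontA m)) L) front_empty mu) =
  nseq (sumn mu) false.
Proof. by elim: mu => //= m mu ->; rewrite nseqD map_nseq. Qed.

Section Product.
Variables la mu : intpart.
Let L := front_mul (frontA_part la) (frontAneg_part mu).

Lemma events_product : events L = [seq Crossing i | i <- blocks 0 la ++ blocks (sumn la) mu].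
Proof.
rewrite [LHS]/= -[X in X ++ _]shift_event0 events_A size_base_A size_nseq events_Aneg.
by rewrite map_cat.
Qed.

Lemma gap_product k : gap L k = nseq (sumn la) true ++ nseq (sumn mu) false.
Proof.
rewrite /gap events_product [base _]/= size_base_A size_base_Aneg.
apply: preserves_foldl; apply: swaps_equal_preserves; rewrite /swaps_equal all_cat.
apply/andP; split.
  apply: (@swaps_equal_blocks _ _ _ true) => j.
  rewrite size_cat !size_nseq nth_cat size_nseq !nth_nseq; case: (ltnP j (sumn la)) => h; lia.
apply: (@swaps_equal_blocks _ _ _ false) => j.
rewrite size_cat !size_nseq nth_cat size_nseq !nth_nseq => /andP[h1 h2].
by rewrite [(j < sumn la)%N]ltnNge h1 /=; split; [lia | rewrite ifT; lia].
Qed.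

End Product.

(** The involution exchanges the right oriented strands with the left oriented ones. *)
Lemma valid_balanced (o : seq bool) f : @valid o f -> count id o = count negb o.
Proof.
move=> /forallP h; have fK : involutive f by move=> j; have /andP[/eqP] := h j.
have cE (b : pred bool) : count b o = (\sum_(j < size o) b (nth true o j))%N.
  by rewrite -sum1_count big_mkcond (big_nth true) big_mkord; apply: eq_bigr => j _; case: (b _).
rewrite !cE (reindex_inj (inv_inj fK)); apply: eq_bigr => j _.
by have /andP[_] := h j; case: (nth _ _ (f j)); case: (nth _ _ j).
Qed.

Lemma ruling_poly2_unbalanced (R : comUnitRingType) (z : R) (la mu : intpart) :
  sumn la != sumn mu -> ruling_poly2 z (front_mul (frontA_part la) (frontAneg_part mu)) = 0.
Proof.
move=> ne; rewrite (ruling_poly2_amp z (events_product la mu) (gap_product la mu)).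
apply: big_pred0 => f; apply: contraNF ne => /valid_balanced.
by rewrite !count_cat !count_nseq /= !mul1n !mul0n addn0 => ->.
Qed.

Lemma ruling_poly2_empty (R : comUnitRingType) (z : R) (la mu : intpart) :
  la = [::] :> seq nat -> mu = [::] :> seq nat ->
  ruling_poly2 z (front_mul (frontA_part la) (frontAneg_part mu)) = 1.
Proof.
move=> la0 mu0.
rewrite (ruling_poly2_amp z (events_product la mu) (gap_product la mu)) la0 mu0 /=.
have E (f g : {ffun 'I_0 -> 'I_0}) : f = g by apply/ffunP => -[].
rewrite (big_pred1 [ffun i => i]) => [|f]; first by rewrite eqxx.
rewrite [f](E _ [ffun i => i]) [RHS]/= eqxx; apply/forallP => -[] //.
Qed.

(** * The free commutative algebra *)

Section FreeCommutativeAlgebra.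
Import finmap monalg.
Variables (R : comNzRingType) (I : choiceType) (S : comAlgType R) (v : I -> S).

Definition cmeval (m : {cmonom I}) : S := \prod_(i <- finsupp m) v i ^+ m i.

Lemma cmevalEw (m : {cmonom I}) (d : {fset I}) : (finsupp m `<=` d)%fset ->
  cmeval m = \prod_(i <- d) v i ^+ m i.
Proof.
move=> le; rewrite /cmeval (big_fset_incl _ le) // => i _.
by rewrite -cmE_neq0 negbK => /eqP ->.
Qed.

Lemma cmeval_mmorphism : mmorphism cmeval.
Proof.
split=> [m1 m2|]; last by rewrite /cmeval mdom1 big_seq_fset0.
rewrite /cmeval mdomD -!/(cmeval _) (cmevalEw (fsubsetUl _ (finsupp m2))).
rewrite (cmevalEw (fsubsetUr (finsupp m1) _)) -big_split /=.
by apply: eq_bigr => i _; rewrite cmM exprD.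
Qed.

HB.instance Definition _ := isMultiplicative.Build {cmonom I} S cmeval cmeval_mmorphism.

Definition malg_eval : {malg R[{cmonom I}]} -> S := mmap (in_alg S) cmeval.

HB.instance Definition _ := GRing.RMorphism.on malg_eval.

Lemma malg_eval_scalable : scalable malg_eval.
Proof. by move=> c g; rewrite /malg_eval mmapZ mulr_algl. Qed.

HB.instance Definition _ :=
  GRing.isScalable.Build R {malg R[{cmonom I}]} S *:%R malg_eval malg_eval_scalable.

Lemma malg_evalU i : malg_eval << ucm i >> = v i.
Proof. by rewrite /malg_eval mmapU /= scale1r mul1r /cmeval mdomU big_seq_fset1 cmUU. Qed.

(** The universal property of the free commutative algebra on [I]. *)
Lemma malg_lrmorphism : exists Theta : {lrmorphism {malg R[{cmonom I}]} -> S},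
  forall i, Theta << ucm i >> = v i.
Proof. exists malg_eval; exact: malg_evalU. Qed.

End FreeCommutativeAlgebra.

Lemma expr_eq_exprV (F : fieldType) (x : F) m : x != 0 -> x ^+ m = x ^- m -> x ^+ m * x ^+ m = 1.
Proof. by move=> x0 {1}->; rewrite mulVf // expf_neq0. Qed.

(** Otherwise s^(2 m) = 1, against the degree in s. *)
Lemma sR_pow_neq0 m : (0 < m)%N -> sR ^+ m - sR^-1 ^+ m != 0.
Proof.
move=> m0; have s0 : s_rf != 0 by rewrite tofrac_eq0 polyX_eq0.
apply/eqP => /(congr1 val).
have -> : val (sR ^+ m - sR^-1 ^+ m) = s_rf ^+ m - s_rf ^- m.
  by rewrite rmorphB !rmorphXn /= (Rprime_valV sR_unit) exprVn.
rewrite rmorph0 => /eqP; rewrite subr_eq0 => /eqP h.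
have : s_rf ^+ (m + m) == 1 by rewrite exprD (expr_eq_exprV s0 h).
rewrite /s_rf -tofracXn -tofrac1 tofrac_eq => /eqP.
move/(congr1 (fun p : {poly {poly int}} => size p)).
by rewrite size_polyXn size_poly1; lia.
Qed.

Lemma Rprime_2_neq0 : 2%:R != 0 :> Rprime.
Proof.
apply/eqP => /(congr1 val); rewrite rmorph_nat rmorph0 => /eqP.
by rewrite -[2%:R](rmorph_nat (@tofrac _)) tofrac_eq0 -!polyC_natr !polyC_eq0.
Qed.

Lemma kerP_series (R : idomainType) (s : R) p :
  s \is a GRing.unit ->
  fps_scale s%:A (gser (hl_coef s) p) = fps_scale s^-1%:A (gser (hl_coef s) p) *
  kerP s (@mvar R p) p.
Proof.
move=> s_unit; rewrite /gser /kerP !rmorph_prod -big_split /=; apply: eq_bigr => k _.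
rewrite hl_factor /mvar valK; exact: scale_ker.
Qed.

(** The generators are free and z is a unit, so the values Y_m / z can be prescribed; the variable
    of index i is A_(i+1), hence the shift. *)
Lemma skA_hom (S : comAlgType Rprime) (Y : nat -> S) :
  exists Theta : {lrmorphism Cplus -> S},
    forall m, (0 < m)%N -> zR *: Theta (skA m) = Y m.
Proof.
have [Theta ThetaE] := malg_lrmorphism (fun i : nat => zR^-1 *: Y i.+1).
exists Theta => -[//|m] _; rewrite /skA ThetaE scalerA divrr ?zR_unit //.
by rewrite scale1r.
Qed.

(** * Equality of the form and the ruling polynomial *)

Section Equality.
Variables (phi : {lrmorphism Cplus -> symfun Rprime}) (phi_bij : bijective phi).
Variables (Q : intpart -> Cplus) (Q_schur : forall la : intpart, is_schur la (phi (Q la))).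
Hypothesis A_hooks : forall m : nat, (0 < m)%N ->
       skA m = \sum_(p : 'I_m * 'I_m | (p.1 + p.2 == m.-1)%N)
                 ((-1) ^+ p.2 * sR ^ (p.1%:Z - p.2%:Z)) *: Q (hook p.1 p.2).
Variables (form : {biscalar Cplus}) (form_Q : forall la mu : intpart, form (Q la) (Q mu) = (la == mu)%:R).

(** The blocks of [la] index the variables u, so [form_A] is applied with the two partitions
    exchanged; the power of z multiplying both sides is a unit and cancels. *)
Lemma form_ruling (la mu : intpart) : form (skA_part la) (skA_part mu) =
    ruling_poly2 zR (front_mul (frontA_part la) (frontAneg_part mu)).
Proof.
have phi_inj := bij_inj phi_bij.
have la0 := intpart_gt0 la; have mu0 := intpart_gt0 mu.
have zu : zR ^+ (size mu + size la) \is a GRing.unit by rewrite unitrX // zR_unit.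
have [e|ne] := eqVneq (sumn la) (sumn mu); last first.
  rewrite ruling_poly2_unbalanced //; apply: (mulrI zu); rewrite mulr0.
  apply: (form_A_unbalanced phi_inj Q_schur Rprime_2_neq0 sR_unit A_hooks form_Q) => //.
  by rewrite eq_sym.
pose p := size la; pose Y := kerP sR (@mvar Rprime p) p.
have [Theta ThetaE] := skA_hom Y.
have formE := form_A phi_inj Q_schur Rprime_2_neq0 sR_unit sR_pow_neq0 A_hooks
  (kerP0 sR_unit _ _) (kerP_series p sR_unit) ThetaE form_Q mu0 la0 (erefl _).
apply: (mulrI zu); rewrite /skA_part formE.
(* [ruling_coef] reads a first bottom block, so the empty front is treated apart; both sides are
   then 1. *)
have [mu_nil|mu_n0] := eqVneq (mu : seq nat) [::]; last first.
  rewrite addnC ruling_coef //; [exact: sR_unit | exact: events_product |].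
  by move=> k; rewrite gap_product e.
have la_nil : la = [::] :> seq nat.
  by move: e la0; rewrite mu_nil /=; case: (la : seq nat) => // -[].
rewrite ruling_poly2_empty // mulr1 mu_nil big_nil mcoeff1 la_nil expr0.
case: eqP => // -[]; apply/mnmP => -[i lt_i]; exfalso.
by move: lt_i; rewrite /p la_nil.
Qed.
End Equality.

Theorem theorem5p6
    (* the isomorphism C^+ -> Lambda, and Q_la corresponding to s_la *)
    (phi : {lrmorphism Cplus -> symfun Rprime}) (phi_bij : bijective phi)
    (Q : intpart -> Cplus)
    (Q_schur : forall la : intpart, is_schur la (phi (Q la)))
    (A_hooks : forall m : nat, (0 < m)%N ->
       skA m = \sum_(p : 'I_m * 'I_m | (p.1 + p.2 == m.-1)%N)
                 ((-1) ^+ p.2 * sR ^ (p.1%:Z - p.2%:Z)) *: Q (hook p.1 p.2))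
    (* the form ( , ) *)
    (form : {biscalar Cplus})
    (form_Q : forall la mu : intpart, form (Q la) (Q mu) = (la == mu)%:R)
    (* the form < , > *)
    (bracket : {biscalar Cplus})
    (bracket_A : forall la mu : intpart,
       bracket (skA_part la) (skA_part mu) =
         ruling_poly2 zR (front_mul (frontA_part la) (frontAneg_part mu)))
    (la mu : intpart) :
  form (skA_part la) (skA_part mu) =
    ruling_poly2 zR (front_mul (frontA_part la) (frontAneg_part mu))
  /\ ruling_poly2 zR (front_mul (frontA_part la) (frontAneg_part mu)) =
       bracket (skA_part la) (skA_part mu).
Proof.
split; last by rewrite bracket_A.
exact: (form_ruling phi_bij Q_schur A_hooks form_Q).
Qed.
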